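(* Let $x_0\in\mathbb{R}^m$, let $G$ be a full-rank (deterministic) $n\times m$ matrix, and let $$b,\sigma:\Omega\times\{0,\dots,T-1\}\times\mathbb{R}^m\times\mathbb{R}^n\times\mathbb{R}^n\to\mathbb{R}^m,\quad f:\Omega\times\{1,\dots,T\}\times\mathbb{R}^m\times\mathbb{R}^n\times\mathbb{R}^n\to\mathbb{R}^n,\quad h:\Omega\times\mathbb{R}^m\to\mathbb{R}^n,$$ with the conventions $b(T,\cdot)\equiv0$, $\sigma(T,\cdot)\equiv 0$, $f(0,\cdot)\equiv 0$. For $\lambda=(x,y,z)\in\mathbb{R}^m\times\mathbb{R}^n\times\mathbb{R}^n$ put $$A(t,\lambda)=\begin{pmatrix}-G^*f(t,\lambda)\\ Gb(t,\lambda)\\ G\sigma(t,\lambda)\end{pmatrix}.$$ Assume: (i) (Lipschitz) $b,\sigma,f$ are uniformly Lipschitz continuous in $\lambda$, and $f$ is independent of $z$ at $t=T$: there is $c>0$ such that $P$-a.s., for all $t\in\{0,\dots,T-1\}$ and all $\lambda=(x,y,z),\lambda'=(x',y',z')$, $|\varphi(t,\lambda)-\varphi(t,\lambda')|\le c|\lambda-\lambda'|$ for $\varphi\in\{b,\sigma,f,A\}$, $|h(x)-h(x')|\le c|x-x'|$, and $|f(T,x,y,z)-f(T,x',y',z')|\le c(|x-x'|+|y-y'|)$. (ii) For every $\lambda$, the processes $b(\cdot,\lambda),\sigma(\cdot,\lambda)$ (on $\{0,\dots,T-1\}$) and $f(\cdot,\lambda)$ (on $\{1,\dots,T\}$) are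 adapted and square integrable, and $h(x)\in L^2(\mathcal{F}_T;\mathbb{R}^n)$ for every $x$. (iii) (Monotonicity) There are constants $\beta_1,\beta_2\ge0$ with $\beta_1+\beta_2>0$, and moreover $\beta_1>0$ if $n>m$ and $\beta_2>0$ if $m>n$, such that for all $\lambda=(x,y,z)$, $\lambda'=(x',y',z')$, $P$-a.s.: for $t\in\{1,\dots,T-1\}$, $$\langle A(t,\lambda)-A(t,\lambda'),\lambda-\lambda'\rangle\le-\beta_1|G(x-x')|^2-\beta_2|G^*(y-y')|^2-\beta_2|G^*(z-z')|^2;$$ for $t=T$, $$\langle -G^*f(T,x,y,z)+G^*f(T,x',y',z'),x-x'\rangle\le-\beta_1|G(x-x')|^2;$$ for $t=0$, $$\langle Gb(0,\lambda)-Gb(0,\lambda'),y-y'\rangle+\langle G\sigma(0,\lambda)-G\sigma(0,\lambda'),z-z'\rangle\le-\beta_2|G^*(y-y')|^2-\beta_2|G^*(z-z')|^2;$$ and $$\langle h(x)-h(x'),G(x-x')\rangle\ge0.$$ Then the forward-backward stochastic difference equation $$\begin{cases}\Delta X_t=b(t,X_t,Y_t,Z_t)+\sigma(t,X_t,Y_t,Z_t)\Delta W_t,\\ \Delta Y_t=-f(t+1,X_{t+1},Y_{t+1},Z_{t+1})+Z_t\Delta W_t+\Delta N_t,\\ X_0=x_0,\qquad Y_T=h(X_T),\end{cases}\qquad t\in\{0,\dots,T-1\},$$ has a unique adapted solution $(X,Y,Z,N)\in\mathcal{M}^2(0,T;\mathbb{R}^m)\times\mathcal{M}^2(0,T;\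mathbb{R}^n)\times\mathcal{M}^2(0,T-1;\mathbb{R}^n)\times\mathcal{M}^2(0,T;\mathbb{R}^n)$.
   Context: Let $T\ge 1$ be an integer and $(\Omega,\mathcal{F},\{\mathcal{F}_t\}_{0\le t\le T},P)$ a filtered probability space in discrete time $t\in\{0,1,\dots,T\}$, with $\mathcal{F}_0$ trivial (up to $P$-null sets) and $\mathcal{F}=\mathcal{F}_T$. For an adapted process $U$, $\Delta U_t=U_{t+1}-U_t$. $W$ is a fixed one-dimensional square integrable martingale with independent increments: $\mathbb{E}[\Delta W_t|\mathcal{F}_t]=\mathbb{E}[\Delta W_t]=0$ and $\mathbb{E}[(\Delta W_t)^2]=1$ for $t\in\{0,\dots,T-1\}$. $\mathcal{F}_t$ is the completion of the $\sigma$-algebra generated by $W$ up to time $t$. $^*$ denotes transposition. $L^2(\mathcal{F}_t;\mathbb{R}^n)$ is the set of $\mathcal{F}_t$-measurable square integrable $\mathbb{R}^n$-valued random variables; $\mathcal{M}^2(s,t;E)$ is the set of adapted square integrable $E$-valued processes indexed by $\{s,\dots,t\}$. $\langle\cdot,\cdot\rangle$ and $|\cdot|$ are the Euclidean inner product and norm. A solution is a quadruple $(X,Y,Z,N)$ in the spaces stated in the claim satisfying the equations $P$-a.s. at all times, where $N$ is a martingale strongly orthogonal to $W$ (i.e. $N_tW_t$ is a martingale), normalized by $N_0=0$. Since $f(T,\cdot)$ does not depend on $z$, no value $Z_T$ is needed. Processes are identified if equal $P$-a.s. at each time. *)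

(* Defs.v *)
From HB Require Import structures.
From mathcomp Require Import all_boot all_order all_algebra.
From mathcomp Require Import all_classical all_reals all_analysis.
Set Implicit Arguments.
Unset Strict Implicit.
Unset Printing Implicit Defensive.
Import Order.TTheory GRing.Theory Num.Theory.

Local Open Scope classical_set_scope.
Local Open Scope ring_scope.

(* The norm `|_| of the library on matrices is the sup norm, hence the
   Euclidean one is introduced here. *)
Definition dot (R : realType) (k : nat) (u v : 'cV[R]_k) : R :=
  \sum_(i < k) u i 0 * v i 0.

Definition enorm (R : realType) (k : nat) (u : 'cV[R]_k) : R :=
  Num.sqrt (dot u u).

(* Processes are functions of all t : nat; only the values at the times of the
   index set at hand are ever constrained. *)
Definition delta (Omega : Type) (V : zmodType) (U : nat -> Omega -> V)
  (t : nat) (w : Omega) : V := U t.+1 w - U t w.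

(* Measurability of f with respect to a sigma-algebra G which need not be the
   canonical one on Omega. *)
Definition measurable_wrt (Omega : Type) (R : realType)
  (G : set (set Omega)) (f : Omega -> R) : Prop :=
  preimage_set_system [set: Omega] f measurable `<=` G.

(* L^2(G; R^k) *)
Definition L2 (d : measure_display) (Omega : measurableType d) (R : realType)
  (P : probability Omega R) (G : set (set Omega)) (k : nat)
  (U : Omega -> 'cV[R]_k) : Prop :=
  (forall i : 'I_k, measurable_wrt G (fun w => U w i 0)) /\
  (\int[P]_w ((enorm (U w)) ^+ 2)%:E < +oo)%E.

(* M^2(s, t; R^k) *)
Definition M2 (d : measure_display) (Omega : measurableType d) (R : realType)
  (P : probability Omega R) (F : nat -> set (set Omega)) (s t : nat) (k : nat)
  (U : nat -> Omega -> 'cV[R]_k) : Prop :=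
  forall r : nat, (s <= r <= t)%N -> L2 P (F r) (U r).

(* Y is a version of E[X | G] *)
Definition is_cond_exp (d : measure_display) (Omega : measurableType d)
  (R : realType) (P : probability Omega R) (G : set (set Omega))
  (X Y : Omega -> R) : Prop :=
  [/\ P.-integrable [set: Omega] (EFin \o X),
      measurable_wrt G Y,
      P.-integrable [set: Omega] (EFin \o Y) &
      forall A : set Omega, G A ->
        (\int[P]_(w in A) (Y w)%:E = \int[P]_(w in A) (X w)%:E)%E].

Definition martingale (d : measure_display) (Omega : measurableType d)
  (R : realType) (P : probability Omega R) (F : nat -> set (set Omega))
  (T : nat) (M : nat -> Omega -> R) : Prop :=
  (forall t : nat, (t <= T)%N ->
     measurable_wrt (F t) (M t) /\
     P.-integrable [set: Omega] (EFin \o M t)) /\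
  (forall s t : nat, (s <= t <= T)%N -> is_cond_exp P (F s) (M t) (M s)).

Definition indep_of (d : measure_display) (Omega : measurableType d)
  (R : realType) (P : probability Omega R) (G : set (set Omega))
  (X : Omega -> R) : Prop :=
  forall (A : set Omega) (B : set R), G A -> measurable B ->
    P (A `&` X @^-1` B) = (P A * P (X @^-1` B))%E.

(* The sigma-algebra generated by W_0, ..., W_t, completed by the P-null
   sets. *)
Definition history (d : measure_display) (Omega : measurableType d)
  (R : realType) (P : probability Omega R) (W : nat -> Omega -> R) (t : nat) :
  set (set Omega) :=
  <<s (\bigcup_(s in [set s : nat | (s <= t)%N])
         preimage_set_system [set: Omega] (W s) measurable)
      `|` [set A | P.-negligible A] >>.

Record driving_noise (d : measure_display) (Omega : measurableType d)
    (R : realType) (P : probability Omega R) (T : nat)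
    (W : nat -> Omega -> R) : Prop := DrivingNoise {
  noise_full : history P W T = measurable;
  noise_trivial : forall A : set Omega, history P W 0 A ->
    P A = 0%E \/ P A = 1%E;
  noise_martingale : martingale P (history P W) T W;
  noise_square_integrable : forall t : nat, (t <= T)%N ->
    (\int[P]_w ((W t w) ^+ 2)%:E < +oo)%E;
  noise_indep : forall s t : nat, (s <= t <= T)%N ->
    indep_of P (history P W s) (fun w => W t w - W s w);
  noise_cond_mean : forall t : nat, (t < T)%N ->
    is_cond_exp P (history P W t) (delta W t) (fun _ => 0);
  noise_mean : forall t : nat, (t < T)%N -> 'E_P[delta W t]%E = 0%E;
  noise_variance : forall t : nat, (t < T)%N ->
    'E_P[fun w => ((delta W t w) ^+ 2)%R]%E = 1%E
}.

Definition stack (R : realType) (m n : nat) (x : 'cV[R]_m) (y z : 'cV[R]_n) :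
  'cV[R]_(m + (n + n)) := col_mx x (col_mx y z).

Definition coefA (Omega : Type) (R : realType) (m n : nat) (G : 'M[R]_(n, m))
  (b sigma : nat -> Omega -> 'cV[R]_m -> 'cV[R]_n -> 'cV[R]_n -> 'cV[R]_m)
  (f : nat -> Omega -> 'cV[R]_m -> 'cV[R]_n -> 'cV[R]_n -> 'cV[R]_n)
  (t : nat) (w : Omega) (x : 'cV[R]_m) (y z : 'cV[R]_n) :
  'cV[R]_(m + (n + n)) :=
  stack (- (G^T *m f t w x y z)) (G *m b t w x y z) (G *m sigma t w x y z).

(* Z T occurs in the backward equation only at t = T - 1, as an argument of
   f T, which is meant not to depend on it; Z T is otherwise unconstrained. *)
Record fbsde_solution (d : measure_display) (Omega : measurableType d)
    (R : realType) (P : probability Omega R) (T : nat) (W : nat -> Omega -> R)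
    (m n : nat) (x0 : 'cV[R]_m)
    (b sigma : nat -> Omega -> 'cV[R]_m -> 'cV[R]_n -> 'cV[R]_n -> 'cV[R]_m)
    (f : nat -> Omega -> 'cV[R]_m -> 'cV[R]_n -> 'cV[R]_n -> 'cV[R]_n)
    (h : Omega -> 'cV[R]_m -> 'cV[R]_n)
    (X : nat -> Omega -> 'cV[R]_m) (Y Z N : nat -> Omega -> 'cV[R]_n) :
    Prop := FBSDESolution {
  sol_X : M2 P (history P W) 0 T X;
  sol_Y : M2 P (history P W) 0 T Y;
  sol_Z : M2 P (history P W) 0 T.-1 Z;
  sol_N : M2 P (history P W) 0 T N;
  sol_N0 : {ae P, forall w, N 0%N w = 0};
  sol_N_martingale : forall i : 'I_n,
    martingale P (history P W) T (fun t w => N t w i 0);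
  sol_N_orthogonal : forall i : 'I_n,
    martingale P (history P W) T (fun t w => N t w i 0 * W t w);
  sol_forward : forall t : nat, (t < T)%N -> {ae P, forall w,
    delta X t w = b t w (X t w) (Y t w) (Z t w)
                  + delta W t w *: sigma t w (X t w) (Y t w) (Z t w)};
  sol_backward : forall t : nat, (t < T)%N -> {ae P, forall w,
    delta Y t w = - f t.+1 w (X t.+1 w) (Y t.+1 w) (Z t.+1 w)
                  + delta W t w *: Z t w + delta N t w};
  sol_initial : {ae P, forall w, X 0%N w = x0};
  sol_terminal : {ae P, forall w, Y T w = h w (X T w)}
}.

(* Main.v *)
(**
Write E_t for conditional expectation given F_t. The backward equation says
exactly that (Y_t, Z_t) = (E_t[eta], E_t[eta dW_t]) with
eta = Y_{t+1} + f(t+1, X_{t+1}, Y_{t+1}, Z_{t+1}), the remainder being the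
increment of N; equivalently U_t = (Y_t, Z_t) is the image of eta under the
adjoint Pi_t of the isometry S_t (y, z) = y + z dW_t of L^2(F_t) x L^2(F_t) into
L^2(F_{t+1}). The solution is decoupled backwards in time: the map Phi_t that
sends X_t to Y_t + f(t, X_t, Y_t, Z_t) is well defined and Lipschitz on L^2(F_t)
and satisfies E<Phi_t X - Phi_t X', G(X - X')> >= beta1 E|G(X - X')|^2.

One step backwards means solving U = Pi (Phi (X + S B(X, U))), B = (b, sigma), in
L^2(F_t). If beta1 > 0 and G is injective this is V = B(X, Psi V) for
Psi V = Pi (Phi (X + S V)); the map V - B(X, Psi V) is strongly monotone relative
to the strongly monotone map G^* Psi. If beta2 > 0 and G^* is injective,
U - Psi (B(X, U)) is strongly monotone relative to the strongly monotone map
U |-> - G B(X, U). Both cases follow from Zarantonello's theorem, applied twice.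
The full rank of G and the sign conditions on beta1, beta2 guarantee one of them.
*)

Require Import Defs.
From HB Require Import structures.
From mathcomp Require Import all_boot all_order all_algebra.
From mathcomp Require Import all_classical all_reals all_analysis.
From mathcomp Require Import measurable_realfun ring lra.
Import Order.TTheory GRing.Theory Num.Theory.
Import numFieldNormedType.Exports.

Set Implicit Arguments.
Unset Strict Implicit.
Unset Printing Implicit Defensive.

Local Open Scope classical_set_scope.
Local Open Scope ring_scope.

(** * Euclidean vectors *)

(** The Lipschitz constants are arbitrary, so the step equation is out of reach of a direct
    contraction, and the operators V - B(X, Psi V) and U - Psi (B(X, U)) are in general not
    monotone. They become so only when paired with the increments of a second, strongly monotone map
    E. Zarantonello's theorem first inverts E, and then solves for the composition with that
    inverse, which is strongly monotone in the usual sense. The backward induction closes because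
    the energy identity of one step returns the lower bound with the same constant beta1. The
    Lipschitz constant may deteriorate, which finitely many steps allow. Two obstacles come from
    measure theory. Random vectors are not identified when equal almost surely, so L^2 is a
    semi-inner product space and equations hold up to null vectors. Monotonicity is assumed almost
    surely for each fixed pair of arguments but applied to random ones; continuity in lambda and a
    countable grid bridge the gap. No conditional expectation is constructed: Pi comes from the
    Riesz representation theorem, and N collects the part of eta orthogonal to the range of S, as W
    need not have the representation property. *)

Section dot_theory.
Variable R : realType.
Implicit Types k m n : nat.

Lemma dotC k (u v : 'cV[R]_k) : dot u v = dot v u.
Proof. by apply: eq_bigr => i _; rewrite mulrC. Qed.

Lemma dotDl k (u v w : 'cV[R]_k) : dot (u + v) w = dot u w + dot v w.
Proof. by rewrite -big_split; apply: eq_bigr => i _; rewrite !mxE mulrDl. Qed.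

Lemma dotZl k a (u w : 'cV[R]_k) : dot (a *: u) w = a * dot u w.
Proof. by rewrite /dot mulr_sumr; apply: eq_bigr => i _; rewrite !mxE mulrA.
Qed.

Lemma dotNl k (u w : 'cV[R]_k) : dot (- u) w = - dot u w.
Proof. by rewrite -scaleN1r dotZl mulN1r. Qed.

Lemma dot0l k (w : 'cV[R]_k) : dot 0 w = 0.
Proof. by rewrite -(scale0r 0) dotZl mul0r. Qed.

Lemma dotDr k (u v w : 'cV[R]_k) : dot u (v + w) = dot u v + dot u w.
Proof. by rewrite dotC dotDl !(dotC u). Qed.

Lemma dotZr k a (u w : 'cV[R]_k) : dot u (a *: w) = a * dot u w.
Proof. by rewrite dotC dotZl dotC. Qed.

Lemma dotNr k (u w : 'cV[R]_k) : dot u (- w) = - dot u w.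
Proof. by rewrite dotC dotNl dotC. Qed.

Lemma dot0r k (u : 'cV[R]_k) : dot u 0 = 0.
Proof. by rewrite dotC dot0l. Qed.

Definition dotE := (dotDl, dotDr, dotNl, dotNr, dotZl, dotZr, dot0l, dot0r).

Lemma dot_ge0 k (u : 'cV[R]_k) : 0 <= dot u u.
Proof. by apply: sumr_ge0 => i _; rewrite -expr2 sqr_ge0. Qed.

Lemma le_sqr_dot k (u : 'cV[R]_k) i : u i 0 ^+ 2 <= dot u u.
Proof.
rewrite /dot (bigD1 i) //= -expr2 lerDl.
by apply: sumr_ge0 => j _; rewrite -expr2 sqr_ge0.
Qed.

Lemma dot_eq0 k (u : 'cV[R]_k) : dot u u = 0 -> u = 0.
Proof.
move=> u0; apply/colP => i; rewrite mxE; apply/eqP; rewrite -sqrf_eq0.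
by rewrite eq_le sqr_ge0 andbT -u0 le_sqr_dot.
Qed.

Lemma enorm_sqr k (u : 'cV[R]_k) : enorm u ^+ 2 = dot u u.
Proof. by rewrite sqr_sqrtr // dot_ge0. Qed.

Lemma enorm_ge0 k (u : 'cV[R]_k) : 0 <= enorm u.
Proof. exact: sqrtr_ge0. Qed.

Lemma enorm0 k : enorm (0 : 'cV[R]_k) = 0.
Proof. by rewrite /enorm dot0l sqrtr0. Qed.

Lemma dot_col_mx k m (a c : 'cV[R]_k) (b d : 'cV[R]_m) :
  dot (col_mx a b) (col_mx c d) = dot a c + dot b d.
Proof.
rewrite /dot big_split_ord /=; congr (_ + _); apply: eq_bigr => i _.
- by rewrite !col_mxEu.
- by rewrite !col_mxEd.
Qed.

Lemma dot_adjl m n (A : 'M[R]_(m, n)) u v : dot (A *m u) v = dot u (A^T *m v).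
Proof.
have dotmx k (a b : 'cV[R]_k) : dot a b = (a^T *m b) 0 0.
  by rewrite /dot mxE; apply: eq_bigr => i _; rewrite mxE.
by rewrite !dotmx trmx_mul mulmxA.
Qed.


Lemma dot_young k (u v : 'cV[R]_k) : dot u v <= (dot u u + dot v v) / 2.
Proof. have := dot_ge0 (u - v); rewrite !dotE (dotC v u); lra. Qed.

Lemma norm_dot_le k (u v : 'cV[R]_k) : `|dot u v| <= (dot u u + dot v v) / 2.
Proof.
have := dot_young u v; have := dot_young (- u) v; rewrite !dotE.
by rewrite ler_norml; lra.
Qed.

Lemma dotD_le k (u v : 'cV[R]_k) : dot (u + v) (u + v) <= 2 * (dot u u + dot v
    v).
Proof. have := dot_young u v; rewrite !dotE (dotC v u); lra. Qed.

(** The minimum over t is at t = c / b. Besides both Cauchy-Schwarz inequalities, this yields the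
    approximate Euler equation in the Riesz theorem. *)
Lemma discriminant_le (a b c : R) : 0 <= b ->
  (forall t, 0 <= a - 2 * t * c + t ^+ 2 * b) -> c ^+ 2 <= a * b.
Proof.
move=> b_ge0 q_ge0; have a_ge0 : 0 <= a by have := q_ge0 0; rewrite expr0n /=;
    lra.
have [b_gt0|b_le0] := ltP 0 b.
  have := q_ge0 (c / b); rewrite -(pmulr_rge0 _ b_gt0).
  have -> : b * (a - 2 * (c / b) * c + (c / b) ^+ 2 * b) = a * b - c ^+ 2.
    by field; lra.
  lra.
have b0 : b = 0 by lra.
have [->|c_neq0] := eqVneq c 0; first by rewrite expr0n /= mulr_ge0.
(* For b = 0 the polynomial is affine in t, and at this t it takes the value -1. *)
have := q_ge0 ((a + 1) / (2 * c)).
have -> : 2 * ((a + 1) / (2 * c)) * c = a + 1 by field.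
rewrite b0; lra.
Qed.

Lemma dot_cauchy_schwarz k (u v : 'cV[R]_k) :
  dot u v ^+ 2 <= dot u u * dot v v.
Proof.
apply: discriminant_le => [|t]; first exact: dot_ge0.
have := dot_ge0 (u - t *: v).
by rewrite !dotE (dotC v u); lra.
Qed.

(** Cauchy-Schwarz row by row; the constant is the squared Frobenius norm. *)
Lemma dot_mulmx_le m n (A : 'M[R]_(m, n)) :
  exists2 C, 0 <= C & forall u, dot (A *m u) (A *m u) <= C * dot u u.
Proof.
exists (\sum_i dot (row i A)^T (row i A)^T).
  by apply: sumr_ge0 => ? _; exact: dot_ge0.
move=> u; rewrite {1}/dot mulr_suml; apply: ler_sum => i _; rewrite -expr2.
apply: le_trans (dot_cauchy_schwarz _ _); rewrite le_eqVlt; apply/orP; left.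
by apply/eqP; congr (_ ^+ 2); rewrite mxE; apply: eq_bigr => j _; rewrite !mxE.
Qed.

Lemma dot_le_mulmx_inj m n (A : 'M[R]_(m, n)) : \rank A = n ->
  exists2 C, 0 < C & forall u, dot u u <= C * dot (A *m u) (A *m u).
Proof.
move=> rkA; have [B BA] : exists B, B *m A = 1%:M.
  by apply/row_fullP; rewrite /row_full rkA.
have [C C0 CP] := dot_mulmx_le B.
(* Adding 1 keeps the constant strictly positive even if C = 0. *)
exists (C + 1) => [|u]; first by lra.
have := CP (A *m u); rewrite mulmxA BA mul1mx => /le_trans; apply.
by rewrite ler_wpM2r ?dot_ge0 //; lra.
Qed.

End dot_theory.

(** * Monotone operators in semi-inner product spaces *)

(** Limits in a semi-Hilbert space are given by a geometric rate only, so passages to the limit take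
    this form. *)
Lemma le_geometric_le0 (R : realType) (x A r : R) : 0 <= r < 1 ->
  (forall k, x <= A * r ^+ k) -> x <= 0.
Proof.
move=> /andP[r_ge0 r_lt1] le_x.
have := @cvg_geometric R A r; rewrite ger0_norm // => /(_ r_lt1) cvg0.
by apply: (@cvgr_to_ge _ _ _ _ _ _ _ cvg0); apply: nearW => k; exact: le_x.
Qed.

(** To be read with s = |u|^2, e = |v|^2 and x = <u, v>: a lower bound on <u, v> becomes one on |v|.
    This is the source of the Lipschitz constants of inverses, of Pi and of the step solution. *)
Lemma le_of_cauchy_schwarz (R : realType) (mu s e x : R) :
  0 < mu -> 0 <= s -> 0 <= e -> x ^+ 2 <= e * s -> mu * s <= x ->
  mu ^+ 2 * s <= e.
Proof.
move=> mu0 s0 e0 xe mux.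
have [->|s_neq0] := eqVneq s 0; first by rewrite mulr0.
have s_gt0 : 0 < s by rewrite lt_def s_neq0.
rewrite -(ler_pM2r s_gt0); apply: le_trans xe.
have -> : mu ^+ 2 * s * s = (mu * s) ^+ 2 by ring.
by rewrite ler_sqr // ?nnegrE ?(le_trans _ mux) // ltW // mulr_gt0.
Qed.

(* [ip] may be degenerate on the domain [D]: for L^2 this avoids quotienting by
   almost sure equality, and equations are solved up to null vectors. Completeness
   is only required for geometrically convergent sequences. *)
Record semi_hilbert (R : realType) (V : lmodType R) (D : V -> Prop)
    (ip : V -> V -> R) : Prop := SemiHilbert {
  dom0 : D 0;
  dom_lin : forall a u v, D u -> D v -> D (a *: u + v);
  ipC : forall u v, ip u v = ip v u;
  ip_lin : forall a u v w, D u -> D v -> D w ->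
    ip (a *: u + v) w = a * ip u w + ip v w;
  ip_ge0 : forall u, D u -> 0 <= ip u u;
  ip_complete : forall (u : nat -> V) (C s : R), (forall k, D (u k)) -> 0 < s <
      1 ->
    (forall k, ip (u k.+1 - u k) (u k.+1 - u k) <= C * (s ^+ 4) ^+ k) ->
    exists2 v, D v & exists K, forall k, ip (v - u k) (v - u k) <= K * (s ^+ 2)
        ^+ k
}.

Section semi_hilbert_theory.
Context (R : realType) (V : lmodType R) (D : V -> Prop) (ip : V -> V -> R).
Hypothesis H : semi_hilbert D ip.
Implicit Types u v w : V.
Local Notation sq u := (ip u u).

Lemma domZ a u : D u -> D (a *: u).
Proof. by move=> Du; rewrite -[_ *: _]addr0; apply: dom_lin H _ _ _ Du (dom0
    H). Qed.

Lemma domD u v : D u -> D v -> D (u + v).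
Proof. by move=> Du Dv; rewrite -[u]scale1r; exact: (dom_lin H). Qed.

Lemma domN u : D u -> D (- u).
Proof. by move=> Du; rewrite -scaleN1r; exact: domZ. Qed.

Lemma domB u v : D u -> D v -> D (u - v).
Proof. by move=> Du Dv; exact/domD/domN. Qed.

Let D0 : D 0 := dom0 H.
Local Hint Resolve domZ domD domN domB D0 : core.

Lemma ipDl u v w : D u -> D v -> D w -> ip (u + v) w = ip u w + ip v w.
Proof. by move=> Du Dv Dw; rewrite -{1}[u]scale1r (ip_lin H) // mul1r. Qed.

Lemma ip0l w : D w -> ip 0 w = 0.
Proof.
move=> Dw; have := ip_lin H 1 (dom0 H) (dom0 H) Dw.
by rewrite scaler0 addr0 mul1r => /eqP; rewrite -subr_eq0 opprD addNKr oppr_eq0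
    => /eqP.
Qed.

Lemma ipZl a u w : D u -> D w -> ip (a *: u) w = a * ip u w.
Proof.
by move=> Du Dw; rewrite -[_ *: _]addr0 (ip_lin H) ?ip0l ?addr0 //; exact: dom0.
Qed.

Lemma ipBl u v w : D u -> D v -> D w -> ip (u - v) w = ip u w - ip v w.
Proof. by move=> Du Dv Dw; rewrite -scaleN1r ipDl ?ipZl ?mulN1r //; auto. Qed.

Lemma ipNl u w : D u -> D w -> ip (- u) w = - ip u w.
Proof. by move=> Du Dw; rewrite -scaleN1r ipZl // mulN1r. Qed.

Lemma ipNr u w : D u -> D w -> ip u (- w) = - ip u w.
Proof. by move=> Du Dw; rewrite !(ipC H u) ipNl. Qed.

Lemma sqD u v : D u -> D v -> sq (u + v) = sq u + 2 * ip u v + sq v.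
Proof.
move=> Du Dv; rewrite ipDl ?[ip _ (u + v)](ipC H) ?ipDl //; auto.
by rewrite (ipC H v u); ring.
Qed.

Lemma sqZ a u : D u -> sq (a *: u) = a ^+ 2 * sq u.
Proof. by move=> Du; rewrite ipZl 1?(ipC H) ?ipZl //; auto; ring. Qed.

Lemma sqN u : D u -> sq (- u) = sq u.
Proof. by move=> Du; rewrite -scaleN1r sqZ // sqrrN expr1n mul1r. Qed.

Lemma sqBC u v : D u -> D v -> sq (u - v) = sq (v - u).
Proof. by move=> Du Dv; rewrite -opprB sqN //; auto. Qed.

Lemma sqB u v : D u -> D v -> sq (u - v) = sq u - 2 * ip u v + sq v.
Proof.
move=> Du Dv; rewrite -scaleN1r sqD ?sqZ; auto.
by rewrite (ipC H) ipZl // (ipC H); ring.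
Qed.

Lemma sqD_le u v : D u -> D v -> sq (u + v) <= 2 * (sq u + sq v).
Proof.
move=> Du Dv; have := ip_ge0 H (domB Du Dv).
by rewrite sqB // sqD //; lra.
Qed.

Lemma sqB_le u v : D u -> D v -> sq (u - v) <= 2 * (sq u + sq v).
Proof. by move=> Du Dv; rewrite -(sqN Dv); apply: sqD_le; auto. Qed.

Lemma ip_cauchy_schwarz u v : D u -> D v -> ip u v ^+ 2 <= sq u * sq v.
Proof.
move=> Du Dv; apply: discriminant_le => [|t]; first exact: (ip_ge0 H).
have := ip_ge0 H (domB Du (domZ t Dv)).
by rewrite sqB ?sqZ; auto; rewrite (ipC H) ipZl // (ipC H v); lra.
Qed.

Lemma ip_null u v : D u -> D v -> sq u = 0 -> ip u v = 0.
Proof.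
move=> Du Dv u0; apply/eqP; rewrite -sqrf_eq0 eq_le sqr_ge0 andbT.
by rewrite (le_trans (ip_cauchy_schwarz Du Dv)) // u0 mul0r.
Qed.

(** This replaces the quotient by null vectors. *)
Lemma ip_congr u u' v v' : D u -> D u' -> D v -> D v' ->
  sq (u - u') = 0 -> sq (v - v') = 0 -> ip u v = ip u' v'.
Proof.
move=> Du Du' Dv Dv' uu' vv'.
have := ip_null (domB Du Du') Dv uu'; rewrite ipBl //.
have := ip_null (domB Dv Dv') Du' vv'; rewrite ipBl // !(ipC H _ u').
by lra.
Qed.

(* Zarantonello: u - tau (F u - w) is a contraction for tau = mu / L. *)
Lemma strongly_monotone_surj (F : V -> V) (L mu : R) : 0 < mu ->
  (forall u, D u -> D (F u)) ->
  (forall u v, D u -> D v -> sq (F u - F v) <= L * sq (u - v)) ->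
  (forall u v, D u -> D v -> mu * sq (u - v) <= ip (F u - F v) (u - v)) ->
  forall w, D w -> exists2 u, D u & sq (F u - w) = 0.
Proof.
move=> mu0 DF FL Fmu w Dw.
(* The summand mu^2 makes the contraction factor q = 1 - mu^2 / L' positive; the absolute value and
   the 1 make L' positive and at least L for any sign of L. *)
pose L' := `|L| + mu ^+ 2 + 1.
have L'0 : 0 < L' by rewrite /L'; have := normr_ge0 L; nra.
have LL' : L <= L' by rewrite /L'; have := ler_norm L; nra.
pose tau := mu / L'; pose q := 1 - mu ^+ 2 / L'.
have tau0 : 0 < tau by exact: divr_gt0.
have q01 : 0 < q < 1.
  have : mu ^+ 2 / L' < 1 by rewrite ltr_pdivrMr // /L'; have := normr_ge0 L;
      lra.
  have : 0 < mu ^+ 2 / L' by rewrite divr_gt0 // exprn_gt0.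
  by rewrite /q => ? ?; apply/andP; split; lra.
have [q0 q1] := andP q01.
pose C u := u - tau *: (F u - w).
have DC u : D u -> D (C u) by rewrite /C; auto.
have Cq u v : D u -> D v -> sq (C u - C v) <= q * sq (u - v).
  move=> Du Dv.
  have -> : C u - C v = (u - v) - tau *: (F u - F v).
    rewrite /C opprD addrACA -opprD -scalerBr.
    by congr (_ - _ *: _); rewrite opprB addrA subrK.
  rewrite sqB ?sqZ; auto; rewrite (ipC H) ipZl; auto.
  have := FL _ _ Du Dv; have := Fmu _ _ Du Dv; have := ip_ge0 H (domB Du Dv).
  set s := sq (u - v); set x := ip _ _; set y := sq (F u - F v) => s0 mux yL.
  have yL' : tau ^+ 2 * y <= tau ^+ 2 * (L' * s).
    by rewrite ler_wpM2l ?sqr_ge0 // (le_trans yL) // ler_wpM2r.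
  have xm : 2 * tau * (mu * s) <= 2 * tau * x by rewrite ler_wpM2l //; lra.
  have -> : q * s = s - 2 * tau * (mu * s) + tau ^+ 2 * (L' * s).
    by rewrite /q /tau; field; lra.
  lra.
(* The fourth root puts the factor q in the form s^4 of [ip_complete]. *)
pose s := Num.sqrt (Num.sqrt q).
have s4 : s ^+ 4 = q.
  by rewrite (exprM s 2 2) !sqr_sqrtr ?sqrtr_ge0 // ltW.
have s01 : 0 < s < 1.
  rewrite !sqrtr_gt0 q0 /= ltNge; apply/negP => s1.
  have : 1 <= s ^+ 4 by exact: exprn_ege1.
  by rewrite s4; lra.
pose u k := iter k C 0.
have Du k : D (u k) by elim: k => [|k IH] /=; auto; exact: dom0.
have step k : sq (u k.+1 - u k) <= sq (C 0 - 0) * (s ^+ 4) ^+ k.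
  elim: k => [|k IH]; first by rewrite expr0 mulr1.
  rewrite exprS mulrCA {1}s4; apply: le_trans (Cq _ _ (Du k.+1) (Du k)) _.
  by rewrite (ler_wpM2l (ltW q0)).
have [v Dv [K vu]] := ip_complete H Du s01 step.
exists v => //; apply/eqP; rewrite eq_le (ip_ge0 H) ?andbT //; auto.
have s2 : 0 <= s ^+ 2 < 1.
  by have /andP[s0 s1] := s01; rewrite sqr_ge0 expr_lt1 // ltW.
rewrite -(pmulr_rle0 _ (exprn_gt0 2 tau0)) -sqZ; auto.
apply: (le_geometric_le0 s2 (A := 4 * K)) => k.
(* The left side is v - C v, and u_{k+1} = C u_k. Both summands have squared norm at most K s^(2k),
   whence the constant 4 K. *)
have -> : tau *: (F v - w) = (v - u k.+1) + (C (u k) - C v).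
  rewrite -[u k.+1]/(C (u k)) addrA subrK {1}/C.
  by rewrite opprB addrC subrK.
apply: le_trans (sqD_le _ _) _; auto.
have := Cq _ _ (Du k) Dv; have := vu k; have := vu k.+1.
rewrite (sqBC (Du k) Dv); have := ip_ge0 H (domB Dv (Du k)).
rewrite exprS; have := exprn_ge0 k (sqr_ge0 s); set r := (s ^+ 2) ^+ k.
set a := sq (v - u k); set b := sq (v - u k.+1); set e := sq (C _ - _).
move=> r0 a0 b1 a1 e1; have qa : q * a <= a by rewrite ler_piMl // ltW.
have Kr : K * r >= 0 by lra.
have : s ^+ 2 * (K * r) <= K * r by rewrite ler_piMl //; case/andP: s2 => _
    /ltW.
rewrite mulrCA; lra.
Qed.

(* g \o E^-1 is strongly monotone. *)
Lemma relatively_monotone_surj (E g : V -> V) (L mu Lg nu : R) :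
  0 < mu -> 0 < nu ->
  (forall u, D u -> D (E u)) -> (forall u, D u -> D (g u)) ->
  (forall u v, D u -> D v -> sq (E u - E v) <= L * sq (u - v)) ->
  (forall u v, D u -> D v -> mu * sq (u - v) <= ip (E u - E v) (u - v)) ->
  (forall u v, D u -> D v -> sq (g u - g v) <= Lg * sq (u - v)) ->
  (forall u v, D u -> D v -> nu * sq (u - v) <= ip (g u - g v) (E u - E v)) ->
  forall w, D w -> exists2 u, D u & sq (g u - w) = 0.
Proof.
move=> mu0 nu0 DE Dg EL Emu gL gnu w Dw.
(* J inverts E up to null vectors; outside D its value is a filler. *)
have /choice[J JP] p : exists u, D p -> D u /\ sq (E u - p) = 0.
  have [Dp|nDp] := pselect (D p); last by exists 0.
  have [u Du Eu] := strongly_monotone_surj mu0 DE EL Emu Dp.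
  by exists u.
have DJ p : D p -> D (J p) by move=> /JP[].
have EJ p p' : D p -> D p' -> sq ((E (J p) - E (J p')) - (p - p')) = 0.
  move=> Dp Dp'; have [DJp Ep] := JP p Dp; have [DJp' Ep'] := JP p' Dp'.
  have -> : (E (J p) - E (J p')) - (p - p') = (E (J p) - p) - (E (J p') - p').
    by rewrite !opprB addrACA [in RHS]addrACA; congr (_ + _); rewrite addrC.
  have D1 : D (E (J p) - p) by auto.
  have D2 : D (E (J p') - p') by auto.
  by rewrite sqB // Ep Ep' (ip_null D1 D2 Ep); ring.
have sqEJ p p' : D p -> D p' -> sq (E (J p) - E (J p')) = sq (p - p').
  by move=> Dp Dp'; apply: ip_congr; rewrite ?EJ; auto.
have Jlip p p' : D p -> D p' -> mu ^+ 2 * sq (J p - J p') <= sq (p - p').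
  move=> Dp Dp'; rewrite -(sqEJ p p') //.
  have Dd := domB (DJ _ Dp) (DJ _ Dp').
  have DEd := domB (DE _ (DJ _ Dp)) (DE _ (DJ _ Dp')).
  exact: (le_of_cauchy_schwarz mu0 (ip_ge0 H Dd) (ip_ge0 H DEd)
    (ip_cauchy_schwarz DEd Dd) (Emu _ _ (DJ _ Dp) (DJ _ Dp'))).
pose L' := `|L| + 1.
have L'0 : 0 < L' by rewrite /L'; have := normr_ge0 L; lra.
have LL' : L <= L' by rewrite /L'; have := ler_norm L; lra.
(* The squared Lipschitz constant of J is 1 / mu^2, which gives that of g o J. The monotonicity
   constant nu / L' comes from |p - p'|^2 = |E (J p) - E (J p')|^2 <= L' |J p - J p'|^2. *)
have [||p p' Dp Dp'|p p' Dp Dp'|p Dp gp] :=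
  @strongly_monotone_surj (g \o J) (`|Lg| / mu ^+ 2) (nu / L') _ _ _ _ w Dw.
- by rewrite divr_gt0.
- by move=> u Du /=; auto.
- apply: le_trans (gL _ _ (DJ _ Dp) (DJ _ Dp')) _.
  rewrite -mulrA; apply: (@le_trans _ _ (`|Lg| * sq (J p - J p'))).
    by rewrite ler_wpM2r ?ler_norm // (ip_ge0 H) //; auto.
  by rewrite ler_wpM2l // mulrC ler_pdivlMr ?exprn_gt0 // mulrC Jlip.
- have -> : ip ((g \o J) p - (g \o J) p') (p - p') =
      ip (g (J p) - g (J p')) (E (J p) - E (J p')).
    have Dd : D (p - p') by exact: domB.
    have Dg' : D (g (J p) - g (J p')) by apply: domB; apply: Dg; exact: DJ.
    have De : D (E (J p) - E (J p')) by apply: domB; apply: DE; exact: DJ.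
    by apply: ip_congr => //; [rewrite subrr ip0l | rewrite sqBC ?EJ].
  apply: le_trans (gnu _ _ (DJ _ Dp) (DJ _ Dp')).
  rewrite -(sqEJ p p') // -mulrA (ler_pM2l nu0) mulrC ler_pdivrMr // mulrC.
  apply: le_trans (EL _ _ (DJ _ Dp) (DJ _ Dp')) _.
  by rewrite ler_wpM2r // (ip_ge0 H) //; auto.
- by exists (J p); auto.
Qed.

(** The representing vector minimises |v|^2 - 2 l(v). By the parallelogram identity a minimising
    sequence with geometric tolerance has geometric increments, which is the only kind of sequence
    known to converge here. *)
Lemma riesz_representation (l : V -> R) (C : R) : 0 <= C ->
  (forall a u v, D u -> D v -> l (a *: u + v) = a * l u + l v) ->
  (forall u, D u -> l u ^+ 2 <= C * sq u) ->
  exists2 u, D u & forall v, D v -> ip u v = l v.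
Proof.
move=> C0 l_lin lC.
have lZ a v : D v -> l (a *: v) = a * l v.
  move=> Dv; have := l_lin (-1) _ _ Dv Dv; rewrite scaleN1r addNr => l0.
  by have := l_lin a v 0 Dv D0; rewrite addr0 l0; lra.
have lD u v : D u -> D v -> l (u + v) = l u + l v.
  by move=> Du Dv; rewrite -{1}[u]scale1r l_lin // mul1r.
pose J v := sq v - 2 * l v.
have J_ge v : D v -> - C <= J v.
  move=> Dv; have := lC _ Dv; have := ip_ge0 H Dv; rewrite /J.
  move: (sq v) (l v) => s x s0 xC.
  have [x0|x0] := leP x 0; first by lra.
  have := sqr_ge0 (C - s); nra.
pose m := inf [set J v | v in D].
have m_inf : has_inf [set J v | v in D].
  by split; [exists (J 0), 0 | exists (- C) => _ [v Dv <-]; exact: J_ge].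
have m_le v : D v -> m <= J v.
  by move=> Dv; apply: (ge_inf m_inf.2); exists v.
have e0 k : 0 < (4^-1 : R) ^+ k by apply: exprn_gt0; lra.
(* The tolerance 4^-k is (s^4)^k for s = sqrt (1/2). *)
have /choice[u uP] k : exists v, D v /\ J v <= m + 4^-1 ^+ k.
  by have [_ [v Dv <-] /ltW Jv] := inf_adherent (e0 k) m_inf; exists v.
have Du k : D (u k) by have [] := uP k.
have Ju k : J (u k) <= m + 4^-1 ^+ k by have [] := uP k.
pose s : R := Num.sqrt 2^-1.
have s2 : s ^+ 2 = 2^-1 by rewrite sqr_sqrtr //; lra.
have s4 : s ^+ 4 = 4^-1 by rewrite (exprM s 2 2) s2; lra.
have s01 : 0 < s < 1.
  rewrite sqrtr_gt0 invr_gt0 ltr0n /= ltNge; apply/negP => s1.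
  by have : 1 <= s ^+ 2; [exact: exprn_ege1 | rewrite s2; lra].
(* With p the midpoint of u = u_k and u' = u_{k+1}, |u' - u|^2 = 2 J(u') + 2 J(u) - 4 J(p), and J(p)
   >= m. *)
have step k : sq (u k.+1 - u k) <= 4 * (s ^+ 4) ^+ k.
  have Ds := domD (Du k.+1) (Du k).
  have := m_le _ (domZ 2^-1 Ds); have := Ju k; have := Ju k.+1.
  rewrite /J sqZ // (sqD (Du k.+1) (Du k)) (sqB (Du k.+1) (Du k)) lZ // lD //.
  by rewrite s4 exprS; have := e0 k; lra.
have [v Dv [K vu]] := ip_complete H Du s01 step.
exists v => // w Dw.
(* J(u_k - t w) >= m >= J(u_k) - 4^-k for all t is a nonnegative quadratic polynomial in t; its
   discriminant bounds the derivative of J at u_k. *)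
have near_crit k : (ip (u k) w - l w) ^+ 2 <= 4^-1 ^+ k * sq w.
  apply: discriminant_le => [|t]; first exact: (ip_ge0 H).
  have Dt : D (- t *: w) by auto.
  have := m_le _ (domD (Du k) Dt); have := Ju k.
  rewrite /J sqD // lD // lZ // sqZ // (ipC H) ipZl // (ipC H w); lra.
apply/eqP; rewrite -subr_eq0 -sqrf_eq0 eq_le sqr_ge0 andbT.
have s2_01 : 0 <= s ^+ 2 < 1 by rewrite s2; apply/andP; split; lra.
apply: (le_geometric_le0 s2_01 (A := 2 * (K + 1) * sq w)) => k.
have := near_crit k.
have := ip_cauchy_schwarz (domB Dv (Du k)) Dw; rewrite ipBl //.
have le4 : 4^-1 ^+ k <= (s ^+ 2) ^+ k.
  by rewrite lerXn2r ?nnegrE ?s2 ?invr_ge0 ?ler0n //; lra.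
have w0 := ip_ge0 H Dw.
have := ler_wpM2r w0 le4; have := ler_wpM2r w0 (vu k).
move: (sq (v - u k)) (ip v w) (ip (u k) w) (l w) => e x y z h1 h2 h3 h4.
have := sqr_ge0 ((x - y) - (y - z)); lra.
Qed.

End semi_hilbert_theory.

(** * The spaces L^2(G; R^k) *)

(** Since the null sets belong to [G], measurability survives almost sure modification and almost
    sure limits. This matters because the coefficients are Lipschitz only almost surely. *)
Record complete_sub_sigma (d : measure_display) (Omega : measurableType d)
    (R : realType) (P : probability Omega R) (G : set (set Omega)) : Prop :=
  CompleteSubSigma {
  sub_sigma : sigma_algebra setT G;
  sub_sigma_measurable : G `<=` measurable;
  sub_sigma_negligible : forall A, P.-negligible A -> G A
}.

Section measurable_wrt_theory.
Context (R : realType) (d : measure_display) (Omega : measurableType d)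
  (P : probability Omega R).
Implicit Types (G : set (set Omega)) (f g : Omega -> R).

Lemma measurable_wrtE G f : measurable_wrt G f <->
  (forall B : set R, measurable B -> G (f @^-1` B)).
Proof.
split=> [Gf B mB|Gf _ [B mB <-]]; last by rewrite setTI; exact: Gf.
by apply: Gf; exists B => //; rewrite setTI.
Qed.

(** The sigma-algebra generated by a sigma-algebra [G] is [G] itself, so the calculus of measurable
    functions applies to [Omega] retyped with [G]. *)
Lemma measurable_wrtP G f : sigma_algebra setT G ->
  measurable_wrt G f <->
  measurable_fun setT (f : g_sigma_algebraType G -> R).
Proof.
move=> sG; have GE : measurable = G :> set (set (g_sigma_algebraType G)).
  exact: sigma_algebra_id.
split=> [/measurable_wrtE Gf _ B mB|mf].
  by rewrite setTI GE; exact: Gf.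
by apply/measurable_wrtE => B mB; rewrite -GE -[_ @^-1` _]setTI; exact: mf.
Qed.

Lemma measurable_wrtS G G' f : G `<=` G' ->
  measurable_wrt G f -> measurable_wrt G' f.
Proof. by move=> GG' Gf A /Gf /GG'. Qed.

Lemma measurable_wrt_measurable G f : G `<=` measurable ->
  measurable_wrt G f -> measurable_fun setT f.
Proof.
by move=> Gm /measurable_wrtE Gf _ B mB; rewrite setTI; apply: Gm; exact: Gf.
Qed.

Context (G : set (set Omega)) (GP : complete_sub_sigma P G).
Let sG := sub_sigma GP.

Lemma measurable_wrt_cst (a : R) : measurable_wrt G (fun _ => a).
Proof. by apply/(measurable_wrtP _ sG). Qed.

Lemma measurable_wrtD f g : measurable_wrt G f -> measurable_wrt G g ->
  measurable_wrt G (fun w => f w + g w).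
Proof.
move=> /(measurable_wrtP _ sG) mf /(measurable_wrtP _ sG) mg.
by apply/(measurable_wrtP _ sG); exact: measurable_funD.
Qed.

Lemma measurable_wrtM f g : measurable_wrt G f -> measurable_wrt G g ->
  measurable_wrt G (fun w => f w * g w).
Proof.
move=> /(measurable_wrtP _ sG) mf /(measurable_wrtP _ sG) mg.
by apply/(measurable_wrtP _ sG); exact: measurable_funM.
Qed.

Lemma measurable_wrtN f : measurable_wrt G f ->
  measurable_wrt G (fun w => - f w).
Proof.
move=> mf; have := measurable_wrtM (@measurable_wrt_cst (-1)) mf.
by congr (measurable_wrt G _); apply/funext => w; rewrite mulN1r.
Qed.

Lemma measurable_wrt_sum (I : finType) (f : I -> Omega -> R) :
  (forall i, measurable_wrt G (f i)) ->
  measurable_wrt G (fun w => \sum_i f i w).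
Proof.
move=> mf; apply/(measurable_wrtP _ sG); apply: measurable_sum => i.
exact/(measurable_wrtP _ sG).
Qed.

(** The preimages under f and g differ only inside a null set, all of whose subsets lie in [G]. *)
Lemma measurable_wrt_ae f g : {ae P, forall w, f w = g w} ->
  measurable_wrt G f -> measurable_wrt G g.
Proof.
move=> fg /measurable_wrtE mf; apply/measurable_wrtE => B mB.
pose N := [set w | ~ f w = g w].
have GN A : A `<=` N -> G A.
  move=> AN; apply: (sub_sigma_negligible GP); apply: negligibleS AN _; exact:
      fg.
have GC (A : set Omega) : G A -> G (~` A).
  by move=> GA; rewrite -setTD; case: sG => _ + _; exact.
have GU (A B' : set Omega) : G A -> G B' -> G (A `|` B').
  move=> GA GB; rewrite -bigcup2E; case: sG => _ _; apply => -[//|[//|n]].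
  by case: sG.
have GI (A B' : set Omega) : G A -> G B' -> G (A `&` B').
  by move=> GA GB; rewrite -[_ `&` _]setCK setCI; apply/GC/GU; exact: GC.
have -> : g @^-1` B = (f @^-1` B `&` ~` N) `|` (g @^-1` B `&` N).
  apply/seteqP; split=> [w /= gw|w /= [[fw /contrapT <-]//|[]//]].
  have [fgw|fgw] := pselect (f w = g w); [left|right] => //.
  by rewrite fgw; split=> // [[]].
apply: GU; last by apply: GN => w [].
by apply: GI; [exact: mf|apply: GC; exact: GN].
Qed.

(** The exceptional set belongs to [G]; multiplying by the indicator of its complement makes the
    convergence hold everywhere. *)
Lemma measurable_wrt_cvg (f : nat -> Omega -> R) g :
  (forall k, measurable_wrt G (f k)) ->
  {ae P, forall w, f ^~ w @ \oo --> g w} -> measurable_wrt G g.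
Proof.
move=> mf fg; pose N := [set w | ~ (f ^~ w @ \oo --> g w)].
have mN : measurable_wrt G (\1_N : Omega -> R).
  apply/(measurable_wrtP _ sG).
  suff mN : measurable (N : set (g_sigma_algebraType G)).
    exact: measurable_indic.
  by rewrite /measurable /= sigma_algebra_id //; exact: (sub_sigma_negligible
      GP).
apply: (@measurable_wrt_ae (fun w => g w * (1 - \1_N w))).
  apply: filterS fg => w fgw; rewrite indicE memNset ?subr0 ?mulr1 //.
apply/(measurable_wrtP _ sG).
apply: (measurable_fun_cvg (h := fun k (w : g_sigma_algebraType G) =>
    f k w * (1 - \1_N w))).
  move=> k; apply/(measurable_wrtP _ sG); apply: measurable_wrtM => //.
  by apply: measurable_wrtD; [exact: measurable_wrt_cst|exact: measurable_wrtN].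
move=> w _; rewrite indicE; have [wN|] := boolP (w \in N).
  by rewrite subrr; under eq_fun do rewrite mulr0; rewrite mulr0; exact:
      cvg_cst.
rewrite notin_setE /N /= => /contrapT fgw.
by rewrite subr0 mulr1; under eq_fun do rewrite mulr1.
Qed.

End measurable_wrt_theory.

Section square_integrable.
Context (R : realType) (d : measure_display) (Omega : measurableType d)
  (P : probability Omega R).
Implicit Types (G : set (set Omega)) (k : nat).

Definition ip k (U V : Omega -> 'cV[R]_k) : R := \int[P]_w dot (U w) (V w).

Lemma ae_le_Rintegral (f g : Omega -> R) :
  P.-integrable setT (EFin \o f) -> P.-integrable setT (EFin \o g) ->
  {ae P, forall w, f w <= g w} -> \int[P]_w f w <= \int[P]_w g w.
Proof.
move=> fi gi fg; rewrite -subr_ge0 -RintegralB //.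
(* The difference is nonnegative only almost surely, whereas its absolute value is nonnegative
   everywhere. *)
have -> : \int[P]_w (g w - f w) = \int[P]_w `|g w - f w|.
  have mfg : measurable_fun setT (fun w => (g w - f w)%R).
    apply: measurable_funB; apply/measurable_EFinP.
      exact: (measurable_int _ gi).
    exact: (measurable_int _ fi).
  rewrite /Rintegral (@ae_eq_integral _ _ _ P setT (fun w => `|g w - f w|%:E))
      //.
  - exact/measurable_EFinP.
  - by apply/measurable_EFinP; exact: measurableT_comp.
  - by apply: filterS fg => w fgw _ /=; rewrite ger0_norm ?subr_ge0.
exact: Rintegral_ge0.
Qed.

Lemma ae_eq_Rintegral (f g : Omega -> R) :
  P.-integrable setT (EFin \o f) -> P.-integrable setT (EFin \o g) ->
  {ae P, forall w, f w = g w} -> \int[P]_w f w = \int[P]_w g w.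
Proof.
move=> fi gi fg; apply/eqP; rewrite eq_le !ae_le_Rintegral //.
  by apply: filterS fg => w ->.
by apply: filterS fg => w ->.
Qed.

Lemma L2S G G' k (U : Omega -> 'cV[R]_k) : G `<=` G' -> L2 P G U -> L2 P G' U.
Proof. by move=> GG' [mU Ufin]; split => // i; exact: measurable_wrtS (mU i).
Qed.

Definition L2m k (U : Omega -> 'cV[R]_k) := L2 P measurable U.

Lemma measurable_dot k (U V : Omega -> 'cV[R]_k) : L2m U -> L2m V ->
  measurable_fun setT (fun w => dot (U w) (V w)).
Proof.
move=> [mU _] [mV _]; apply: measurable_sum => i.
by apply: measurable_funM; apply: (@measurable_wrt_measurable _ _ _ measurable).
Qed.

Lemma integrable_sq k (U : Omega -> 'cV[R]_k) : L2m U ->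
  P.-integrable setT (EFin \o (fun w => dot (U w) (U w))).
Proof.
move=> LU; apply/integrableP; split; first
    exact/measurable_EFinP/measurable_dot.
case: LU => _; congr (_ < _)%E; apply: eq_integral => w _.
by rewrite /= enorm_sqr ger0_norm // dot_ge0.
Qed.

Lemma integrable_sqD k (U V : Omega -> 'cV[R]_k) : L2m U -> L2m V ->
  P.-integrable setT (EFin \o (fun w => dot (U w) (U w) + dot (V w) (V w))).
Proof.
move=> LU LV.
exact: (integrableD measurableT (integrable_sq LU) (integrable_sq LV)).
Qed.

Lemma integrable_dot k (U V : Omega -> 'cV[R]_k) : L2m U -> L2m V ->
  P.-integrable setT (EFin \o (fun w => dot (U w) (V w))).
Proof.
move=> LU LV; apply: (le_integrable _ _ _ (integrable_sqD LU LV)) => //.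
  exact/measurable_EFinP/measurable_dot.
move=> w _ /=; rewrite lee_fin.
have := norm_dot_le (U w) (V w); have := dot_ge0 (U w); have := dot_ge0 (V w).
move=> V0 U0 le_dot; rewrite [leRHS]ger0_norm ?addr_ge0 //; lra.
Qed.

Lemma ip_ae_eq k l (U V : Omega -> 'cV[R]_k) (U' V' : Omega -> 'cV[R]_l) :
  L2m U -> L2m V -> L2m U' -> L2m V' ->
  {ae P, forall w, dot (U w) (V w) = dot (U' w) (V' w)} -> ip U V = ip U' V'.
Proof. by move=> *; apply: ae_eq_Rintegral => //; exact: integrable_dot. Qed.

Lemma ip_eq0_ae k (U : Omega -> 'cV[R]_k) : L2m U -> ip U U = 0 ->
  {ae P, forall w, U w = 0}.
Proof.
move=> LU U0; have Ui := integrable_sq LU.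
have : (\int[P]_w `|(dot (U w) (U w))%:E| = 0)%E.
  under eq_integral do rewrite gee0_abs ?lee_fin ?dot_ge0 //.
  by rewrite -(fineK (integrable_fin_num _ Ui)) // -[fine _]/(ip U U) U0.
move/ae_eq_integral_abs => /= /(_ measurableT).
move=> /(_ (measurable_int _ Ui)); apply: filterS => w /(_ I) [].
exact: dot_eq0.
Qed.

Lemma ae_eq0_ip k (U V : Omega -> 'cV[R]_k) : {ae P, forall w, U w = V w} ->
  L2m (U - V) -> ip (U - V) (U - V) = 0.
Proof.
move=> UV LUV; rewrite /ip /Rintegral.
rewrite (@ae_eq_integral _ _ _ P setT (cst 0%E)) ?integral0 //.
  by apply/measurable_EFinP; exact: measurable_dot.
by apply: filterS UV => w UVw _ /=; rewrite !fctE UVw subrr dot0l.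
Qed.

Context (G : set (set Omega)) (GP : complete_sub_sigma P G).

Lemma L2_L2m k (U : Omega -> 'cV[R]_k) : L2 P G U -> L2m U.
Proof. by apply: L2S; exact: sub_sigma_measurable GP. Qed.

Lemma L2_dominated k (U : Omega -> 'cV[R]_k) (g : Omega -> R) :
  (forall i, measurable_wrt G (fun w => U w i 0)) ->
  P.-integrable setT (EFin \o g) ->
  {ae P, forall w, dot (U w) (U w) <= g w} -> L2 P G U.
Proof.
move=> mU gi Ug; split=> //.
have mU2 : measurable_fun setT (fun w => dot (U w) (U w)).
  apply: (measurable_wrt_measurable (sub_sigma_measurable GP)); apply:
      (measurable_wrt_sum GP) => i.
  exact: (measurable_wrtM GP).
have /integrableP[mg] := integrable_abse gi; apply: le_lt_trans.
have -> : (fun w => (enorm (U w) ^+ 2)%:E) = (fun w => (dot (U w) (U w))%:E).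
  by apply/funext => w; rewrite enorm_sqr.
apply: ae_ge0_le_integral => //.
- by move=> w _; rewrite lee_fin dot_ge0.
- exact/measurable_EFinP.
- exact: measurableT_comp.
- apply: filterS Ug => w Ug _ /=; rewrite lee_fin normr_id.
  exact: le_trans Ug (ler_norm _).
Qed.

Lemma L2_cst k (u : 'cV[R]_k) : L2 P G (fun _ => u).
Proof.
apply: (@L2_dominated _ _ (fun _ => dot u u)).
- by move=> i; exact: (measurable_wrt_cst GP).
- by apply: finite_measure_integrable_cst.
- exact: aeW.
Qed.

Lemma L2D k (U V : Omega -> 'cV[R]_k) : L2 P G U -> L2 P G V -> L2 P G (U + V).
Proof.
move=> LU LV; apply: (@L2_dominated _ _
  (fun w => 2 * (dot (U w) (U w) + dot (V w) (V w)))).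
- move=> i; have -> : (fun w => (U + V) w i 0) = (fun w => U w i 0 + V w i 0).
    by apply/funext => w; rewrite fctE mxE.
  by apply: (measurable_wrtD GP); [exact: LU.1|exact: LV.1].
- exact: (integrableZl measurableT 2 (integrable_sqD (L2_L2m LU) (L2_L2m LV))).
- by apply: aeW => w; exact: dotD_le.
Qed.

Lemma measurable_wrt_scaler (a : Omega -> R) k (U : Omega -> 'cV[R]_k) :
    measurable_wrt G a ->
  (forall i, measurable_wrt G (fun w => U w i 0)) ->
  forall i, measurable_wrt G (fun w => (a w *: U w) i 0).
Proof.
move=> ma mU i; have -> : (fun w => (a w *: U w) i 0) = (fun w => a w * U w i
    0).
  by apply/funext => w; rewrite mxE.
exact: (measurable_wrtM GP).
Qed.

Lemma L2_mulmx m k (A : 'M[R]_(m, k)) (U : Omega -> 'cV[R]_k) : L2 P G U ->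
  L2 P G (fun w => A *m U w).
Proof.
move=> LU; have [C C0 CP] := dot_mulmx_le A.
apply: (@L2_dominated _ _ (fun w => C * dot (U w) (U w))).
- move=> i; have -> : (fun w => (A *m U w) i 0) = (fun w => \sum_j A i j * U w
    j 0).
    by apply/funext => w; rewrite mxE.
  apply: (measurable_wrt_sum GP) => j; apply: (measurable_wrtM GP); last exact:
      LU.1.
  exact: (measurable_wrt_cst GP).
- exact: (integrableZl measurableT C (integrable_sq (L2_L2m LU))).
- by apply: aeW => w.
Qed.

Lemma L2Z k a (U : Omega -> 'cV[R]_k) : L2 P G U -> L2 P G (a *: U).
Proof.
move=> LU; have := L2_mulmx a%:M LU; congr (L2 P G _).
by apply/funext => w; rewrite mul_scalar_mx.
Qed.

Lemma L2_col_mx k l (U : Omega -> 'cV[R]_k) (V : Omega -> 'cV[R]_l) :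
  L2 P G U -> L2 P G V -> L2 P G (fun w => col_mx (U w) (V w)).
Proof.
move=> LU LV; apply: (@L2_dominated _ _
  (fun w => dot (U w) (U w) + dot (V w) (V w))).
- move=> i; case: (split_ordP i) => j ->.
  + have := LU.1 j; congr (measurable_wrt G _).
    by apply/funext => w; rewrite col_mxEu.
  + have := LV.1 j; congr (measurable_wrt G _).
    by apply/funext => w; rewrite col_mxEd.
- exact: (integrableD measurableT (integrable_sq (L2_L2m LU))
    (integrable_sq (L2_L2m LV))).
- by apply: aeW => w; rewrite dot_col_mx.
Qed.

Lemma L2_usubmx k l (U : Omega -> 'cV[R]_(k + l)) : L2 P G U ->
  L2 P G (fun w => usubmx (U w)).
Proof.
move=> LU; apply: (@L2_dominated _ _ (fun w => dot (U w) (U w))).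
- move=> i; have := LU.1 (lshift l i); congr (measurable_wrt G _).
  by apply/funext => w; rewrite mxE.
- exact: (integrable_sq (L2_L2m LU)).
- by apply: aeW => w; rewrite -{3 4}(vsubmxK (U w)) dot_col_mx lerDl dot_ge0.
Qed.

Lemma L2_dsubmx k l (U : Omega -> 'cV[R]_(k + l)) : L2 P G U ->
  L2 P G (fun w => dsubmx (U w)).
Proof.
move=> LU; apply: (@L2_dominated _ _ (fun w => dot (U w) (U w))).
- move=> i; have := LU.1 (rshift k i); congr (measurable_wrt G _).
  by apply/funext => w; rewrite mxE.
- exact: (integrable_sq (L2_L2m LU)).
- by apply: aeW => w; rewrite -{3 4}(vsubmxK (U w)) dot_col_mx lerDr dot_ge0.
Qed.

End square_integrable.

(** * Completeness of L^2 along sequences with geometric increments *)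

Lemma geometric_increments_cvg (R : realType) (x : nat -> R) (A s : R) :
  0 < s < 1 -> (forall j, `|x j.+1 - x j| <= A * s ^+ j) ->
  exists2 l, x @ \oo --> l & forall j, `|l - x j| <= A * s ^+ j / (1 - s).
Proof.
move=> /andP[s0 s1] dx.
have A0 : 0 <= A by have := dx 0; rewrite expr0 mulr1; apply: le_trans.
have cvg_tele : cvgn (series (telescope x)).
  apply: normed_cvg; apply: (@series_le_cvg _ _ (geometric A s)).
  - by move=> n /=.
  - by move=> n /=; rewrite mulr_ge0 // exprn_ge0 // ltW.
  - by move=> n /=; exact: dx.
  - by apply: is_cvg_geometric_series; rewrite gtr0_norm.
have cvgx : cvgn x.
  have -> : x = series (telescope x) + cst (x 0).
    by apply/funext => n; rewrite telescopeK !fctE /= subrK.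
  by apply: is_cvgD => //; exact: is_cvg_cst.
exists (limn x) => // j.
(* The exact partial sum of the geometric series makes the induction close. *)
have tail n : `|x (j + n)%N - x j| <= A * s ^+ j / (1 - s) * (1 - s ^+ n).
  elim: n => [|n IH]; first by rewrite addn0 expr0 !subrr normr0 mulr0.
  rewrite addnS -[x _ - _](subrKA (x (j + n)%N)).
  apply: le_trans (ler_normD _ _) _.
  apply: le_trans (lerD (dx _) IH) _.
  rewrite le_eqVlt; apply/orP; left; apply/eqP.
  by rewrite exprD exprS; field; lra.
apply: (@cvgr_to_le _ \oo _ _ (fun n => `|x (j + n)%N - x j|)).
  apply: cvg_norm; apply: cvgB; last exact: cvg_cst.
  rewrite (_ : (fun n => x (j + n)%N) = [sequence x (n + j)%N]_n); last first.
    by apply/funext => n; rewrite addnC.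
  by rewrite (cvg_shiftn j).
apply: nearW => n; apply: le_trans (tail n) _.
rewrite ler_piMr //; first by rewrite divr_ge0 ?mulr_ge0 ?exprn_ge0 //; lra.
by have := exprn_ge0 n (ltW s0); lra.
Qed.

Lemma geometric_sum_le (R : realType) (C r : R) n : 0 <= C -> 0 <= r < 1 ->
  \sum_(j < n) C * r ^+ j <= C / (1 - r).
Proof.
move=> C0 /andP[r0 r1]; rewrite ler_pdivlMr; last by lra.
rewrite -mulr_sumr -mulrA ler_piMr //.
have <- : 1 - r ^+ n = (\sum_(j < n) r ^+ j) * (1 - r).
  by rewrite -[in LHS]opprB subrX1 -mulNr opprB mulrC.
by have := exprn_ge0 n r0; lra.
Qed.

Section L2_hilbert.
Context (R : realType) (d : measure_display) (Omega : measurableType d)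
  (P : probability Omega R) (G : set (set Omega)) (GP : complete_sub_sigma P G).
Variable k : nat.
Implicit Types U V W : Omega -> 'cV[R]_k.

Lemma L2B U V : L2 P G U -> L2 P G V -> L2 P G (U - V).
Proof. by move=> LU LV; rewrite -scaleN1r; apply: (L2D GP) => //; exact: (L2Z
    GP). Qed.

Lemma ip_linear a U V W : L2 P G U -> L2 P G V -> L2 P G W ->
  ip P (a *: U + V) W = a * ip P U W + ip P V W.
Proof.
move=> /(L2_L2m GP) LU /(L2_L2m GP) LV /(L2_L2m GP) LW.
rewrite /ip -RintegralZl //; last exact: integrable_dot.
rewrite -RintegralD //; last exact: integrable_dot.
  by apply: eq_Rintegral => w _; rewrite !fctE !dotE.
exact: (integrableZl measurableT a (integrable_dot LU LW)).
Qed.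

(** Squared increments of order s^(4j) can be divided by s^(2j) and still be summed. Hence the whole
    sequence converges almost surely, without extraction of a subsequence, and its limit is
    measurable for [G]; the price is the slower rate s^(2j). *)
Lemma L2_complete (u : nat -> Omega -> 'cV[R]_k) (C s : R) :
  (forall j, L2 P G (u j)) -> 0 < s < 1 ->
  (forall j, ip P (u j.+1 - u j) (u j.+1 - u j) <= C * (s ^+ 4) ^+ j) ->
  exists2 v, L2 P G v &
    exists K, forall j, ip P (v - u j) (v - u j) <= K * (s ^+ 2) ^+ j.
Proof.
move=> Lu s01 step; have [s0 s1] := andP s01.
have r0 : 0 < s ^+ 2 by exact: exprn_gt0.
have r1 : s ^+ 2 < 1 by rewrite expr_lt1 // ltW.
(* The squared increments divided by s^(2 j) have a sum c integrable in w, so that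
   almost surely all increments are bounded by sqrt(c) s^j. *)
pose e j w := dot (u j.+1 w - u j w) (u j.+1 w - u j w) / (s ^+ 2) ^+ j.
have Ldu j : L2m P (u j.+1 - u j) by apply: (L2_L2m GP); exact: L2B.
have e0 j w : 0 <= e j w by rewrite divr_ge0 ?dot_ge0 // exprn_ge0 // ltW.
have ei j : P.-integrable setT (EFin \o e j).
  exact: (integrableZr measurableT _ (integrable_sq (Ldu j))).
have me j : measurable_fun setT (EFin \o e j) by exact: (measurable_int _ (ei
    j)).
have C0 : 0 <= C.
  have := step 0; rewrite expr0 mulr1; apply: le_trans.
  by apply: Rintegral_ge0 => w _; exact: dot_ge0.
have int_e j : (\int[P]_w (e j w)%:E <= (C * (s ^+ 2) ^+ j)%:E)%E.
  rewrite -[leLHS]fineK ?(integrable_fin_num _ (ei j)) // lee_fin.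
  have -> : fine (\int[P]_w (e j w)%:E) =
      ip P (u j.+1 - u j) (u j.+1 - u j) / (s ^+ 2) ^+ j.
    rewrite -[LHS]/(\int[P]_w e j w) /e RintegralZr //.
    exact: (integrable_sq (Ldu j)).
  rewrite ler_pdivrMr ?exprn_gt0 //; apply: le_trans (step j) _.
  by rewrite -mulrA -exprMn -exprD.
pose g w := (\sum_(j <oo) (e j w)%:E)%E.
have g0 w : (0 <= g w)%E by apply: nneseries_ge0 => j _ _; rewrite lee_fin.
have mg : measurable_fun setT g.
  by apply: ge0_emeasurable_sum => [j w _ _|j _]; [rewrite lee_fin|exact: me].
have int_g : (\int[P]_w g w <= (C / (1 - s ^+ 2))%:E)%E.
  rewrite integral_nneseries //; last by move=> j w _; rewrite lee_fin.
  apply: lime_le.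
    by apply: is_cvg_nneseries => j _ _; apply: integral_ge0 => w _; rewrite
        lee_fin.
  apply: nearW => n; apply: le_trans (lee_sum _ (fun j _ => int_e j)) _.
  rewrite sumEFin lee_fin big_mkord; apply: geometric_sum_le => //.
  by rewrite r1 ltW.
have gi : P.-integrable setT g.
  apply/integrableP; split => //; under eq_integral do rewrite gee0_abs //.
  by apply: le_lt_trans int_g _; rewrite ltry.
(* On the null set where the sum is infinite, c takes the default value 0. *)
pose c w := fine (g w).
have ci : P.-integrable setT (EFin \o c).
  apply: (le_integrable _ _ _ gi) => //.
    exact/measurable_EFinP/measurableT_comp.
  move=> w _ /=; rewrite /c; case: (g w) (g0 w) => [x||] //= _.
  by rewrite normr0 leey.
have eb : {ae P, forall w, forall j i,
    `|u j.+1 w i 0 - u j w i 0| <= Num.sqrt (c w) * s ^+ j}.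
  have := integrable_ae measurableT gi; apply: filterS => w /(_ I) gfin j i.
  have ejg : e j w <= c w.
    rewrite -lee_fin fineK //; apply: le_trans (nneseries_lim_ge j.+1 _).
      by rewrite big_nat_recr //= leeDr // sume_ge0 // => l _; rewrite lee_fin.
    by move=> l _ _; rewrite lee_fin.
  have c0 : 0 <= c w by exact: fine_ge0.
  rewrite -ler_sqr ?nnegrE ?mulr_ge0 ?sqrtr_ge0 ?exprn_ge0 ?(ltW s0) //.
  rewrite real_normK ?num_real // exprMn sqr_sqrtr // exprAC.
  rewrite -ler_pdivrMr ?exprn_gt0 //; apply: le_trans ejg.
  rewrite /e ler_pM2r ?invr_gt0 ?exprn_gt0 //.
  by have := le_sqr_dot (u j.+1 w - u j w) i; rewrite !mxE.
pose v w := \col_(i < k) limn (fun j => u j w i 0).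
have vP : {ae P, forall w, forall i, (fun j => u j w i 0) @ \oo --> v w i 0 /\
    forall j, `|v w i 0 - u j w i 0| <= Num.sqrt (c w) * s ^+ j / (1 - s)}.
  apply: filterS eb => w eb i.
  have [l ul dl] := geometric_increments_cvg s01 (fun j => eb j i).
  have -> : v w i 0 = l by rewrite mxE; exact: cvg_lim.
  by [].
(* There are k coordinates, each with error at most sqrt(c) s^j / (1 - s). *)
pose K := k%:R / (1 - s) ^+ 2.
have vu j : {ae P, forall w,
    dot ((v - u j) w) ((v - u j) w) <= K * (s ^+ 2) ^+ j * c w}.
  apply: filterS vP => w vP.
  have c0 : 0 <= c w by exact: fine_ge0.
  apply: (@le_trans _ _ (\sum_(i < k) (s ^+ 2) ^+ j * c w / (1 - s) ^+ 2)).
    apply: ler_sum => i _; rewrite -expr2 -real_normK ?num_real //.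
    rewrite !fctE !mxE -[limn _](_ : v w i 0 = _) ?mxE //.
    have -> : (s ^+ 2) ^+ j * c w / (1 - s) ^+ 2 =
        (Num.sqrt (c w) * s ^+ j / (1 - s)) ^+ 2.
      rewrite (exprAC s 2 j) -{1}(sqr_sqrtr c0); move: (s ^+ j) => q.
      by field; lra.
    by rewrite lerXn2r ?nnegrE // ?divr_ge0 ?mulr_ge0 ?sqrtr_ge0 ?exprn_ge0 //;
      [lra|lra|have [_ /(_ j)] := vP i; rewrite mxE].
  rewrite sumr_const card_ord -mulr_natl /K le_eqVlt; apply/orP; left.
  by apply/eqP; ring.
have Kci j : P.-integrable setT (EFin \o (fun w => K * (s ^+ 2) ^+ j * c w)).
  exact: (integrableZl measurableT (K * (s ^+ 2) ^+ j) ci).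
have mv i : measurable_wrt G (fun w => v w i 0).
  apply: (measurable_wrt_cvg GP (f := fun j w => u j w i 0)).
    by move=> j; exact: (Lu j).1.
  by apply: filterS vP => w /(_ i)[].
have Lv : L2 P G v.
  have -> : v = (v - u 0) + u 0 by rewrite subrK.
  apply: (L2D GP) => //; apply: (L2_dominated GP _ (Kci 0) (vu 0)) => i.
  have -> : (fun w => (v - u 0) w i 0) = (fun w => v w i 0 + - u 0 w i 0).
    by apply/funext => w; rewrite !fctE !mxE.
  by apply: (measurable_wrtD GP) => //; apply: (measurable_wrtN GP); exact: (Lu
      0).1.
exists v => //; exists (K * \int[P]_w c w) => j.
rewrite mulrAC -RintegralZl //; apply: ae_le_Rintegral (vu j) => //.
by apply: integrable_sq; apply: (L2_L2m GP); exact: L2B.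
Qed.

Lemma L2_semi_hilbert : semi_hilbert (@L2 d Omega R P G k) (@ip R d Omega P k).
Proof.
split.
- exact: (L2_cst GP).
- by move=> a U V LU LV; apply: (L2D GP) => //; exact: (L2Z GP).
- by move=> U V; apply: eq_Rintegral => w _; exact: dotC.
- exact: ip_linear.
- by move=> U _; apply: Rintegral_ge0 => w _; exact: dot_ge0.
- exact: L2_complete.
Qed.

End L2_hilbert.

(** * Orthogonality and independence *)

Section integral_transfer.
Context (R : realType) (d : measure_display) (Omega : measurableType d)
  (P : probability Omega R) (G : set (set Omega)).
Hypothesis sG : sigma_algebra setT G.
Hypothesis Gm : G `<=` measurable.

Import HBNNSimple.

(** The hypothesis covers indicators of sets of [G]. Linearity extends it to simple functions whose
    level sets lie in [G], monotone convergence to [eta]. It does the work of conditional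
    expectation for nonnegative functions, without integrability of the products. *)
Lemma ge0_integral_transfer (f1 f2 eta : Omega -> R) :
  measurable_fun setT f1 -> measurable_fun setT f2 ->
  (forall w, 0 <= f1 w) -> (forall w, 0 <= f2 w) ->
  measurable_wrt G eta -> (forall w, 0 <= eta w) ->
  (forall A, G A -> \int[P]_(w in A) (f1 w)%:E = \int[P]_(w in A) (f2 w)%:E)%E
      ->
  (\int[P]_w (eta w * f1 w)%:E = \int[P]_w (eta w * f2 w)%:E)%E.
Proof.
move=> mf1 mf2 f10 f20 /(measurable_wrtP _ sG) meta eta0 f12.
have GE : measurable = G :> set (set (g_sigma_algebraType G)).
  exact: sigma_algebra_id.
have me : measurable_fun setT (EFin \o (eta : g_sigma_algebraType G -> R)).
  exact/measurable_EFinP.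
pose h n : {nnsfun (g_sigma_algebraType G) >-> R} := nnsfun_approx measurableT
    me n.
have h0 n x : 0 <= h n x by exact: fun_ge0.
have Gh n (A : set R) : measurable A -> G (h n @^-1` A).
  move=> mA; have := measurable_funP (h n) measurableT _ mA.
  by rewrite setTI GE.
have mh n : measurable_fun setT (h n : Omega -> R).
  by move=> _ A mA; rewrite setTI; apply: Gm; exact: Gh.
have int_h (f : Omega -> R) n : measurable_fun setT f -> (forall w, 0 <= f w) ->
    (\int[P]_w (h n w * f w)%:E = \sum_(y \in range (h n))
      (y%:E * \int[P]_(w in h n @^-1` [set y]) (f w)%:E))%E.
  move=> mf f0.
  pose T y (w : Omega) := (y * (f w * \1_(h n @^-1` [set y]) w))%:E.
  have mA y : measurable (h n @^-1` [set y] : set Omega) by exact/Gm/Gh.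
  have T0 y w : (0 <= T y w)%E.
    rewrite lee_fin indicE; have [/set_mem <-|] := boolP (w \in _).
      by rewrite mulr1 mulr_ge0 // h0.
    by rewrite !mulr0.
  have mT y : measurable_fun setT (T y).
    apply/measurable_EFinP/measurable_funM => //.
    by apply: measurable_funM => //; exact: measurable_indic.
  transitivity (\int[P]_w (\sum_(y \in range (h n)) T y w))%E.
    apply: eq_integral => w _; rewrite (fimfunE (h n) w) fsumEFin //.
    congr EFin; rewrite mulr_fsuml //; apply: eq_fsbigr => y _.
    by rewrite -mulrA [f w * _]mulrC.
  rewrite ge0_integral_fsum //; apply: eq_fsbigr => y _.
  (* A negative y is not a value of h n, so both sides vanish. *)
  have [y0|y0] := leP 0 y.
    rewrite [in RHS]integral_mkcond -ge0_integralZl_EFin //.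
    - apply: eq_integral => w _; rewrite /T EFinM; congr (_ * _)%E.
      by rewrite patchE indicE; case: ifPn => _; rewrite ?mulr1 ?mulr0.
    - by move=> w _; rewrite patchE; case: ifPn => _ //; rewrite lee_fin.
    - by apply/(measurable_restrictT _ (mA y));
        exact/measurable_funTS/measurable_EFinP.
  have -> : h n @^-1` [set y] = set0 :> set Omega.
    by apply/seteqP; split => // w /= hy; have := h0 n w; rewrite hy leNgt y0.
  rewrite integral_set0 mule0 /T integral0_eq // => w _.
  have -> : h n @^-1` [set y] = set0 :> set Omega.
    by apply/seteqP; split => // w' /= hy; have := h0 n w'; rewrite hy leNgt y0.
  by rewrite indic0 mulr0 mulr0.
have lim_h (f : Omega -> R) : measurable_fun setT f -> (forall w, 0 <= f w) ->
    (\int[P]_w (h n w * f w)%:E @[n --> \oo] --> \int[P]_w (eta w * f w)%:E)%E.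
  move=> mf f0; pose g n w := (h n w * f w)%:E.
  have -> : (\int[P]_w (eta w * f w)%:E = \int[P]_w limn (g ^~ w))%E.
    apply: eq_integral => w _; apply/esym/cvg_lim => //.
    rewrite /g EFinM; under eq_fun do rewrite EFinM.
    apply: cvgeZr => //.
    by apply: (cvg_nnsfun_approx measurableT me) => // x _; rewrite /= lee_fin.
  apply: (@cvg_monotone_convergence _ _ _ P setT measurableT g).
  - by move=> n; apply/measurable_EFinP; exact: measurable_funM.
  - by move=> n w _; rewrite lee_fin mulr_ge0.
  - move=> w _ n n' nn'; rewrite lee_fin ler_wpM2r //.
    by have /lefP := nd_nnsfun_approx measurableT me nn'; apply.
apply: (cvg_unique _ (lim_h f1 mf1 f10)) => //.
have -> : (fun n => \int[P]_w (h n w * f1 w)%:E)%E =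
    (fun n => \int[P]_w (h n w * f2 w)%:E)%E.
  apply/funext => n; rewrite !int_h //; apply: eq_fsbigr => y _.
  by rewrite f12 //; exact: Gh.
exact: lim_h.
Qed.

End integral_transfer.

Section orthogonality.
Context (R : realType) (d : measure_display) (Omega : measurableType d)
  (P : probability Omega R) (G : set (set Omega)).
Hypothesis sG : sigma_algebra setT G.
Hypothesis Gm : G `<=` measurable.

(** The hypothesis says E[f | G] = 0, so the positive and negative parts of f have equal integrals
    over the sets of [G]. The transfer applies to the two parts of [eta] separately, and
    integrability of eta f allows recombining the four products. *)
Lemma Rintegral_orthogonal (f eta : Omega -> R) :
  P.-integrable setT (EFin \o f) -> measurable_wrt G eta ->
  P.-integrable setT (EFin \o (fun w => eta w * f w)) ->
  (forall A, G A -> \int[P]_(w in A) (f w)%:E = 0)%E ->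
  \int[P]_w (eta w * f w) = 0.
Proof.
move=> fi Geta efi f0.
have mf : measurable_fun setT f by apply/measurable_EFinP; exact:
    (measurable_int _ fi).
have fpi := integrable_funrpos measurableT fi.
have fni := integrable_funrneg measurableT fi.
have fE w : f w = f^\+ w - f^\- w.
  by rewrite -{1}(funrposBneg f) /=.
have f12 A : G A -> (\int[P]_(w in A) (f^\+ w)%:E = \int[P]_(w in A) (f^\-
    w)%:E)%E.
  move=> GA; have mA := Gm GA.
  have pA : P.-integrable A (EFin \o f^\+) by exact: integrableS fpi.
  have nA : P.-integrable A (EFin \o f^\-) by exact: integrableS fni.
  have := f0 _ GA; under eq_integral do rewrite fE.
  rewrite integralB_EFin // => /eqP; rewrite sube_eq ?add0e.
  - by move/eqP.
  - exact: integrable_fin_num.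
  - by rewrite fin_num_adde_defl // integrable_fin_num.
have part e : measurable_wrt G e -> (forall w, 0 <= e w <= `|eta w|) ->
    P.-integrable setT (EFin \o (fun w => e w * f^\+ w)) /\
    P.-integrable setT (EFin \o (fun w => e w * f^\- w)) /\
    \int[P]_w (e w * f^\+ w) = \int[P]_w (e w * f^\- w).
  move=> Ge e01; have me := measurable_wrt_measurable Gm Ge.
  have e_ge0 w : 0 <= e w by have /andP[] := e01 w.
  have le_e w : e w <= `|eta w| by have /andP[] := e01 w.
  have pf : forall w, 0 <= f^\+ w <= `|f w|.
    by move=> w; rewrite /funrpos le_max lexx orbT ge_max normr_ge0 ler_norm.
  have nf : forall w, 0 <= f^\- w <= `|f w|.
    move=> w; rewrite /funrneg le_max lexx orbT ge_max normr_ge0 andbT.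
    by rewrite -normrN ler_norm.
  have dom (g : Omega -> R) : measurable_fun setT g -> (forall w, 0 <= g w <=
      `|f w|) ->
      P.-integrable setT (EFin \o (fun w => e w * g w)).
    move=> mg g01; apply: (le_integrable _ _ _ efi) => //.
      exact/measurable_EFinP/measurable_funM.
    move=> w _ /=; have /andP[g0 gf] := g01 w.
    by rewrite lee_fin !normrM (ger0_norm (e_ge0 w)) (ger0_norm g0) ler_pM.
  split; first by apply: dom => //; exact: measurable_funrpos.
  split; first by apply: dom => //; exact: measurable_funrneg.
  congr fine; apply: (ge0_integral_transfer sG Gm) => //.
  - exact: measurable_funrpos.
  - exact: measurable_funrneg.
have ewP : forall w, 0 <= eta^\+ w <= `|eta w|.
  by move=> w; rewrite /funrpos le_max lexx orbT ge_max normr_ge0 ler_norm.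
have ewN : forall w, 0 <= eta^\- w <= `|eta w|.
  move=> w; rewrite /funrneg le_max lexx orbT ge_max normr_ge0 andbT.
  by rewrite -normrN ler_norm.
have [|pp [pn peq]] := part eta^\+ _ ewP.
  by apply/(measurable_wrtP _ sG)/measurable_funrpos/(measurable_wrtP _ sG).
have [|np [nn neq]] := part eta^\- _ ewN.
  by apply/(measurable_wrtP _ sG)/measurable_funrneg/(measurable_wrtP _ sG).
have pi := integrableB measurableT pp pn.
have ni := integrableB measurableT np nn.
transitivity (\int[P]_w ((eta^\+ w * f^\+ w - eta^\+ w * f^\- w) -
    (eta^\- w * f^\+ w - eta^\- w * f^\- w))).
  have etaE w : eta w = eta^\+ w - eta^\- w.
    by rewrite -{1}(funrposBneg eta) /=.
  by apply: eq_Rintegral => w _; rewrite {1}etaE {1}fE; ring.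
by rewrite RintegralB // !RintegralB // peq neq !subrr.
Qed.

Lemma indep_integral_sq (xi : Omega -> R) (A : set Omega) :
  measurable_fun setT xi -> indep_of P G xi -> G A ->
  (\int[P]_(w in A) (xi w ^+ 2)%:E = P A * \int[P]_w (xi w ^+ 2)%:E)%E.
Proof.
move=> mxi ind GA; have mA := Gm GA.
(* By independence, [\1_A] and [P A] have the same integrals over [sigma(xi)]. *)
have sxi : sigma_algebra setT (preimage_set_system setT xi measurable).
  exact: (sigma_algebra_measurable (g_sigma_algebra_preimageType xi)).
have xim : preimage_set_system setT xi measurable `<=` measurable.
  by move=> _ [B mB <-]; exact: mxi.
have PA : P A = (fine (P A))%:E by rewrite fineK // fin_num_measure.
have xi2 : measurable_wrt (preimage_set_system setT xi measurable)
    (fun w => xi w ^+ 2).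
  move=> _ [B mB <-]; exists ((fun x => x ^+ 2) @^-1` B) => //.
  by rewrite -[_ @^-1` _]setTI; exact: exprn_measurable.
have := @ge0_integral_transfer _ _ _ P _ sxi xim (\1_A) (fun _ => fine (P A))
  (fun w => xi w ^+ 2).
move=> /(_ (measurable_indic mA) (measurable_cst _)) tr.
transitivity (\int[P]_w (xi w ^+ 2 * \1_A w)%:E)%E.
  rewrite integral_mkcond; apply: eq_integral => w _.
  by rewrite patchE indicE; case: ifPn => _; rewrite ?mulr1 ?mulr0.
rewrite tr //.
- under eq_integral do rewrite EFinM muleC.
  rewrite ge0_integralZl_EFin //; first by rewrite -PA.
  + by move=> w _; rewrite lee_fin sqr_ge0.
  + by apply/measurable_EFinP/measurable_funX.
  + by rewrite fine_ge0.
- by move=> w; rewrite fine_ge0.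
- by move=> w; rewrite sqr_ge0.
- move=> _ [B mB <-]; rewrite integral_indic //; last exact: mxi.
  by rewrite integral_cst -?PA ?setTI; [exact: ind|rewrite -[X in measurable
      X]setTI; exact: mxi].
Qed.

End orthogonality.

(** * One noise increment *)

(** E[xi | G] = 0 and E[xi^2 | G] = 1, stated through integrals over sets of [G]. The analysis of
    one step sees the noise only through this record. *)
Record standard_increment (d : measure_display) (Omega : measurableType d)
    (R : realType) (P : probability Omega R) (G G' : set (set Omega))
    (xi : Omega -> R) : Prop := StandardIncrement {
  incr_adapted : measurable_wrt G' xi;
  incr_integrable : P.-integrable setT (EFin \o xi);
  incr_mean : forall A, G A -> (\int[P]_(w in A) (xi w)%:E = 0)%E;
  incr_variance : forall A, G A -> (\int[P]_(w in A) (xi w ^+ 2)%:E = P A)%E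
}.

Section noise_step.
Context (R : realType) (d : measure_display) (Omega : measurableType d)
  (P : probability Omega R) (G G' : set (set Omega)).
Hypothesis GP : complete_sub_sigma P G.
Hypothesis GP' : complete_sub_sigma P G'.
Hypothesis GG' : G `<=` G'.
Variable xi : Omega -> R.
Hypothesis xiP : standard_increment P G G' xi.
Let sG := sub_sigma GP.
Let Gm := sub_sigma_measurable GP.
Local Notation ip := (ip P).

Lemma measurable_wrt_dot k (U V : Omega -> 'cV[R]_k) : L2 P G U -> L2 P G V ->
  measurable_wrt G (fun w => dot (U w) (V w)).
Proof.
move=> [mU _] [mV _]; apply: (measurable_wrt_sum GP) => i.
exact: (measurable_wrtM GP).
Qed.

Let mxi : measurable_fun setT xi.
Proof. by apply/measurable_EFinP; exact: (measurable_int _ (incr_integrable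
    xiP)). Qed.

(** The product of two square integrable functions is square integrable here because E[xi^2 | G] =
    1: in the integral of |Z|^2 xi^2 the factor xi^2 may be replaced by 1. *)
Lemma L2_noise k (Z : Omega -> 'cV[R]_k) : L2 P G Z ->
  L2 P G' (fun w => xi w *: Z w).
Proof.
move=> LZ; split.
  apply: (measurable_wrt_scaler GP'); first exact: incr_adapted xiP.
  by move=> i; apply: measurable_wrtS GG' _; exact: LZ.1.
have -> : (\int[P]_w (enorm (xi w *: Z w) ^+ 2)%:E =
    \int[P]_w (dot (Z w) (Z w) * xi w ^+ 2)%:E)%E.
  apply: eq_integral => w _; congr EFin; rewrite enorm_sqr !dotE; ring.
rewrite (@ge0_integral_transfer _ _ _ P _ sG Gm _ (fun _ => 1)) //.
- have := LZ.2; congr (_ < _)%E; apply: eq_integral => w _.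
  by rewrite mulr1 enorm_sqr.
- exact: measurable_funX.
- by move=> w; exact: sqr_ge0.
- exact: measurable_wrt_dot.
- by move=> w; exact: dot_ge0.
- move=> A GA; rewrite (incr_variance xiP) // integral_cst ?mul1e //; exact: Gm.
Qed.

Lemma ip_noise1 k (U V : Omega -> 'cV[R]_k) : L2 P G U -> L2 P G V ->
  ip (fun w => xi w *: U w) V = 0.
Proof.
move=> LU LV; have LU' := L2_L2m GP' (L2_noise LU).
have := integrable_dot LU' (L2_L2m GP LV).
rewrite /ip /=.
have -> : (fun w => dot (xi w *: U w) (V w)) = (fun w => dot (U w) (V w) * xi
    w).
  by apply/funext => w; rewrite dotZl mulrC.
move=> uvi; apply: (Rintegral_orthogonal sG Gm (incr_integrable xiP)) => //.
  exact: measurable_wrt_dot.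
exact: incr_mean xiP.
Qed.

(** The argument of [ip_noise1], with xi^2 - 1 as the function of zero conditional mean. *)
Lemma ip_noise2 k (U V : Omega -> 'cV[R]_k) : L2 P G U -> L2 P G V ->
  ip (fun w => xi w *: U w) (fun w => xi w *: V w) = ip U V.
Proof.
move=> LU LV; have LU' := L2_L2m GP' (L2_noise LU).
have LV' := L2_L2m GP' (L2_noise LV).
have uvi := integrable_dot LU' LV'.
have uvi0 := integrable_dot (L2_L2m GP LU) (L2_L2m GP LV).
have xi2i : P.-integrable setT (EFin \o (fun w => xi w ^+ 2)).
  apply/integrableP; split; first exact/measurable_EFinP/measurable_funX.
  have -> : (\int[P]_w `|(EFin \o (fun w => (xi w ^+ 2)%R)) w| = P setT)%E.
    rewrite -(incr_variance xiP); last first.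
      by rewrite -setC0 -setTD; case: sG => G0 GC _; exact: GC.
    by apply: eq_integral => w _; rewrite gee0_abs //= lee_fin sqr_ge0.
  by rewrite probability_setT ltry.
have onei : P.-integrable setT (EFin \o (fun _ : Omega => 1)).
  exact: finite_measure_integrable_cst.
apply/eqP; rewrite -subr_eq0 /ip -RintegralB //.
have -> : (fun w => dot (xi w *: U w) (xi w *: V w) - dot (U w) (V w)) =
    (fun w => dot (U w) (V w) * (xi w ^+ 2 - 1)).
  by apply/funext => w; rewrite !dotE; ring.
apply/eqP; apply: (Rintegral_orthogonal sG Gm).
- exact: (integrableB measurableT xi2i onei).
- exact: measurable_wrt_dot.
- have := integrableB measurableT uvi uvi0; congr (P.-integrable setT _).
  by apply/funext => w; rewrite /= !dotE -EFinB; congr EFin; ring.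
- move=> A GA; have mA := Gm GA.
  rewrite integralB_EFin //; [|exact: integrableS xi2i|exact: integrableS onei].
  rewrite (incr_variance xiP) // integral_cst // mul1e subee //.
  exact: fin_num_measure.
Qed.

(* A pair (Y, Z) is stacked into one vector of size k + k. *)
Definition noise_sum k (U : Omega -> 'cV[R]_(k + k)) w : 'cV[R]_k :=
  usubmx (U w) + xi w *: dsubmx (U w).

Lemma L2_noise_sum k (U : Omega -> 'cV[R]_(k + k)) : L2 P G U ->
  L2 P G' (noise_sum U).
Proof.
move=> LU; apply: (L2D GP' (U := fun w => usubmx (U w))
  (V := fun w => xi w *: dsubmx (U w))).
  by apply: L2S GG' _; exact: (L2_usubmx GP).
by apply: L2_noise; exact: (L2_dsubmx GP).
Qed.

Lemma noise_sum_lin k a (U V : Omega -> 'cV[R]_(k + k)) :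
  noise_sum (a *: U + V) = a *: noise_sum U + noise_sum V.
Proof.
by apply/funext => w; apply/colP => i; rewrite /noise_sum !fctE !mxE; ring.
Qed.

Lemma noise_sumB k (U V : Omega -> 'cV[R]_(k + k)) :
  noise_sum (U - V) = noise_sum U - noise_sum V.
Proof. by rewrite -scaleN1r addrC noise_sum_lin scaleN1r addrC. Qed.

(** The cross terms vanish by the conditional mean of xi, and the conditional variance 1 preserves
    the second block. *)
Lemma ip_noise_sum k (U V : Omega -> 'cV[R]_(k + k)) : L2 P G U -> L2 P G V ->
  ip (noise_sum U) (noise_sum V) = ip U V.
Proof.
move=> LU LV.
pose U1 w := usubmx (U w); pose U2 w := dsubmx (U w).
pose V1 w := usubmx (V w); pose V2 w := dsubmx (V w).
have LU1 : L2 P G U1 by exact: (L2_usubmx GP).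
have LU2 : L2 P G U2 by exact: (L2_dsubmx GP).
have LV1 : L2 P G V1 by exact: (L2_usubmx GP).
have LV2 : L2 P G V2 by exact: (L2_dsubmx GP).
have H' := L2_semi_hilbert GP' k.
have nU := L2_noise LU2; have nV := L2_noise LV2.
have L' W : L2 P G W -> L2 P G' W by exact: L2S.
have -> : noise_sum U = U1 + (fun w => xi w *: U2 w) by [].
have -> : noise_sum V = V1 + (fun w => xi w *: V2 w) by [].
have LU1' := L' _ _ LU1; have LV1' := L' _ _ LV1.
have LV' : L2 P G' (V1 + (fun w => xi w *: V2 w)) by exact: (L2D GP').
rewrite (ipDl H') // !(ipC H' _ (V1 + _)) !(ipDl H') //.
rewrite ip_noise1 // (ipC H' V1 (fun w => xi w *: U2 w)) ip_noise1 //.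
rewrite ip_noise2 // addr0 add0r (ipC H' V1 U1) (ipC H' V2 U2).
have i1 := integrable_dot (L2_L2m GP LU1) (L2_L2m GP LV1).
have i2 := integrable_dot (L2_L2m GP LU2) (L2_L2m GP LV2).
rewrite /ip -RintegralD //; apply: eq_Rintegral => w _.
by rewrite -dot_col_mx !vsubmxK.
Qed.

(* The adjoint of the isometry [noise_sum]; its two blocks are
   E[eta | G] and E[xi eta | G]. *)
Lemma noise_proj_exists k : exists Pi : (Omega -> 'cV[R]_k) -> (Omega ->
    'cV[R]_(k + k)),
  forall eta, L2 P G' eta -> L2 P G (Pi eta) /\
    forall V, L2 P G V -> ip (Pi eta) V = ip eta (noise_sum V).
Proof.
suff /choice[Pi PiP] : forall eta : Omega -> 'cV[R]_k, exists U,
    L2 P G' eta -> L2 P G U /\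
    forall V, L2 P G V -> ip U V = ip eta (noise_sum V) by exists Pi.
move=> eta.
have [Leta|] := pselect (L2 P G' eta); last by exists 0.
have H := L2_semi_hilbert GP (k + k); have H' := L2_semi_hilbert GP' k.
have [|||U LU UV] := @riesz_representation _ _ _ _ H
  (fun V => ip eta (noise_sum V)) (ip eta eta).
- exact: (ip_ge0 H').
- move=> a U V LU LV; rewrite noise_sum_lin !(ipC H' eta) (ip_lin H') //.
    exact: L2_noise_sum.
  exact: L2_noise_sum.
- move=> V LV; rewrite -(ip_noise_sum LV LV).
  by apply: (ip_cauchy_schwarz H') => //; exact: L2_noise_sum.
- by exists U.
Qed.

End noise_step.

(** * Composition with random Lipschitz functions *)

(** The squared form integrates directly to an estimate in L^2. *)
Definition lipschitz_sq (R : realType) (p q : nat) (C : R)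
  (phi : 'cV[R]_p -> 'cV[R]_q) : Prop :=
  forall u v, dot (phi u - phi v) (phi u - phi v) <= C * dot (u - v) (u - v).

(** Convergence by coordinates avoids comparing the Euclidean norm with the sup norm on matrices. *)
Definition cvg_col (R : realType) (p : nat) (u : nat -> 'cV[R]_p) (l :
    'cV[R]_p) : Prop :=
  forall j, (fun i => u i j 0) @ \oo --> l j 0.

Section cvg_col_theory.
Variable R : realType.
Implicit Types p q : nat.

Lemma cvg_fin_sum (I : finType) (F : I -> nat -> R) (l : I -> R) :
  (forall i, F i @ \oo --> l i) -> (fun k => \sum_i F i k) @ \oo --> \sum_i l i.
Proof.
move=> Fl; elim: (index_enum I) => [|a s IH].
  by rewrite big_nil; under eq_fun do rewrite big_nil; exact: cvg_cst.
by rewrite big_cons; under eq_fun do rewrite big_cons; exact: cvgD.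
Qed.

Lemma cvg_colB p (u v : nat -> 'cV[R]_p) l l' : cvg_col u l -> cvg_col v l' ->
  cvg_col (fun i => u i - v i) (l - l').
Proof.
move=> ul vl j; rewrite !mxE; under eq_fun do rewrite !mxE.
exact: cvgB.
Qed.

Lemma cvg_col_mulmx p q (A : 'M[R]_(p, q)) (u : nat -> 'cV[R]_q) l :
  cvg_col u l -> cvg_col (fun i => A *m u i) (A *m l).
Proof.
move=> ul j; rewrite mxE; under eq_fun do rewrite mxE.
apply: (cvg_fin_sum (F := fun k i => A j k * u i k 0)) => k.
by apply: cvgM; [exact: cvg_cst|exact: ul].
Qed.

Lemma cvg_col_dot p (u v : nat -> 'cV[R]_p) l l' : cvg_col u l -> cvg_col v l'
    ->
  (fun i => dot (u i) (v i)) @ \oo --> dot l l'.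
Proof.
move=> ul vl; apply: (cvg_fin_sum (F := fun k i => u i k 0 * v i k 0)) => k.
by apply: cvgM; [exact: ul|exact: vl].
Qed.

Lemma cvg_col_usubmx p q (u : nat -> 'cV[R]_(p + q)) l : cvg_col u l ->
  cvg_col (fun i => usubmx (u i)) (usubmx l).
Proof. by move=> ul j; rewrite mxE; under eq_fun do rewrite mxE; exact: ul. Qed.

Lemma cvg_col_dsubmx p q (u : nat -> 'cV[R]_(p + q)) l : cvg_col u l ->
  cvg_col (fun i => dsubmx (u i)) (dsubmx l).
Proof. by move=> ul j; rewrite mxE; under eq_fun do rewrite mxE; exact: ul. Qed.

Lemma cvg_col_mx p q (u : nat -> 'cV[R]_p) (v : nat -> 'cV[R]_q) l l' :
  cvg_col u l -> cvg_col v l' ->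
  cvg_col (fun i => col_mx (u i) (v i)) (col_mx l l').
Proof.
move=> ul vl j; case: (split_ordP j) => k ->.
  by rewrite col_mxEu; under eq_fun do rewrite col_mxEu; exact: ul.
by rewrite col_mxEd; under eq_fun do rewrite col_mxEd; exact: vl.
Qed.

Lemma cvg_col_lipschitz p q C (phi : 'cV[R]_p -> 'cV[R]_q) u l :
  lipschitz_sq C phi -> cvg_col u l -> cvg_col (fun i => phi (u i)) (phi l).
Proof.
move=> lip ul j.
have dist0 : (fun i => C * dot (u i - l) (u i - l)) @ \oo --> 0.
  have ul0 : cvg_col (fun i => u i - l) 0.
    by rewrite -(subrr l); apply: cvg_colB => // k; exact: cvg_cst.
  have := cvgM (cvg_cst C) (cvg_col_dot ul0 ul0); rewrite dot0l mulr0; exact.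
apply/cvgrPdist_le => e e0; have e20 : 0 < e ^+ 2 by exact: exprn_gt0.
move/cvgrPdist_le : dist0 => /(_ _ e20); apply: filterS => i.
rewrite sub0r normrN => /(le_trans (ler_norm _)) => le_e.
rewrite -ler_sqr ?nnegrE // ?(ltW e0) // distrC real_normK ?num_real //.
apply: le_trans le_e; apply: le_trans (lip _ _).
by have := le_sqr_dot (phi (u i) - phi l) j; rewrite !mxE.
Qed.

(* Dyadic grids reduce measurability of phi(w, U(w)), and statements holding almost
   surely for each fixed argument, to countably many arguments. *)
Definition grid_point p (i : nat) (z : 'cV[int]_p) : 'cV[R]_p :=
  \col_j ((z j 0)%:~R / 2 ^+ i).

Definition grid_index p (i : nat) (u : 'cV[R]_p) : 'cV[int]_p :=
  \col_j Num.floor (u j 0 * 2 ^+ i).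

Lemma grid_cvg p (u : 'cV[R]_p) :
  cvg_col (fun i => grid_point i (grid_index i u)) u.
Proof.
move=> j; apply/cvgrPdist_le => e e0.
have half : `|2^-1 : R| < 1 by rewrite ger0_norm ?invr_ge0 // invf_lt1 ?ltr1n.
have /cvgrPdist_le /(_ _ e0) := @cvg_geometric R 1 2^-1 half.
apply: filterS => i /=; rewrite sub0r normrN mul1r ger0_norm ?exprn_ge0
    ?invr_ge0 //; apply: le_trans.
rewrite !mxE; have p2 : 0 < (2 : R) ^+ i by exact: exprn_gt0.
rewrite exprVn; set r := 2 ^+ i in p2 *; set f := Num.floor _.
have -> : u j 0 - f%:~R / r = (u j 0 * r - f%:~R) / r by field; lra.
rewrite normrM normfV (gtr0_norm p2) ler_piMl ?invr_ge0 ?(ltW p2) // ler_norml.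
have := floor_le (u j 0 * r); have := floorD1_gt (u j 0 * r); rewrite -/f.
rewrite intrD; lra.
Qed.

End cvg_col_theory.

Section nemytskii.
Context (R : realType) (d : measure_display) (Omega : measurableType d)
  (P : probability Omega R).

Lemma ae_forall_countType (T : countType) (Q : T -> Omega -> Prop) :
  (forall x, {ae P, forall w, Q x w}) -> {ae P, forall w, forall x, Q x w}.
Proof.
move=> Qx; pose Q' n w := if unpickle n is Some x then Q x w else True.
have : {ae P, forall w, forall n, Q' n w}.
  apply: ae_foralln => n; rewrite /Q'; case: (unpickle n) => [x|]; last exact:
      aeW.
  exact: Qx.
by apply: filterS => w Qw x; have := Qw (pickle x); rewrite /Q' pickleK.
Qed.

(** The exceptional null set may depend on the argument. The countably many grid points share one,
    and off it continuity reaches every argument. *)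
Lemma ae_le0_of_grid p (Q : Omega -> 'cV[R]_p -> R) :
  (forall l, {ae P, forall w, Q w l <= 0}) ->
  {ae P, forall w, forall u l, cvg_col u l -> Q w \o u @ \oo --> Q w l} ->
  {ae P, forall w, forall l, Q w l <= 0}.
Proof.
move=> Qle Qcont.
have : {ae P, forall w, forall iz : nat * 'cV[int]_p, Q w (grid_point R iz.1
    iz.2) <= 0}.
  by apply: ae_forall_countType => -[i z]; exact: Qle.
apply: filterS2 Qcont => w Qcont Qgrid l.
have /cvgr_to_le := Qcont _ _ (@grid_cvg R p l); apply; apply: nearW => i /=.
exact: (Qgrid (i, grid_index i l)).
Qed.

(** The pair (l, l') is treated as one vector of size p + p, so that the grid argument moves both at
    once. In the applications [kappa] is linear and [Q] is a quadratic form or zero. *)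
Lemma ae_monotone p q C (phi : Omega -> 'cV[R]_p -> 'cV[R]_q)
    (kappa : 'cV[R]_p -> 'cV[R]_q) (Q : 'cV[R]_p -> R) :
  {ae P, forall w, lipschitz_sq C (phi w)} ->
  (forall u l, cvg_col u l -> cvg_col (kappa \o u) (kappa l)) ->
  (forall u l, cvg_col u l -> Q \o u @ \oo --> Q l) ->
  (forall l l', {ae P, forall w, dot (phi w l - phi w l') (kappa (l - l')) <= Q
      (l - l')}) ->
  {ae P, forall w, forall l l', dot (phi w l - phi w l') (kappa (l - l')) <= Q
      (l - l')}.
Proof.
move=> lip kcont Qcont mono.
pose F w (L : 'cV[R]_(p + p)) :=
  dot (phi w (usubmx L) - phi w (dsubmx L)) (kappa (usubmx L - dsubmx L))
  - Q (usubmx L - dsubmx L).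
suff : {ae P, forall w, forall L, F w L <= 0}.
  apply: filterS => w H l l'; have := H (col_mx l l').
  by rewrite /F col_mxKu col_mxKd subr_le0.
apply: ae_le0_of_grid.
- by move=> L; apply: filterS (mono (usubmx L) (dsubmx L)) => w; rewrite /F
    subr_le0.
- apply: filterS lip => w lip u l ul.
  have ul1 := cvg_col_usubmx ul; have ul2 := cvg_col_dsubmx ul.
  have ulB := cvg_colB ul1 ul2.
  apply: cvgB; last exact: (Qcont _ _ ulB).
  apply: cvg_col_dot; last exact: (kcont _ _ ulB).
  by apply: cvg_colB; apply: cvg_col_lipschitz lip _.
Qed.

Context (G : set (set Omega)) (GP : complete_sub_sigma P G).

(** The rounded U has countably many values, and on each cell phi has a fixed argument. *)
Lemma measurable_wrt_grid p q (phi : Omega -> 'cV[R]_p -> 'cV[R]_q)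
    (U : Omega -> 'cV[R]_p) i j :
  (forall l, measurable_wrt G (fun w => phi w l j 0)) ->
  (forall k, measurable_wrt G (fun w => U w k 0)) ->
  measurable_wrt G (fun w => phi w (grid_point R i (grid_index i (U w))) j 0).
Proof.
move=> mphi mU; apply/(measurable_wrtP _ (sub_sigma GP)) => _ B mB; rewrite
    setTI.
pose T := g_sigma_algebraType G.
pose cell (z : 'cV[int]_p) : set T := [set w | grid_index i (U w) = z].
have -> : (fun w => phi w (grid_point R i (grid_index i (U w))) j 0) @^-1` B =
    \bigcup_z (cell z `&` (fun w => phi w (grid_point R i z) j 0) @^-1` B) :>
        set T.
  apply/seteqP; split=> [w /= Bw|w [z _ [/= <-]] //].
  by exists (grid_index i (U w)).
apply: countable_bigcupT_measurable; first exact: countableP.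
move=> z; apply: measurableI; last first.
  have /(measurable_wrtP _ (sub_sigma GP)) := mphi (grid_point R i z).
  by move=> /(_ measurableT _ mB); rewrite setTI.
have -> : cell z = \bigcap_(k in [set: 'I_p])
    ((fun w => U w k 0 * 2 ^+ i) @^-1` `[(z k 0)%:~R, (z k 0 + 1)%:~R[%classic).
  apply/seteqP; split=> [w <- k _ /=|w cw].
    by rewrite !mxE in_itv /= floor_le floorD1_gt.
  apply/colP => k; have := cw k I; rewrite /= in_itv /= !mxE.
  by move=> /floor_def.
apply: fin_bigcap_measurable => [|k _]; first exact: finite_finset.
have /(measurable_wrtP _ (sub_sigma GP)) : measurable_wrt G (fun w => U w k 0 *
    2 ^+ i).
  by apply: (measurable_wrtM GP) => //; exact: (measurable_wrt_cst GP).
by move=> mUk; rewrite -[_ @^-1` _]setTI; exact: mUk.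
Qed.

(** Measurability comes from the almost sure limit along rounded arguments, integrability from
    comparison with phi(w, 0). *)
Lemma L2_nemytskii p q C (phi : Omega -> 'cV[R]_p -> 'cV[R]_q)
    (U : Omega -> 'cV[R]_p) :
  {ae P, forall w, lipschitz_sq C (phi w)} ->
  (forall l, L2 P G (fun w => phi w l)) -> L2 P G U ->
  L2 P G (fun w => phi w (U w)).
Proof.
move=> lip Lphi LU.
pose g w := 2 * (C * dot (U w) (U w) + dot (phi w 0) (phi w 0)).
have gi : P.-integrable setT (EFin \o g).
  have i1 := integrableZl measurableT C (integrable_sq (L2_L2m GP LU)).
  have i2 := integrable_sq (L2_L2m GP (Lphi 0)).
  exact: (integrableZl measurableT 2 (integrableD measurableT i1 i2)).
apply: (L2_dominated GP _ gi).
  move=> j; apply: (measurable_wrt_cvg GP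
    (f := fun i w => phi w (grid_point R i (grid_index i (U w))) j 0)).
    by move=> i; apply: measurable_wrt_grid => [l|k]; [exact: (Lphi l).1|exact:
        LU.1].
  apply: filterS lip => w lip.
  by have := cvg_col_lipschitz lip (@grid_cvg R p (U w)); apply.
apply: filterS lip => w /(_ (U w) 0); rewrite subr0 => lip.
have := dotD_le (phi w (U w) - phi w 0) (phi w 0); rewrite subrK /g; lra.
Qed.

Lemma ip_nemytskii p q C (phi : Omega -> 'cV[R]_p -> 'cV[R]_q)
    (U V : Omega -> 'cV[R]_p) :
  {ae P, forall w, lipschitz_sq C (phi w)} ->
  (forall l, L2 P G (fun w => phi w l)) -> L2 P G U -> L2 P G V ->
  let D := (fun w => phi w (U w)) - (fun w => phi w (V w)) in
  ip P D D <= C * ip P (U - V) (U - V).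
Proof.
move=> lip Lphi LU LV /=.
have LUV : L2m P (U - V) by apply: (L2_L2m GP); exact: (L2B GP).
rewrite /ip -RintegralZl //; last exact: (integrable_sq LUV).
apply: ae_le_Rintegral.
- apply: integrable_sq; apply: (L2_L2m GP); apply: (L2B GP).
    exact: L2_nemytskii lip Lphi LU.
  exact: L2_nemytskii lip Lphi LV.
- exact: (integrableZl measurableT C (integrable_sq LUV)).
- by apply: filterS lip => w; apply.
Qed.

End nemytskii.

(** * One step backwards *)

Definition mxapp (R : realType) (Omega : Type) (p q : nat) (A : 'M[R]_(p, q))
  (U : Omega -> 'cV[R]_q) (w : Omega) : 'cV[R]_p := A *m U w.

Section mxapp_theory.
Context (R : realType) (d : measure_display) (Omega : measurableType d)
  (P : probability Omega R) (p q : nat) (A : 'M[R]_(p, q)).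
Local Notation ip := (ip P).
Implicit Types U V : Omega -> 'cV[R]_q.

Lemma mxappB U V : mxapp A (U - V) = mxapp A U - mxapp A V.
Proof. by apply/funext => w; rewrite /mxapp !fctE mulmxBr. Qed.

Lemma mxappD U V : mxapp A (U + V) = mxapp A U + mxapp A V.
Proof. by apply/funext => w; rewrite /mxapp !fctE mulmxDr. Qed.

Lemma ip_mxapp U (V : Omega -> 'cV[R]_p) : ip (mxapp A U) V = ip U (mxapp A^T
    V).
Proof. by apply: eq_Rintegral => w _; rewrite dot_adjl. Qed.

Lemma ip_mxapp_tr (U : Omega -> 'cV[R]_p) V :
  ip (mxapp A^T U) V = ip U (mxapp A V).
Proof. by apply: eq_Rintegral => w _; rewrite dot_adjl trmxK. Qed.

Lemma sq_le_pointwise k l (C : R) (U : Omega -> 'cV[R]_k) (V : Omega ->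
    'cV[R]_l) :
  L2m P U -> L2m P V ->
  {ae P, forall w, dot (U w) (U w) <= C * dot (V w) (V w)} -> ip U U <= C * ip
      V V.
Proof.
move=> LU LV UV; rewrite /ip -RintegralZl //; last exact: integrable_sq.
apply: ae_le_Rintegral => //; first exact: integrable_sq.
exact: (integrableZl measurableT C (integrable_sq LV)).
Qed.

Lemma sq_mxapp_le : exists2 C, 0 <= C & forall G (GP : complete_sub_sigma P G)
    U,
  L2 P G U -> ip (mxapp A U) (mxapp A U) <= C * ip U U.
Proof.
have [C C0 CP] := dot_mulmx_le A; exists C => // G GP U LU.
apply: sq_le_pointwise; [|exact: (L2_L2m GP)|by apply: aeW => w; exact: CP].
by apply: (L2_L2m GP); exact: (L2_mulmx GP).
Qed.

End mxapp_theory.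

Definition bounded_below (R : realType) (p q : nat) (A : 'M[R]_(p, q)) :=
  exists2 K, 0 < K & forall u : 'cV[R]_q, dot u u <= K * dot (A *m u) (A *m u).

(** With D = [diag2 G], the monotonicity terms in y and in z become the single inner product of (b,
    sigma) with D^T (y, z). *)
Definition diag2 (R : realType) (p q : nat) (A : 'M[R]_(p, q)) :
  'M[R]_(p + p, q + q) := block_mx A 0 0 A.

Lemma mul_diag2 (R : realType) (p q : nat) (A : 'M[R]_(p, q)) (u v : 'cV[R]_q) :
  diag2 A *m col_mx u v = col_mx (A *m u) (A *m v).
Proof. by rewrite mul_block_col !mul0mx addr0 add0r. Qed.

Lemma tr_diag2 (R : realType) (p q : nat) (A : 'M[R]_(p, q)) :
  (diag2 A)^T = diag2 A^T.
Proof. by rewrite tr_block_mx !trmx0. Qed.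

Lemma bounded_below_diag2 (R : realType) (p q : nat) (A : 'M[R]_(p, q)) :
  bounded_below A -> bounded_below (diag2 A).
Proof.
move=> [K K0 AK]; exists K => // u.
rewrite -(vsubmxK u) mul_diag2 !dot_col_mx mulrDr; exact: lerD.
Qed.

(** * The step equation for abstract operators on L^2 *)

Section one_step.
Context (R : realType) (d : measure_display) (Omega : measurableType d)
  (P : probability Omega R) (G G' : set (set Omega)).
Hypothesis GP : complete_sub_sigma P G.
Hypothesis GP' : complete_sub_sigma P G'.
Hypothesis GG' : G `<=` G'.
Variable xi : Omega -> R.
Hypothesis xiP : standard_increment P G G' xi.
Local Notation ip := (ip P).
Local Notation sq U := (ip U U).
Local Notation S := (noise_sum xi).

Variables (m n : nat) (A : 'M[R]_(n, m)).
Local Notation D := (diag2 A).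

Variable Pi : (Omega -> 'cV[R]_n) -> (Omega -> 'cV[R]_(n + n)).
Hypothesis PiP : forall eta, L2 P G' eta -> L2 P G (Pi eta) /\
  forall V, L2 P G V -> ip (Pi eta) V = ip eta (S V).

Variable B : (Omega -> 'cV[R]_m) -> (Omega -> 'cV[R]_(n + n)) -> (Omega ->
    'cV[R]_(m + m)).
Variables (beta1 beta2 C : R).
Hypothesis beta1_ge0 : 0 <= beta1.
Hypothesis beta2_ge0 : 0 <= beta2.
Hypothesis L2B : forall X U, L2 P G X -> L2 P G U -> L2 P G (B X U).
Hypothesis B_lip : forall X X' U U', L2 P G X -> L2 P G X' -> L2 P G U -> L2 P
    G U' ->
  sq (B X U - B X' U') <= C * (sq (X - X') + sq (U - U')).
Hypothesis B_mono : forall X U U', L2 P G X -> L2 P G U -> L2 P G U' ->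
  ip (B X U - B X U') (mxapp D^T (U - U')) <= - beta2 * sq (mxapp D^T (U - U')).

Variable Phi : (Omega -> 'cV[R]_m) -> (Omega -> 'cV[R]_n).
Variable L : R.
Hypothesis L2Phi : forall X, L2 P G' X -> L2 P G' (Phi X).
Hypothesis Phi_lip : forall X X', L2 P G' X -> L2 P G' X' ->
  sq (Phi X - Phi X') <= L * sq (X - X').
Hypothesis Phi_mono : forall X X', L2 P G' X -> L2 P G' X' ->
  beta1 * sq (mxapp A (X - X')) <= ip (Phi X - Phi X') (mxapp A (X - X')).

Hypothesis coercive : 0 < beta1 /\ bounded_below A \/ 0 < beta2 /\
    bounded_below A^T.

Let HG k := L2_semi_hilbert GP k.
Let HG' k := L2_semi_hilbert GP' k.
Let LGG' k (U : Omega -> 'cV[R]_k) : L2 P G U -> L2 P G' U := L2S GG'.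

Let L2S' k (U : Omega -> 'cV[R]_(k + k)) : L2 P G U -> L2 P G' (S U).
Proof. exact: (L2_noise_sum GP GP' GG' xiP). Qed.

Let L2mxapp p q (M : 'M[R]_(p, q)) F (FP : complete_sub_sigma P F) U :
  L2 P F U -> L2 P F (mxapp M U).
Proof. exact: (L2_mulmx FP). Qed.

Lemma noise_sum_mxapp V : S (mxapp D V) = mxapp A (S V).
Proof.
apply/funext => w; rewrite /noise_sum /mxapp -{1 2}(vsubmxK (V w)) mul_diag2.
by rewrite col_mxKu col_mxKd mulmxDr -scalemxAr.
Qed.

Lemma ip_projB eta eta' W : L2 P G' eta -> L2 P G' eta' -> L2 P G W ->
  ip (Pi eta - Pi eta') W = ip (eta - eta') (S W).
Proof.
move=> Le Le' LW; have [Lp Pe] := PiP Le; have [Lp' Pe'] := PiP Le'.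
rewrite (ipBl (HG (n + n)) Lp Lp' LW) (Pe _ LW) (Pe' _ LW).
by rewrite -(ipBl (HG' n) Le Le' (L2S' LW)).
Qed.

Let isometric k (U V : Omega -> 'cV[R]_(k + k)) : L2 P G U -> L2 P G V ->
  ip (S U) (S V) = ip U V.
Proof. exact: (ip_noise_sum GP GP' GG' xiP). Qed.

(** The adjoint of an isometry is a contraction: test with the difference of the images and apply
    Cauchy-Schwarz. *)
Lemma proj_nonexpansive eta eta' : L2 P G' eta -> L2 P G' eta' ->
  sq (Pi eta - Pi eta') <= sq (eta - eta').
Proof.
move=> Le Le'; have [Lp _] := PiP Le; have [Lp' _] := PiP Le'.
have Ld := domB (HG (n + n)) Lp Lp'; have LSd := L2S' Ld.
have de := domB (HG' n) Le Le'.
have sqE := ip_projB Le Le' Ld; have CS := ip_cauchy_schwarz (HG' n) de LSd.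
rewrite (isometric Ld Ld) -sqE in CS.
have := le_of_cauchy_schwarz ltr01 (ip_ge0 (HG (n + n)) Ld) (ip_ge0 (HG' n) de)
    CS.
by rewrite expr1n !mul1r; apply.
Qed.

Section frozen_state.
Variable X : Omega -> 'cV[R]_m.
Hypothesis LX : L2 P G X.

(** The map Psi of the overview, for a frozen state [X]. *)
Definition response V := Pi (Phi (X + S V)).

Let LXS V : L2 P G V -> L2 P G' (X + S V).
Proof. by move=> LV; apply: (domD (HG' _)); [exact: LGG'|exact: L2S']. Qed.

Let XSB V V' : (X + S V) - (X + S V') = S (V - V').
Proof. by rewrite noise_sumB opprD addrACA subrr add0r. Qed.

Lemma L2_response V : L2 P G V -> L2 P G (response V).
Proof. by move=> LV; have [] := PiP (L2Phi (LXS LV)). Qed.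

Lemma response_lip V V' : L2 P G V -> L2 P G V' ->
  sq (response V - response V') <= L * sq (V - V').
Proof.
move=> LV LV'; have LX1 := LXS LV; have LX2 := LXS LV'.
have LdV := domB (HG (m + m)) LV LV'.
apply: le_trans (proj_nonexpansive (L2Phi LX1) (L2Phi LX2)) _.
by have := Phi_lip LX1 LX2; rewrite XSB (isometric LdV LdV).
Qed.

(** S D = A S and S is isometric, so adjointness carries the monotonicity of [Phi] over to
    [response] with the same constant. *)
Lemma response_mono V V' : L2 P G V -> L2 P G V' ->
  beta1 * sq (mxapp D (V - V')) <= ip (response V - response V') (mxapp D (V -
      V')).
Proof.
move=> LV LV'; have LX1 := LXS LV; have LX2 := LXS LV'.
have LD := L2mxapp D GP (domB (HG (m + m)) LV LV').
rewrite (ip_projB (L2Phi LX1) (L2Phi LX2) LD) noise_sum_mxapp.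
have := Phi_mono LX1 LX2; rewrite XSB -noise_sum_mxapp (isometric LD LD).
exact.
Qed.

End frozen_state.

(** The equation is imposed in the seminorm, since [Pi] is only determined up to null vectors. *)
Definition step_solution X U :=
  L2 P G U /\ sq (U - Pi (Phi (X + S (B X U)))) = 0.

Lemma step_exists X : L2 P G X -> exists U, step_solution X U.
Proof.
move=> LX; pose Psi := response X.
have LPsi V : L2 P G V -> L2 P G (Psi V) by exact: L2_response.
have C0 : exists2 C', 0 <= C' & forall U U', L2 P G U -> L2 P G U' ->
    sq (B X U - B X U') <= C' * sq (U - U').
  exists `|C| => // U U' LU LU'; apply: le_trans (B_lip LX LX LU LU') _.
  rewrite subrr (ip0l (HG _)) ?add0r; last exact: (dom0 (HG _)).
  rewrite ler_wpM2r ?ler_norm //; apply: (ip_ge0 (HG _)); exact: (domB (HG _)).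
have [C' C'0 BX_lip] := C0.
have L0 : exists2 L', 0 <= L' & forall V V', L2 P G V -> L2 P G V' ->
    sq (Psi V - Psi V') <= L' * sq (V - V').
  exists `|L| => // V V' LV LV'; apply: le_trans (response_lip LX LV LV') _.
  rewrite ler_wpM2r ?ler_norm //; apply: (ip_ge0 (HG _)); exact: (domB (HG _)).
have [L' L'0 Psi_lip] := L0.
have null0 k : L2 P G (0 : Omega -> 'cV[R]_k) by exact: (dom0 (HG _)).
have dB k (U V : Omega -> 'cV[R]_k) : L2 P G U -> L2 P G V -> L2 P G (U - V).
  exact: (domB (HG _)).
have Psi_mono V V' : L2 P G V -> L2 P G V' ->
    beta1 * sq (mxapp D (V - V')) <= ip (Psi V - Psi V') (mxapp D (V - V')).
  exact: response_mono.
suff [U LU UE] : exists2 U, L2 P G U & sq (U - Psi (B X U)) = 0 by exists U.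
clearbody Psi.
have sq_ge0 k (U : Omega -> 'cV[R]_k) : L2 P G U -> 0 <= sq U.
  exact: (ip_ge0 (HG _)).
have low (k l : nat) (M : 'M[R]_(k, l)) b K V : 0 < K -> 0 < b ->
    (forall u, dot u u <= K * dot (M *m u) (M *m u)) -> L2 P G V ->
    b / K * sq V <= b * sq (mxapp M V).
  move=> K0 b0 MK LV; rewrite -mulrA ler_pM2l // ler_pdivrMl //.
  apply: sq_le_pointwise; last by apply: aeW => w; exact: MK.
    exact: (L2_L2m GP).
  by apply: (L2_L2m GP); exact: L2mxapp.
case: coercive => [[b1 /bounded_below_diag2 [K K0 DK]]|[b2 /bounded_below_diag2
    [K K0 DK]]].
- have [c c0 cP] := sq_mxapp_le P D^T.
  (* <dV, dE> = <D dV, dPsi> >= beta1 |D dV|^2 >= (beta1 / K) |dV|^2, while -<dB, dE> >= beta2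
     |dE|^2 >= 0 by the monotonicity of B. *)
  pose E V := mxapp D^T (Psi V); pose g V := V - B X (Psi V).
  have bK : 0 < beta1 / K by exact: divr_gt0.
  have LE V : L2 P G V -> L2 P G (E V).
    by move=> LV; apply: (L2mxapp _ GP); exact: LPsi.
  have Lg V : L2 P G V -> L2 P G (g V).
    by move=> LV; apply: dB => //; apply: L2B => //; exact: LPsi.
  have E_lip V V' : L2 P G V -> L2 P G V' ->
      sq (E V - E V') <= c * L' * sq (V - V').
    move=> LV LV'; rewrite /E -mxappB.
    apply: le_trans (cP _ GP _ (dB _ _ _ (LPsi _ LV) (LPsi _ LV'))) _.
    by rewrite -mulrA ler_wpM2l //; exact: Psi_lip.
  have E_mono V V' : L2 P G V -> L2 P G V' ->
      beta1 / K * sq (V - V') <= ip (E V - E V') (V - V').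
    move=> LV LV'; rewrite /E -mxappB ip_mxapp_tr.
    apply: le_trans (low _ _ _ _ _ _ K0 b1 DK (dB _ _ _ LV LV')) _.
    exact: Psi_mono.
  have g_lip V V' : L2 P G V -> L2 P G V' ->
      sq (g V - g V') <= 2 * (1 + C' * L') * sq (V - V').
    move=> LV LV'; have LPV := LPsi _ LV; have LPV' := LPsi _ LV'.
    have LB := L2B LX LPV; have LB' := L2B LX LPV'.
    rewrite /g opprD addrACA -opprD.
    apply: le_trans (sqB_le (HG _) (dB _ _ _ LV LV') (dB _ _ _ LB LB')) _.
    rewrite -mulrA ler_pM2l // mulrDl mul1r lerD2l.
    apply: le_trans (BX_lip _ _ LPV LPV') _.
    by rewrite -mulrA ler_wpM2l //; exact: Psi_lip.
  have g_mono V V' : L2 P G V -> L2 P G V' ->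
      beta1 / K * sq (V - V') <= ip (g V - g V') (E V - E V').
    move=> LV LV'; have LPV := LPsi _ LV; have LPV' := LPsi _ LV'.
    have LB := L2B LX LPV; have LB' := L2B LX LPV'.
    have LdE : L2 P G (E V - E V') by apply: dB; exact: LE.
    have LdB := dB _ _ _ LB LB'; have LdV := dB _ _ _ LV LV'.
    rewrite /g opprD addrACA -opprD (ipBl (HG (m + m)) LdV LdB LdE).
    rewrite (ipC (HG (m + m)) (V - V') (E V - E V')).
    have := E_mono _ _ LV LV'; have := B_mono LX LPV LPV'.
    rewrite mxappB -/(E V) -/(E V').
    have := mulr_ge0 beta2_ge0 (sq_ge0 _ _ LdE).
    by rewrite mulNr; lra.
  have [V LV gV] := relatively_monotone_surj (HG _) bK bK LE Lg E_lip E_mono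
    g_lip g_mono (null0 _).
  have LPV := LPsi _ LV; have LB := L2B LX LPV.
  have gV0 : sq (V - B X (Psi V)) = 0 by rewrite -gV subr0.
  (* V and B(X, Psi V) differ by a null vector, and so do their images under the Lipschitz map
     Psi. *)
  exists (Psi V) => //; have := Psi_lip _ _ LV LB; rewrite gV0 mulr0 => le0.
  by apply/eqP; rewrite eq_le le0 (sq_ge0 _ _ (dB _ _ _ LPV (LPsi _ LB))).
- have [c c0 cP] := sq_mxapp_le P D.
  rewrite -tr_diag2 in DK.
  (* <dU, dE> = -<dB, D^T dU> >= beta2 |D^T dU|^2 >= (beta2 / K) |dU|^2, while -<dPsi, dE> = <dPsi,
     D dB> >= beta1 |D dB|^2 >= 0. *)
  pose E U := - mxapp D (B X U); pose g U := U - Psi (B X U).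
  have bK : 0 < beta2 / K by exact: divr_gt0.
  have LE U : L2 P G U -> L2 P G (E U).
    by move=> LU; apply: (domN (HG _)); apply: (L2mxapp _ GP); exact: L2B.
  have Lg U : L2 P G U -> L2 P G (g U).
    by move=> LU; apply: dB => //; apply: LPsi; exact: L2B.
  have dE U U' : E U - E U' = - mxapp D (B X U - B X U').
    by rewrite mxappB opprB /E opprK addrC.
  have LdE U U' : L2 P G U -> L2 P G U' -> L2 P G (mxapp D (B X U - B X U')).
    by move=> LU LU'; apply: (L2mxapp _ GP); apply: dB; exact: L2B.
  have E_lip U U' : L2 P G U -> L2 P G U' ->
      sq (E U - E U') <= c * C' * sq (U - U').
    move=> LU LU'; rewrite dE (sqN (HG _)); last exact: LdE.
    have LdB := dB _ _ _ (L2B LX LU) (L2B LX LU').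
    apply: le_trans (cP _ GP _ LdB) _.
    by rewrite -mulrA ler_wpM2l //; exact: BX_lip.
  have E_mono U U' : L2 P G U -> L2 P G U' ->
      beta2 / K * sq (U - U') <= ip (E U - E U') (U - U').
    move=> LU LU'; have LdU := dB _ _ _ LU LU'.
    rewrite dE (ipNl (HG _)) //; last exact: LdE.
    rewrite ip_mxapp lerNr; apply: le_trans (B_mono LX LU LU') _.
    by rewrite mulNr lerN2; exact: (low _ _ _ _ _ _ K0 b2 DK).
  have g_lip U U' : L2 P G U -> L2 P G U' ->
      sq (g U - g U') <= 2 * (1 + L' * C') * sq (U - U').
    move=> LU LU'; have LB := L2B LX LU; have LB' := L2B LX LU'.
    have LPB := LPsi _ LB; have LPB' := LPsi _ LB'.
    rewrite /g opprD addrACA -opprD.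
    apply: le_trans (sqB_le (HG _) (dB _ _ _ LU LU') (dB _ _ _ LPB LPB')) _.
    rewrite -mulrA ler_pM2l // mulrDl mul1r lerD2l.
    apply: le_trans (Psi_lip _ _ LB LB') _.
    by rewrite -mulrA ler_wpM2l //; exact: BX_lip.
  have g_mono U U' : L2 P G U -> L2 P G U' ->
      beta2 / K * sq (U - U') <= ip (g U - g U') (E U - E U').
    move=> LU LU'; have LB := L2B LX LU; have LB' := L2B LX LU'.
    have LPB := LPsi _ LB; have LPB' := LPsi _ LB'; have LdB := LdE _ _ LU LU'.
    have LdP := dB _ _ _ LPB LPB'; have LdU := dB _ _ _ LU LU'.
    have LdEU : L2 P G (E U - E U') by apply: dB; exact: LE.
    rewrite /g opprD addrACA -opprD (ipBl (HG (n + n)) LdU LdP LdEU).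
    rewrite (ipC (HG (n + n)) (U - U') (E U - E U')).
    have := E_mono _ _ LU LU'; rewrite [in X in _ - ip _ X]dE (ipNr (HG (n +
        n)) LdP LdB).
    have := Psi_mono _ _ LB LB'.
    have := mulr_ge0 beta1_ge0 (sq_ge0 _ _ LdB).
    lra.
  have [U LU gU] := relatively_monotone_surj (HG _) bK bK LE Lg E_lip E_mono
    g_lip g_mono (null0 _).
  by exists U => //; move: gU; rewrite subr0.
Qed.

(** It writes a vector measurable for [G] in the form S U, and at time T it supplies 0 in the place
    of Z_T. *)
Definition pad (V : Omega -> 'cV[R]_n) (w : Omega) : 'cV[R]_(n + n) :=
  col_mx (V w) 0.

Lemma L2_pad V : L2 P G V -> L2 P G (pad V).
Proof.
move=> LV; exact: (L2_col_mx GP (U := V) (V := fun _ => 0) LV (L2_cst GP 0)).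
Qed.

Lemma noise_sum_pad V : S (pad V) = V.
Proof.
apply/funext => w.
by rewrite /noise_sum /pad col_mxKu col_mxKd scaler0 addr0.
Qed.

Definition next_state X U := X + S (B X U).

Lemma L2_next_state X U : L2 P G X -> L2 P G U -> L2 P G' (next_state X U).
Proof.
by move=> LX LU; apply: (domD (HG' m)); [exact: LGG'|apply: L2S'; exact: L2B].
Qed.

(** * Energy identity and stability of the step *)

Section two_solutions.
Variables (X X' : Omega -> 'cV[R]_m) (U U' : Omega -> 'cV[R]_(n + n)).
Hypothesis LX : L2 P G X.
Hypothesis LX' : L2 P G X'.
Hypothesis XU : step_solution X U.
Hypothesis XU' : step_solution X' U'.
Let LU : L2 P G U := XU.1.
Let LU' : L2 P G U' := XU'.1.
Let LN := L2_next_state LX LU.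
Let LN' := L2_next_state LX' LU'.
Let LdU := domB (HG (n + n)) LU LU'.
Let LdX := domB (HG m) LX LX'.
Let LB := L2B LX LU.
Let LB' := L2B LX' LU'.
Let LdB := domB (HG (m + m)) LB LB'.
Local Notation dX := (X - X').
Local Notation dU := (U - U').
Local Notation dB := (B X U - B X' U').
Local Notation dPhi := (Phi (next_state X U) - Phi (next_state X' U')).

(** U equals Pi (Phi X+) up to a null vector, which no inner product detects; adjointness then
    eliminates Pi. *)
Lemma ip_step_solutionB W : L2 P G W -> ip dU W = ip dPhi (S W).
Proof.
move=> LW; have [Lp _] := PiP (L2Phi LN); have [Lp' _] := PiP (L2Phi LN').
rewrite -(ip_projB (L2Phi LN) (L2Phi LN') LW).
have e1 := ip_null (HG (n + n)) (domB (HG (n + n)) LU Lp) LW XU.2.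
have e2 := ip_null (HG (n + n)) (domB (HG (n + n)) LU' Lp') LW XU'.2.
rewrite (ipBl (HG (n + n)) LU Lp LW) in e1.
rewrite (ipBl (HG (n + n)) LU' Lp' LW) in e2.
rewrite (ipBl (HG (n + n)) LU LU' LW) (ipBl (HG (n + n)) Lp Lp' LW).
move: e1 e2; move: (ip U W) (ip U' W) (ip (Pi (Phi (next_state X U))) W).
by move: (ip (Pi (Phi (next_state X' U'))) W) => *; lra.
Qed.

Lemma sq_step_solutionB : sq dU <= sq dPhi.
Proof.
have CS := ip_cauchy_schwarz (HG' n) (domB (HG' n) (L2Phi LN) (L2Phi LN'))
    (L2S' LdU).
rewrite -(ip_step_solutionB LdU) (isometric LdU LdU) in CS.
have := le_of_cauchy_schwarz ltr01 (ip_ge0 (HG (n + n)) LdU)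
  (ip_ge0 (HG' n) (domB (HG' n) (L2Phi LN) (L2Phi LN'))) CS.
by rewrite expr1n !mul1r; apply.
Qed.

(* <dPhi, G dX+> computed from X+ = X + S B(X, U), through the adjoint of S. *)
Lemma step_energy :
  beta1 * sq (mxapp A (next_state X U - next_state X' U')) <=
  ip dU (pad (mxapp A dX)) + ip dB (mxapp D^T dU).
Proof.
have LA : L2 P G (mxapp A dX) by exact: (L2mxapp A GP LdX).
have LD : L2 P G (mxapp D dB) by exact: (L2mxapp D GP LdB).
have Lpad := L2_pad LA.
have -> : ip dB (mxapp D^T dU) = ip dU (mxapp D dB).
  by rewrite (ipC (HG (m + m)) dB) ip_mxapp_tr.
have -> : ip dU (pad (mxapp A dX)) + ip dU (mxapp D dB) =
    ip dPhi (mxapp A (next_state X U - next_state X' U')).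
  rewrite (ip_step_solutionB Lpad) (ip_step_solutionB LD).
  have Ld := domB (HG' n) (L2Phi LN) (L2Phi LN').
  rewrite !(ipC (HG' n) dPhi) -(ipDl (HG' n) (L2S' Lpad) (L2S' LD) Ld).
  rewrite noise_sum_pad noise_sum_mxapp noise_sumB -mxappD.
  by rewrite /next_state [in RHS]opprD addrACA.
exact: Phi_mono LN LN'.
Qed.

End two_solutions.

(* Passing from (X, U) to (X', U') through (X, U') separates the dissipation in U
   from terms that are Lipschitz in X. *)
Lemma step_stable : exists2 c, 0 <= c & forall X X' U U',
  L2 P G X -> L2 P G X' -> step_solution X U -> step_solution X' U' ->
  sq (U - U') <= c * sq (X - X').
Proof.
have [cA cA0 cAP] := sq_mxapp_le P A; have [cD cD0 cDP] := sq_mxapp_le P D.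
(* In both cases the dissipation on the right controls dU: directly through D^T if beta2 > 0, and
   through |dU| <= |dPhi|, the Lipschitz bound on Phi and the injectivity of A if beta1 > 0. *)
suff [mu mu0 muP] : exists2 mu, 0 < mu & forall X X' U U',
    L2 P G X -> L2 P G X' -> step_solution X U -> step_solution X' U' ->
    mu * sq (U - U') <= beta1 * sq (mxapp A (next_state X U - next_state X' U'))
      + beta2 * sq (mxapp D^T (U - U')).
  exists (`|2 * (cA + cD * C)| / mu ^+ 2) => [|X X' U U' LX LX' XU XU'].
    by rewrite divr_ge0 // sqr_ge0.
  have LU := XU.1; have LU' := XU'.1.
  have LdU := domB (HG (n + n)) LU LU'; have LdX := domB (HG m) LX LX'.
  have LB := L2B LX LU; have LB1 := L2B LX LU'; have LB' := L2B LX' LU'.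
  have Ld1 := domB (HG (m + m)) LB LB1; have Ld2 := domB (HG (m + m)) LB1 LB'.
  have LDT := L2mxapp D^T GP LdU.
  have LP := L2_pad (L2mxapp A GP LdX); have LD2 := L2mxapp D GP Ld2.
  (* W is what remains paired with dU in the energy identity once the dissipation is moved to the
     left; it is bounded by dX alone. *)
  pose W := pad (mxapp A (X - X')) + mxapp D (B X U' - B X' U').
  have LW : L2 P G W := domD (HG (n + n)) LP LD2.
  have sqW : sq W <= 2 * (cA + cD * C) * sq (X - X').
    apply: le_trans (sqD_le (HG (n + n)) LP LD2) _.
    rewrite -mulrA ler_pM2l // mulrDl; apply: lerD.
      by rewrite -(isometric LP LP) noise_sum_pad; exact: (cAP _ GP _ LdX).
    apply: le_trans (cDP _ GP _ Ld2) _; rewrite -mulrA ler_wpM2l //.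
    have := B_lip LX LX' LU' LU'.
    by rewrite subrr (ip0l (HG (n + n)) (dom0 (HG (n + n)))) addr0.
  have energy := step_energy LX LX' XU XU'.
  have dissip := B_mono LX LU LU'.
  have low := muP _ _ _ _ LX LX' XU XU'.
  have split_dB : ip (B X U - B X' U') (mxapp D^T (U - U')) =
      ip (B X U - B X U') (mxapp D^T (U - U')) +
      ip (U - U') (mxapp D (B X U' - B X' U')).
    rewrite -(ip_mxapp_tr P D) [ip (mxapp D^T _) _](ipC (HG (m + m))).
    by rewrite -(ipDl (HG (m + m)) Ld1 Ld2 LDT) addrA subrK.
  have xW : ip (U - U') W = ip (U - U') (pad (mxapp A (X - X'))) +
      ip (U - U') (mxapp D (B X U' - B X' U')).
    by rewrite /W !(ipC (HG (n + n)) (U - U')) (ipDl (HG (n + n)) LP LD2 LdU).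
  have lowW : mu * sq (U - U') <= ip (U - U') W.
    rewrite xW; move: energy dissip low; rewrite split_dB mulNr.
    move: (sq (U - U')) (sq (mxapp A _)) (sq (mxapp D^T _)) (ip _ (pad _)).
    move: (ip (B X U - B X U') _) (ip _ (mxapp D _)) => *; lra.
  have CS := ip_cauchy_schwarz (HG (n + n)) LdU LW; rewrite mulrC in CS.
  have := le_of_cauchy_schwarz mu0 (ip_ge0 (HG (n + n)) LdU)
    (ip_ge0 (HG (n + n)) LW) CS lowW.
  move=> /le_trans/(_ sqW) le1.
  rewrite mulrAC ler_pdivlMr ?exprn_gt0 // mulrC; apply: le_trans le1 _.
  by rewrite ler_wpM2r ?ler_norm //; exact: (ip_ge0 (HG m) LdX).
case: coercive => [[b1 [K K0 AK]]|[b2 /bounded_below_diag2 [K K0 DK]]].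
- have L1 : 0 < `|L| + 1 by have := normr_ge0 L; lra.
  exists (beta1 / ((`|L| + 1) * K)) => [|X X' U U' LX LX' XU XU'].
    by rewrite divr_gt0 ?mulr_gt0.
  have LN := L2_next_state LX XU.1; have LN' := L2_next_state LX' XU'.1.
  have LdN := domB (HG' m) LN LN'; have LAN := L2mxapp A GP' LdN.
  have le1 := sq_step_solutionB LX LX' XU XU'.
  have le2 := Phi_lip LN LN'.
  have le3 : sq (next_state X U - next_state X' U') <=
      K * sq (mxapp A (next_state X U - next_state X' U')).
    apply: sq_le_pointwise; [exact: (L2_L2m GP' LdN)|exact: (L2_L2m GP' LAN)|].
    by apply: aeW => w; exact: AK.
  have q2 := ip_ge0 (HG (m + m)) (L2mxapp D^T GP (domB (HG (n + n)) XU.1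
      XU'.1)).
  have n0 := ip_ge0 (HG' m) LdN.
  move: (le_trans le1 le2) le3 q2 n0 => {le1 le2}.
  move: (sq (U - U')) (sq (mxapp D^T _)) (sq (next_state X U - _)) (sq (mxapp A
      _)).
  move=> u q2 s a us sa q20 s0.
  have us' : u <= (`|L| + 1) * K * a.
    apply: le_trans us _; apply: (@le_trans _ _ ((`|L| + 1) * s)).
      by rewrite ler_wpM2r //; have := ler_norm L; lra.
    by rewrite -mulrA ler_pM2l.
  apply: (@le_trans _ _ (beta1 * a)); last by rewrite lerDl mulr_ge0.
  by rewrite -mulrA ler_pM2l // ler_pdivrMl ?mulr_gt0.
- exists (beta2 / K) => [|X X' U U' LX LX' XU XU']; first exact: divr_gt0.
  have LN := L2_next_state LX XU.1; have LN' := L2_next_state LX' XU'.1.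
  have q1 := ip_ge0 (HG' n) (L2mxapp A GP' (domB (HG' m) LN LN')).
  have LdU := domB (HG (n + n)) XU.1 XU'.1; have LDT := L2mxapp D^T GP LdU.
  have le1 : sq (U - U') <= K * sq (mxapp D^T (U - U')).
    apply: sq_le_pointwise; [exact: (L2_L2m GP LdU)|exact: (L2_L2m GP LDT)|].
    by apply: aeW => w; rewrite /mxapp tr_diag2; exact: DK.
  move: q1 le1; move: (sq (U - U')) (sq (mxapp D^T _)) (sq (mxapp A _)) => u q
      a a0 uq.
  apply: (@le_trans _ _ (beta2 * q)); last by rewrite lerDr mulr_ge0.
  by rewrite -mulrA ler_pM2l // ler_pdivrMl.
Qed.

Lemma step_unique X X' U U' : L2 P G X -> L2 P G X' -> sq (X - X') = 0 ->
  step_solution X U -> step_solution X' U' -> sq (U - U') = 0.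
Proof.
move=> LX LX' XX' XU XU'; have [c c0 cP] := step_stable.
have := cP _ _ _ _ LX LX' XU XU'; rewrite XX' mulr0 => le0.
apply/eqP; rewrite eq_le le0.
exact: (ip_ge0 (HG (n + n)) (domB (HG (n + n)) XU.1 XU'.1)).
Qed.

(** * The field of the preceding time and its bounds *)

Variable F : (Omega -> 'cV[R]_m) -> (Omega -> 'cV[R]_(n + n)) -> (Omega ->
    'cV[R]_n).
Variable CF : R.
Hypothesis L2F : forall X U, L2 P G X -> L2 P G U -> L2 P G (F X U).
Hypothesis F_lip : forall X X' U U', L2 P G X -> L2 P G X' -> L2 P G U -> L2 P
    G U' ->
  sq (F X U - F X' U') <= CF * (sq (X - X') + sq (U - U')).
Hypothesis F_mono : forall X X' U U', L2 P G X -> L2 P G X' -> L2 P G U -> L2 P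
    G U' ->
  ip (B X U - B X' U') (mxapp D^T (U - U')) - ip (F X U - F X' U') (mxapp A (X
      - X'))
  <= - beta1 * sq (mxapp A (X - X')).

Definition first_block (U : Omega -> 'cV[R]_(n + n)) (w : Omega) : 'cV[R]_n :=
  usubmx (U w).

Variable sol : (Omega -> 'cV[R]_m) -> (Omega -> 'cV[R]_(n + n)).
Hypothesis solP : forall X, L2 P G X -> step_solution X (sol X).

Let Phi' X := first_block (sol X) + F X (sol X).

Let L2fb U : L2 P G U -> L2 P G (first_block U).
Proof. exact: (L2_usubmx GP). Qed.

Let L2_Phi' X : L2 P G X -> L2 P G (Phi' X).
Proof.
move=> LX; have LU := (solP LX).1.
exact: (domD (HG n) (L2fb LU) (L2F LX LU)).
Qed.

Let Phi'B X X' : Phi' X - Phi' X' =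
  first_block (sol X - sol X') + (F X (sol X) - F X' (sol X')).
Proof.
rewrite /Phi' opprD addrACA; congr (_ + _).
by apply/funext => w; rewrite /first_block !fctE linearB.
Qed.

Lemma step_output_lip : exists L', forall X X', L2 P G X -> L2 P G X' ->
  sq (Phi' X - Phi' X') <= L' * sq (X - X').
Proof.
have [c c0 cP] := step_stable.
exists (2 * (c + `|CF| * (1 + c))) => X X' LX LX'.
have XU := solP LX; have XU' := solP LX'; have LU := XU.1; have LU' := XU'.1.
have LdU := domB (HG (n + n)) LU LU'.
have LF := domB (HG n) (L2F LX LU) (L2F LX' LU').
rewrite Phi'B; apply: le_trans (sqD_le (HG n) (L2fb LdU) LF) _.
have le1 : sq (first_block (sol X - sol X')) <= 1 * sq (sol X - sol X').
  apply: sq_le_pointwise.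
  - exact: (L2_L2m GP (L2fb LdU)).
  - exact: (L2_L2m GP LdU).
  - apply: aeW => w; rewrite mul1r /first_block.
    by rewrite -{3 4}(vsubmxK ((sol X - sol X') w)) dot_col_mx lerDl dot_ge0.
have le2 := F_lip LX LX' LU LU'; have le3 := cP _ _ _ _ LX LX' XU XU'.
have x0 := ip_ge0 (HG m) (domB (HG m) LX LX').
have u0 := ip_ge0 (HG (n + n)) LdU.
rewrite -mulrA ler_pM2l // mulrDl; apply: lerD.
  by apply: le_trans le1 _; rewrite mul1r.
apply: le_trans le2 _; apply: (@le_trans _ _ (`|CF| * (sq (X - X') + sq (sol X
    - sol X')))).
  by rewrite ler_wpM2r ?ler_norm ?addr_ge0.
by rewrite -mulrA ler_wpM2l // mulrDl mul1r lerD2l.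
Qed.

(** [step_energy] gives 0 <= <dY, A dX> + <dB, D^T dU>, and [F_mono] bounds the last term by <dF, A
    dX> - beta1 |A dX|^2. The constant beta1 is thus reproduced exactly. *)
Lemma step_output_mono X X' : L2 P G X -> L2 P G X' ->
  beta1 * sq (mxapp A (X - X')) <= ip (Phi' X - Phi' X') (mxapp A (X - X')).
Proof.
move=> LX LX'; have XU := solP LX; have XU' := solP LX'.
have LU := XU.1; have LU' := XU'.1.
have LdU := domB (HG (n + n)) LU LU'; have LA := L2mxapp A GP (domB (HG m) LX
    LX').
have LF := domB (HG n) (L2F LX LU) (L2F LX' LU').
rewrite Phi'B (ipDl (HG n) (L2fb LdU) LF LA).
have -> : ip (first_block (sol X - sol X')) (mxapp A (X - X')) =
    ip (sol X - sol X') (pad (mxapp A (X - X'))).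
  apply: eq_Rintegral => w _; rewrite /first_block /pad.
  by rewrite -{2}(vsubmxK ((sol X - sol X') w)) dot_col_mx dot0r addr0.
have := step_energy LX LX' XU XU'; have := F_mono LX LX' LU LU'.
have LN := L2_next_state LX LU; have LN' := L2_next_state LX' LU'.
have := mulr_ge0 beta1_ge0 (ip_ge0 (HG' n) (L2mxapp A GP' (domB (HG' m) LN
    LN'))).
rewrite mulNr; move: (beta1 * sq (mxapp A (next_state _ _ - _))).
move: (ip _ (pad _)) (ip (B _ _ - _) _) (ip (F _ _ - _) _) (beta1 * _) => *;
    lra.
Qed.

End one_step.

(** * Martingales with respect to the noise *)

Section noise.
Context (R : realType) (d : measure_display) (Omega : measurableType d)
  (P : probability Omega R) (T : nat) (W : nat -> Omega -> R).
Hypothesis hW : driving_noise P T W.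
Local Notation H := (history P W).

Lemma history_mono s t : (s <= t)%N -> H s `<=` H t.
Proof.
move=> st; apply: sub_sigma_algebra2; apply: setSU => A [r /= rs Ar].
by exists r => //=; exact: leq_trans rs st.
Qed.

Lemma history_complete t : (t <= T)%N -> complete_sub_sigma P (H t).
Proof.
move=> tT; split.
- exact: smallest_sigma_algebra.
- by rewrite -(noise_full hW); exact: history_mono.
- by move=> A nA; apply: sub_sigma_algebra; right.
Qed.

Lemma noise_adapted t : measurable_wrt (H t) (W t).
Proof. by move=> A WA; apply: sub_sigma_algebra; left; exists t => /=. Qed.

(** Only the unconditional variance is given; independence makes it conditional. *)
Lemma noise_increment t : (t < T)%N ->
  standard_increment P (H t) (H t.+1) (delta W t).
Proof.
move=> tT; have tT' := ltnW tT.
have Wi s : (s <= T)%N -> P.-integrable setT (EFin \o W s).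
  by move=> sT; have [] := (noise_martingale hW).1 _ sT.
have ad : measurable_wrt (H t.+1) (delta W t).
  apply: (measurable_wrtD (history_complete tT)); first exact: noise_adapted.
  apply: (measurable_wrtN (history_complete tT)).
  by apply: measurable_wrtS (history_mono (leqnSn t)) _; exact: noise_adapted.
split=> //.
- exact: (integrableB measurableT (Wi _ tT) (Wi _ tT')).
- move=> A HA; have [_ _ _ /(_ _ HA) <-] := noise_cond_mean hW tT.
  by rewrite integral0.
- move=> A HA; have GP := history_complete tT'.
  have mD := measurable_wrt_measurable (sub_sigma_measurable (history_complete
      tT)) ad.
  rewrite (indep_integral_sq (sub_sigma_measurable GP) mD _ HA); last first.
    by apply: (noise_indep hW); rewrite leqnSn.
  by have := noise_variance hW tT; rewrite unlock => ->; rewrite mule1.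
Qed.

Lemma L2_noise_value s t : (s <= t)%N -> (t <= T)%N ->
  L2 P (H t) (fun w => const_mx (W s w) : 'cV[R]_1).
Proof.
move=> st tT; split=> [i|].
  have := measurable_wrtS (history_mono st) (noise_adapted (t:=s)).
  by congr (measurable_wrt _ _); apply/funext => w; rewrite mxE.
have := noise_square_integrable hW (leq_trans st tT).
congr (_ < _)%E; apply: eq_integral => w _.
by rewrite enorm_sqr /dot big_ord1 !mxE expr2.
Qed.

End noise.

(** * Martingales through their one-step increments *)

Section martingale_increments.
Context (R : realType) (d : measure_display) (Omega : measurableType d)
  (P : probability Omega R).

Lemma Rintegral_indic (f : Omega -> R) (A : set Omega) : measurable A ->
  P.-integrable setT (EFin \o f) ->
  (\int[P]_(w in A) (f w)%:E = (\int[P]_w (f w * \1_A w))%:E)%E.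
Proof.
move=> mA fi; rewrite -[LHS]fineK; last first.
  by apply: integrable_fin_num => //; exact: integrableS fi.
congr EFin; rewrite -[LHS]/(\int[P]_(w in A) f w)%R Rintegral_mkcond.
apply: eq_Rintegral => w _; rewrite patchE indicE.
by case: ifPn => _; rewrite ?mulr1 ?mulr0.
Qed.

Lemma integrable_indicr (f : Omega -> R) (A : set Omega) : measurable A ->
  P.-integrable setT (EFin \o f) ->
  P.-integrable setT (EFin \o (fun w => f w * \1_A w)).
Proof.
move=> mA fi; apply: (le_integrable _ _ _ fi) => //.
  apply/measurable_EFinP/measurable_funM; last exact: measurable_indic.
  by apply/measurable_EFinP; exact: (measurable_int _ fi).
move=> w _ /=; rewrite lee_fin normrM indicE.
by case: (w \in A); rewrite ?normr1 ?normr0 ?mulr1 ?mulr0.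
Qed.

Lemma integral_eq_of_increment (f g : Omega -> R) (A : set Omega) : measurable
    A ->
  P.-integrable setT (EFin \o f) -> P.-integrable setT (EFin \o g) ->
  (\int[P]_(w in A) (f w)%:E = \int[P]_(w in A) (g w)%:E)%E <->
  \int[P]_w ((g w - f w) * \1_A w) = 0.
Proof.
move=> mA fi gi; rewrite !Rintegral_indic //.
have -> : \int[P]_w ((g w - f w) * \1_A w) =
    \int[P]_w (g w * \1_A w) - \int[P]_w (f w * \1_A w).
  rewrite -RintegralB //; do ?exact: integrable_indicr.
  by apply: eq_Rintegral => w _; rewrite mulrBl.
split=> [[->]|/eqP]; first by rewrite subrr.
by rewrite subr_eq0 => /eqP ->.
Qed.

Variables (H : nat -> set (set Omega)) (T : nat).
Hypothesis HP : forall t, (t <= T)%N -> complete_sub_sigma P (H t).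
Hypothesis Hmono : forall s t, (s <= t)%N -> H s `<=` H t.

(** A set of H s stays in every later H r, so its integrals are carried from s to t one step at a
    time. *)
Lemma martingale_of_increments (M : nat -> Omega -> R) :
  (forall t, (t <= T)%N -> measurable_wrt (H t) (M t) /\
     P.-integrable setT (EFin \o M t)) ->
  (forall t A, (t < T)%N -> H t A -> \int[P]_w (delta M t w * \1_A w) = 0) ->
  martingale P H T M.
Proof.
move=> Mi incr; split=> // s t /andP[st tT].
have sT := leq_trans st tT; have [ms ints] := Mi _ sT; have [mt intt] := Mi _
    tT.
split=> // A HA; have mA := sub_sigma_measurable (HP sT) HA.
elim: t st tT {mt intt} => [|t IH] st tT.
  by move: st; rewrite leqn0 => /eqP ->.
move: st; rewrite leq_eqVlt => /orP[/eqP <- //|st].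
rewrite IH //; last exact: ltnW.
have [_ it] := Mi _ (ltnW tT); have [_ it1] := Mi _ tT.
apply/(integral_eq_of_increment mA it it1); apply: incr => //.
exact: (@Hmono s t st _ HA).
Qed.

Lemma martingale_increment (M : nat -> Omega -> R) t A :
  martingale P H T M -> (t < T)%N -> H t A ->
  \int[P]_w (delta M t w * \1_A w) = 0.
Proof.
move=> [Mi Mm] tT HA; have [_ it] := Mi _ (ltnW tT); have [_ it1] := Mi _ tT.
apply/(integral_eq_of_increment (sub_sigma_measurable (HP (ltnW tT)) HA) it
    it1).
have tt : (t <= t.+1 <= T)%N by rewrite leqnSn.
by have [_ _ _ /(_ _ HA)] := Mm _ _ tt.
Qed.

End martingale_increments.

(** * Strong orthogonality as orthogonality to the range of S *)

Section orthogonal_increment.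
Context (R : realType) (d : measure_display) (Omega : measurableType d)
  (P : probability Omega R).

Lemma integrable_entry_mul k l (U : Omega -> 'cV[R]_k) (V : Omega -> 'cV[R]_l)
    i j :
  L2m P U -> L2m P V -> P.-integrable setT (EFin \o (fun w => U w i 0 * V w j
      0)).
Proof.
move=> LU LV.
apply: (le_integrable _ _ _ (integrableD measurableT (integrable_sq LU)
    (integrable_sq LV))) => //.
  apply/measurable_EFinP/measurable_funM.
    by apply: (@measurable_wrt_measurable _ _ _ measurable) => //; exact: LU.1.
  by apply: (@measurable_wrt_measurable _ _ _ measurable) => //; exact: LV.1.
move=> w _ /=; rewrite lee_fin [leRHS]ger0_norm ?addr_ge0 ?dot_ge0 //.
have := le_sqr_dot (U w) i; have := le_sqr_dot (V w) j.
have := sqr_ge0 (U w i 0 - V w j 0); have := sqr_ge0 (U w i 0 + V w j 0).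
by rewrite ler_norml; nra.
Qed.

Lemma Rintegral_fin_sum (I : finType) (f : I -> Omega -> R) :
  (forall i, P.-integrable setT (EFin \o f i)) ->
  \int[P]_w (\sum_i f i w) = \sum_i \int[P]_w f i w.
Proof.
move=> fi; elim: (index_enum I) => [|a s IH].
  rewrite big_nil; under eq_Rintegral do rewrite big_nil.
  by rewrite /Rintegral integral0.
rewrite big_cons -IH -RintegralD //.
  by apply: eq_Rintegral => w _; rewrite big_cons.
have := integrable_sum measurableT s (P := xpredT) (fun i _ => fi i).
by congr (P.-integrable setT _); apply/funext => w; rewrite /= sumEFin.
Qed.

Context (G G' : set (set Omega)).
Hypothesis GP : complete_sub_sigma P G.
Hypothesis GP' : complete_sub_sigma P G'.
Hypothesis GG' : G `<=` G'.
Variable xi : Omega -> R.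
Hypothesis xiP : standard_increment P G G' xi.
Let sG := sub_sigma GP.
Let Gm := sub_sigma_measurable GP.

Lemma L2_indic k (U : Omega -> 'cV[R]_k) A : G A -> L2 P G U ->
  L2 P G (fun w => \1_A w *: U w).
Proof.
move=> GA LU; apply: (L2_dominated GP _ (integrable_sq (L2_L2m GP LU))).
  apply: (measurable_wrt_scaler GP) => [|i]; last exact: LU.1.
  apply/(measurable_wrtP _ sG); apply: measurable_indic.
  by rewrite /measurable /= sigma_algebra_id.
apply: aeW => w; rewrite !dotE indicE.
by case: (w \in A); rewrite ?mul1r // mul0r dot_ge0.
Qed.

Lemma L2_increment : L2 P G' (fun w => const_mx (xi w) : 'cV[R]_1).
Proof.
have := L2_noise GP GP' GG' xiP (L2_cst GP (const_mx 1 : 'cV[R]_1)).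
by congr (L2 P G' _); apply/funext => w; apply/colP => i; rewrite !mxE mulr1.
Qed.

Variables (n : nat) (N0 N1 : Omega -> 'cV[R]_n) (W0 : Omega -> R).
Hypothesis LN0 : L2 P G N0.
Hypothesis LN1 : L2 P G' N1.
Hypothesis LW0 : L2 P G (fun w => const_mx (W0 w) : 'cV[R]_1).
Let dN := N1 - N0.
Let LdN : L2 P G' dN := L2B GP' LN1 (L2S GG' LN0).
Let dN_m := L2_L2m GP' LdN.

Let dNxi_int i : P.-integrable setT (EFin \o (fun w => dN w i 0 * xi w)).
Proof.
have := integrable_entry_mul i 0 dN_m (L2_L2m GP' L2_increment).
by congr (P.-integrable setT _); apply/funext => w /=; rewrite [const_mx _ _
    _]mxE.
Qed.

Let mW0 : measurable_wrt G W0.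
Proof.
by have := LW0.1 0; congr (measurable_wrt G _); apply/funext => w; rewrite mxE.
Qed.

Let dNW_int i : P.-integrable setT (EFin \o (fun w => dN w i 0 * W0 w)).
Proof.
have := integrable_entry_mul i 0 dN_m (L2_L2m GP LW0).
by congr (P.-integrable setT _); apply/funext => w /=; rewrite [const_mx _ _
    _]mxE.
Qed.

Let N0xi_int i : P.-integrable setT (EFin \o (fun w => N0 w i 0 * xi w)).
Proof.
have := integrable_entry_mul i 0 (L2_L2m GP LN0) (L2_L2m GP' L2_increment).
by congr (P.-integrable setT _); apply/funext => w /=; rewrite [const_mx _ _
    _]mxE.
Qed.

Let mindic A : G A -> measurable_wrt G (\1_A : Omega -> R).
Proof.
move=> GA; apply/(measurable_wrtP _ sG); apply: measurable_indic.
by rewrite /measurable /= sigma_algebra_id.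
Qed.

Let N0xi_indic i A : G A -> \int[P]_w (N0 w i 0 * xi w * \1_A w) = 0.
Proof.
move=> GA; have mA := Gm GA.
have -> : (fun w => N0 w i 0 * xi w * \1_A w) = (fun w => N0 w i 0 * \1_A w *
    xi w).
  by apply/funext => w; rewrite mulrAC.
apply: (Rintegral_orthogonal sG Gm (incr_integrable xiP)).
- by apply: (measurable_wrtM GP); [exact: LN0.1|exact: mindic].
- have := integrable_indicr mA (N0xi_int i); congr (P.-integrable setT _).
  by apply/funext => w /=; rewrite mulrAC.
- exact: incr_mean xiP.
Qed.

(** The increment of N W is dN W0 + dN xi + N0 xi, and N0 xi has zero conditional mean. *)
Let product_split i A : G A ->
  \int[P]_w ((N1 w i 0 * (W0 w + xi w) - N0 w i 0 * W0 w) * \1_A w) =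
  \int[P]_w (dN w i 0 * W0 w * \1_A w) + \int[P]_w (dN w i 0 * xi w * \1_A w).
Proof.
move=> GA; have mA := Gm GA.
rewrite -[RHS]addr0 -(N0xi_indic i GA) -!RintegralD //; do ?exact:
    integrable_indicr.
  by apply: eq_Rintegral => w _; rewrite /dN !fctE !mxE; ring.
exact: (integrableD measurableT (integrable_indicr mA (dNW_int i))
  (integrable_indicr mA (dNxi_int i))).
Qed.

(** The last two hypotheses are the martingale properties of N and N W over one step. Since dN,
    hence dN W0, has zero conditional mean, [product_split] gives the same for dN xi. The two blocks
    of [V] are tested against dN and dN xi. *)
Lemma martingale_orthogonal_noise :
  (forall i, P.-integrable setT (EFin \o (fun w => dN w i 0))) ->
  (forall i A, G A -> \int[P]_w (dN w i 0 * \1_A w) = 0) ->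
  (forall i A, G A ->
    \int[P]_w ((N1 w i 0 * (W0 w + xi w) - N0 w i 0 * W0 w) * \1_A w) = 0) ->
  forall V, L2 P G V -> ip P dN (noise_sum xi V) = 0.
Proof.
move=> dNi orth1 orth2 V LV.
have LV1 := L2_usubmx GP LV; have LV2 := L2_dsubmx GP LV.
have i1 i : P.-integrable setT (EFin \o (fun w => usubmx (V w) i 0 * dN w i 0)).
  exact: (integrable_entry_mul i i (L2_L2m GP LV1) dN_m).
have i2 i : P.-integrable setT (EFin \o (fun w => dsubmx (V w) i 0 * (dN w i 0
    * xi w))).
  have := integrable_entry_mul i i dN_m (L2_L2m GP' (L2_noise GP GP' GG' xiP
      LV2)).
  congr (P.-integrable setT _); apply/funext => w /=; rewrite !mxE.
  by congr EFin; ring.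
have -> : ip P dN (noise_sum xi V) = \int[P]_w (\sum_i
    (usubmx (V w) i 0 * dN w i 0 + dsubmx (V w) i 0 * (dN w i 0 * xi w))).
  apply: eq_Rintegral => w _; apply: eq_bigr => i _.
  by rewrite /noise_sum !mxE; ring.
rewrite Rintegral_fin_sum; last first.
  by move=> i; exact: (integrableD measurableT (i1 i) (i2 i)).
rewrite big1 // => i _; rewrite RintegralD //.
have zero1 A : G A -> (\int[P]_(w in A) (dN w i 0)%:E = 0)%E.
  by move=> GA; rewrite Rintegral_indic ?orth1 //; exact: Gm.
rewrite (Rintegral_orthogonal sG Gm (dNi i) (LV1.1 i) (i1 i) zero1) add0r.
apply: (Rintegral_orthogonal sG Gm (dNxi_int i) (LV2.1 i) (i2 i)) => A GA.
have mA := Gm GA; rewrite Rintegral_indic //.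
have := product_split i GA; rewrite (orth2 _ _ GA).
have -> : \int[P]_w (dN w i 0 * W0 w * \1_A w) = 0.
  have -> : (fun w => dN w i 0 * W0 w * \1_A w) = (fun w => W0 w * \1_A w * dN
      w i 0).
    by apply/funext => w; ring.
  apply: (Rintegral_orthogonal sG Gm (dNi i) _ _ zero1).
    exact: (measurable_wrtM GP mW0 (mindic GA)).
  have := integrable_indicr mA (dNW_int i); congr (P.-integrable setT _).
  by apply/funext => w /=; congr EFin; ring.
by rewrite add0r => <-.
Qed.

(** The converse direction. The test pairs are (1_A e_i, 0), (W0 1_A e_i, 0) and (0, 1_A e_i), the
    second one admissible because W0 is square integrable. *)
Lemma orthogonal_noise_martingale :
  (forall V, L2 P G V -> ip P dN (noise_sum xi V) = 0) ->
  (forall i A, G A -> \int[P]_w (dN w i 0 * \1_A w) = 0) /\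
  (forall i A, G A ->
    \int[P]_w ((N1 w i 0 * (W0 w + xi w) - N0 w i 0 * W0 w) * \1_A w) = 0).
Proof.
move=> orth.
have dot_delta (u : 'cV[R]_n) i a : dot u (delta_mx i 0 *m (const_mx a :
    'cV[R]_1)) = u i 0 * a.
  rewrite /dot (bigD1 i) //= big1 ?addr0.
    by rewrite mxE big_ord1 !mxE !eqxx mul1r.
  by move=> j ji; rewrite mxE big_ord1 !mxE (negbTE ji) mul0r mulr0.
have L0 : L2 P G (fun _ => 0 : 'cV[R]_n) by exact: (L2_cst GP).
have orth_pad i a : L2 P G (fun w => const_mx (a w) : 'cV[R]_1) ->
    \int[P]_w (dN w i 0 * a w) = 0.
  move=> La; have La' := L2_mulmx GP (delta_mx i 0 : 'M[R]_(n, 1)) La.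
  have := orth _ (L2_col_mx GP La' L0); rewrite /ip => <-.
  apply: eq_Rintegral => w _; rewrite /noise_sum col_mxKu col_mxKd scaler0
      addr0.
  by rewrite dot_delta.
have orth_noise i a : L2 P G (fun w => const_mx (a w) : 'cV[R]_1) ->
    \int[P]_w (dN w i 0 * xi w * a w) = 0.
  move=> La; have La' := L2_mulmx GP (delta_mx i 0 : 'M[R]_(n, 1)) La.
  have := orth _ (L2_col_mx GP L0 La'); rewrite /ip => <-.
  apply: eq_Rintegral => w _; rewrite /noise_sum col_mxKu col_mxKd add0r.
  by rewrite dotZr dot_delta; ring.
have L1 A : G A -> L2 P G (fun w => const_mx (\1_A w) : 'cV[R]_1).
  move=> GA; have := L2_indic GA (L2_cst GP (const_mx 1 : 'cV[R]_1)).
  by congr (L2 P G _); apply/funext => w; apply/colP => i; rewrite !mxE mulr1.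
have LW1 A : G A -> L2 P G (fun w => const_mx (W0 w * \1_A w) : 'cV[R]_1).
  move=> GA; have := L2_indic GA LW0.
  by congr (L2 P G _); apply/funext => w; apply/colP => i; rewrite !mxE mulrC.
split=> i A GA; first exact/orth_pad/L1.
rewrite product_split // (orth_noise _ _ (L1 _ GA)) addr0.
rewrite -[RHS](orth_pad i _ (LW1 _ GA)); apply: eq_Rintegral => w _.
by rewrite mulrA.
Qed.

End orthogonal_increment.

(** * The coefficients and the equation *)

Lemma usubmxB (R : realType) (p q : nat) (u v : 'cV[R]_(p + q)) :
  usubmx (u - v) = usubmx u - usubmx v.
Proof. by apply/colP => i; rewrite !mxE. Qed.

Lemma dsubmxB (R : realType) (p q : nat) (u v : 'cV[R]_(p + q)) :
  dsubmx (u - v) = dsubmx u - dsubmx v.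
Proof. by apply/colP => i; rewrite !mxE. Qed.

Lemma sqr_enorm_le (R : realType) (p q : nat) (c : R) (u : 'cV[R]_p) (v :
    'cV[R]_q) :
  0 <= c -> enorm u <= c * enorm v -> dot u u <= c ^+ 2 * dot v v.
Proof.
move=> c0 uv; rewrite -!enorm_sqr -exprMn ler_sqr // ?nnegrE ?enorm_ge0 //.
by rewrite mulr_ge0 ?enorm_ge0.
Qed.

Lemma ae_and (d : measure_display) (Omega : measurableType d) (R : realType)
    (P : probability Omega R) (A B : Omega -> Prop) :
  {ae P, forall w, A w} -> {ae P, forall w, B w} -> {ae P, forall w, A w /\ B
      w}.
Proof. by apply: filterS2 => w. Qed.

Section coefficients.
Context (R : realType) (d : measure_display) (Omega : measurableType d)
  (P : probability Omega R) (T : nat) (W : nat -> Omega -> R).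
Hypothesis hT : (1 <= T)%N.
Hypothesis hW : driving_noise P T W.
Variables (m n : nat) (G : 'M[R]_(n, m)).
Variables
  (b sigma : nat -> Omega -> 'cV[R]_m -> 'cV[R]_n -> 'cV[R]_n -> 'cV[R]_m)
  (f : nat -> Omega -> 'cV[R]_m -> 'cV[R]_n -> 'cV[R]_n -> 'cV[R]_n)
  (h : Omega -> 'cV[R]_m -> 'cV[R]_n) (c beta1 beta2 : R).
Hypothesis hc : 0 < c.
Hypothesis hLip : {ae P, forall w,
    (forall t x y z x' y' z', (t < T)%N ->
      [/\ enorm (b t w x y z - b t w x' y' z')
            <= c * enorm (stack x y z - stack x' y' z'),
          enorm (sigma t w x y z - sigma t w x' y' z')
            <= c * enorm (stack x y z - stack x' y' z'),
          enorm (f t w x y z - f t w x' y' z')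
            <= c * enorm (stack x y z - stack x' y' z') &
          enorm (coefA G b sigma f t w x y z
                 - coefA G b sigma f t w x' y' z')
            <= c * enorm (stack x y z - stack x' y' z')]) /\
    (forall x x', enorm (h w x - h w x') <= c * enorm (x - x')) /\
    (forall x y z x' y' z',
      enorm (f T w x y z - f T w x' y' z')
        <= c * (enorm (x - x') + enorm (y - y')))}.
Local Notation H := (history P W).
Hypothesis hb2 : forall x y z, M2 P H 0 T.-1 (fun t w => b t w x y z).
Hypothesis hsigma2 : forall x y z, M2 P H 0 T.-1 (fun t w => sigma t w x y z).
Hypothesis hf2 : forall x y z, M2 P H 1 T (fun t w => f t w x y z).
Hypothesis hh2 : forall x, L2 P (H T) (fun w => h w x).
Hypothesis hbeta1 : 0 <= beta1.
Hypothesis hbeta2 : 0 <= beta2.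
Hypothesis hmon : forall t, (1 <= t <= T.-1)%N -> forall x y z x' y' z',
    {ae P, forall w,
      dot (coefA G b sigma f t w x y z - coefA G b sigma f t w x' y' z')
          (stack x y z - stack x' y' z')
      <= - beta1 * enorm (G *m (x - x')) ^+ 2
         - beta2 * enorm (G^T *m (y - y')) ^+ 2
         - beta2 * enorm (G^T *m (z - z')) ^+ 2}.
Hypothesis hmonT : forall x y z x' y' z',
    {ae P, forall w,
      dot (- (G^T *m f T w x y z) + G^T *m f T w x' y' z') (x - x')
      <= - beta1 * enorm (G *m (x - x')) ^+ 2}.
Hypothesis hmon0 : forall x y z x' y' z',
    {ae P, forall w,
      dot (G *m b 0%N w x y z - G *m b 0%N w x' y' z') (y - y')
      + dot (G *m sigma 0%N w x y z - G *m sigma 0%N w x' y' z') (z - z')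
      <= - beta2 * enorm (G^T *m (y - y')) ^+ 2
         - beta2 * enorm (G^T *m (z - z')) ^+ 2}.
Hypothesis hmonh : forall x x',
    {ae P, forall w, 0 <= dot (h w x - h w x') (G *m (x - x'))}.

Local Notation D := (diag2 G).
Local Notation ip := (ip P).
Local Notation sq U := (ip U U).
Local Notation lam := 'cV[R]_(m + (n + n)).

(** Gathering x, y, z into one argument and b, sigma into one value brings the coefficients into the
    form of the composition results. *)
Definition coef_bs t (w : Omega) (l : lam) : 'cV[R]_(m + m) :=
  col_mx (b t w (usubmx l) (usubmx (dsubmx l)) (dsubmx (dsubmx l)))
         (sigma t w (usubmx l) (usubmx (dsubmx l)) (dsubmx (dsubmx l))).

Definition coef_f t (w : Omega) (l : lam) : 'cV[R]_n :=
  f t w (usubmx l) (usubmx (dsubmx l)) (dsubmx (dsubmx l)).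

Definition join (X : Omega -> 'cV[R]_m) (U : Omega -> 'cV[R]_(n + n)) w : lam :=
  col_mx (X w) (U w).

Definition op_bs t X U w := coef_bs t w (join X U w).
Definition op_f t X U w := coef_f t w (join X U w).
Definition op_h (X : Omega -> 'cV[R]_m) w := h w (X w).

Let stackE (l : lam) :
  stack (usubmx l) (usubmx (dsubmx l)) (dsubmx (dsubmx l)) = l.
Proof. by rewrite /stack !vsubmxK. Qed.

Let c0 : 0 <= c := ltW hc.

Lemma coef_bs_lipschitz t : (t < T)%N ->
  {ae P, forall w, lipschitz_sq (2 * c ^+ 2) (coef_bs t w)}.
Proof.
move=> tT; apply: filterS hLip => w [Lw _] l l'.
have [Lb Ls _ _] := Lw t (usubmx l) (usubmx (dsubmx l)) (dsubmx (dsubmx l))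
  (usubmx l') (usubmx (dsubmx l')) (dsubmx (dsubmx l')) tT.
rewrite !stackE in Lb Ls.
have := sqr_enorm_le c0 Lb; have := sqr_enorm_le c0 Ls.
by rewrite /coef_bs opp_col_mx add_col_mx dot_col_mx; lra.
Qed.

(** The factor 2 comes from (|dx| + |dy|)^2 <= 2 (|dx|^2 + |dy|^2) at t = T; earlier times share the
    constant. *)
Lemma coef_f_lipschitz t : (t <= T)%N ->
  {ae P, forall w, lipschitz_sq (2 * c ^+ 2) (coef_f t w)}.
Proof.
move=> tT; apply: filterS hLip => w [Lw [_ LT]] l l'.
have [tT'|Tt] := ltnP t T.
  have [_ _ Lf _] := Lw t (usubmx l) (usubmx (dsubmx l)) (dsubmx (dsubmx l))
    (usubmx l') (usubmx (dsubmx l')) (dsubmx (dsubmx l')) tT'.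
  rewrite !stackE in Lf; have := sqr_enorm_le c0 Lf.
  have := mulr_ge0 (sqr_ge0 c) (dot_ge0 (l - l')); rewrite /coef_f; lra.
have -> : t = T by apply/eqP; rewrite eqn_leq tT.
have := LT (usubmx l) (usubmx (dsubmx l)) (dsubmx (dsubmx l))
  (usubmx l') (usubmx (dsubmx l')) (dsubmx (dsubmx l')).
set dx := _ - usubmx l'; set dy := _ - usubmx (dsubmx l') => le_f.
have dl : dot dx dx + dot dy dy <= dot (l - l') (l - l').
  rewrite -(vsubmxK (l - l')) dot_col_mx -(vsubmxK (dsubmx (l - l')))
      dot_col_mx.
  by rewrite !dsubmxB !usubmxB addrA lerDl dot_ge0.
have dxdy : (enorm dx + enorm dy) ^+ 2 <= 2 * (dot dx dx + dot dy dy).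
  rewrite -!enorm_sqr; have := sqr_ge0 (enorm dx - enorm dy); lra.
rewrite /coef_f -enorm_sqr.
apply: (@le_trans _ _ ((c * (enorm dx + enorm dy)) ^+ 2)).
  by rewrite ler_sqr // ?nnegrE ?enorm_ge0 // mulr_ge0 // addr_ge0 ?enorm_ge0.
have dxdy' : (enorm dx + enorm dy) ^+ 2 <= 2 * dot (l - l') (l - l').
  by apply: le_trans dxdy _; rewrite ler_pM2l.
by have := ler_wpM2l (sqr_ge0 c) dxdy'; lra.
Qed.

Lemma h_lipschitz : {ae P, forall w, lipschitz_sq (c ^+ 2) (h w)}.
Proof.
by apply: filterS hLip => w [_ [Lh _]] x x'; exact: sqr_enorm_le.
Qed.

(** The Lipschitz bound at time T has no term in z - z'. *)
Lemma f_terminal_z : {ae P, forall w, forall x y z z', f T w x y z = f T w x y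
    z'}.
Proof.
apply: filterS hLip => w [_ [_ LT]] x y z z'.
have := LT x y z x y z'; rewrite !subrr !enorm0 addr0 mulr0 => le0.
apply/eqP; rewrite -subr_eq0; apply/eqP/dot_eq0.
by rewrite -enorm_sqr; apply/eqP; rewrite sqrf_eq0 eq_le le0 enorm_ge0.
Qed.

Lemma L2_coef_bs t l : (t < T)%N -> L2 P (H t) (fun w => coef_bs t w l).
Proof.
move=> tT; have tT1 : (0 <= t <= T.-1)%N by rewrite leq0n /= -ltnS prednK.
have HP := history_complete hW (ltnW tT).
by apply: (L2_col_mx HP); [exact: hb2|exact: hsigma2].
Qed.

Lemma L2_coef_f t l : (1 <= t <= T)%N -> L2 P (H t) (fun w => coef_f t w l).
Proof. by move=> tT; exact: hf2. Qed.

Lemma join_sq t X X' U U' : (t <= T)%N -> L2 P (H t) X -> L2 P (H t) X' ->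
  L2 P (H t) U -> L2 P (H t) U' ->
  sq (join X U - join X' U') = sq (X - X') + sq (U - U').
Proof.
move=> tT LX LX' LU LU'; have HP := history_complete hW tT.
have LdX := L2_L2m HP (L2B HP LX LX'); have LdU := L2_L2m HP (L2B HP LU LU').
rewrite -RintegralD //; do ?exact: integrable_sq.
by apply: eq_Rintegral => w _; rewrite !fctE /join opp_col_mx add_col_mx
    dot_col_mx.
Qed.

Lemma L2_join t X U : (t <= T)%N -> L2 P (H t) X -> L2 P (H t) U ->
  L2 P (H t) (join X U).
Proof. by move=> tT LX LU; exact: (L2_col_mx (history_complete hW tT) LX LU).
Qed.

Lemma L2_op_bs t X U : (t < T)%N -> L2 P (H t) X -> L2 P (H t) U ->
  L2 P (H t) (op_bs t X U).
Proof.
move=> tT LX LU; apply: (L2_nemytskii (history_complete hW (ltnW tT))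
  (coef_bs_lipschitz tT)) (L2_join (ltnW tT) LX LU) => l.
exact: L2_coef_bs.
Qed.

Lemma op_bs_lip t X X' U U' : (t < T)%N -> L2 P (H t) X -> L2 P (H t) X' ->
  L2 P (H t) U -> L2 P (H t) U' ->
  sq (op_bs t X U - op_bs t X' U') <= 2 * c ^+ 2 * (sq (X - X') + sq (U - U')).
Proof.
move=> tT LX LX' LU LU'; rewrite -(join_sq (ltnW tT) LX LX' LU LU').
exact: (ip_nemytskii (history_complete hW (ltnW tT)) (coef_bs_lipschitz tT)
  (fun l => L2_coef_bs l tT) (L2_join (ltnW tT) LX LU) (L2_join (ltnW tT) LX'
      LU')).
Qed.

Lemma L2_op_f t X U : (1 <= t <= T)%N -> L2 P (H t) X -> L2 P (H t) U ->
  L2 P (H t) (op_f t X U).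
Proof.
move=> tT LX LU; have /andP[_ tT'] := tT.
exact: (L2_nemytskii (history_complete hW tT') (coef_f_lipschitz tT')
  (fun l => L2_coef_f l tT) (L2_join tT' LX LU)).
Qed.

Lemma op_f_lip t X X' U U' : (1 <= t <= T)%N -> L2 P (H t) X -> L2 P (H t) X' ->
  L2 P (H t) U -> L2 P (H t) U' ->
  sq (op_f t X U - op_f t X' U') <= 2 * c ^+ 2 * (sq (X - X') + sq (U - U')).
Proof.
move=> tT LX LX' LU LU'; have /andP[_ tT'] := tT.
rewrite -(join_sq tT' LX LX' LU LU').
exact: (ip_nemytskii (history_complete hW tT') (coef_f_lipschitz tT')
  (fun l => L2_coef_f l tT) (L2_join tT' LX LU) (L2_join tT' LX' LU')).
Qed.

Lemma L2_op_h X : L2 P (H T) X -> L2 P (H T) (op_h X).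
Proof. exact: (L2_nemytskii (history_complete hW (leqnn T)) h_lipschitz hh2).
Qed.

Lemma op_h_lip X X' : L2 P (H T) X -> L2 P (H T) X' ->
  sq (op_h X - op_h X') <= c ^+ 2 * sq (X - X').
Proof. exact: (ip_nemytskii (history_complete hW (leqnn T)) h_lipschitz hh2).
Qed.

Lemma coefA_dot t w x y z x' y' z' :
  dot (coefA G b sigma f t w x y z - coefA G b sigma f t w x' y' z')
      (stack x y z - stack x' y' z') =
  - dot (f t w x y z - f t w x' y' z') (G *m (x - x')) +
  (dot (b t w x y z - b t w x' y' z') (G^T *m (y - y')) +
   dot (sigma t w x y z - sigma t w x' y' z') (G^T *m (z - z'))).
Proof.
have fE u v : - (G^T *m u) - - (G^T *m v) = - (G^T *m (u - v)).
  by rewrite mulmxBr opprB opprK addrC.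
rewrite /coefA /stack !opp_col_mx !add_col_mx !dot_col_mx fE dotNl.
by rewrite -!mulmxBr !dot_adjl trmxK.
Qed.

Let D_T (u : 'cV[R]_(n + n)) :
  D^T *m u = col_mx (G^T *m usubmx u) (G^T *m dsubmx u).
Proof. by rewrite tr_diag2 -{1}(vsubmxK u) mul_diag2. Qed.

Let quad (l : lam) := - beta1 * dot (G *m usubmx l) (G *m usubmx l)
  - beta2 * dot (D^T *m dsubmx l) (D^T *m dsubmx l).

(** The coefficients are free because the initial and terminal inequalities use this form with one
    of them equal to 0. *)
Lemma cvg_col_quad (b1 b2 : R) (u : nat -> lam) l : cvg_col u l ->
  (fun i => b1 * dot (G *m usubmx (u i)) (G *m usubmx (u i))
    - b2 * dot (D^T *m dsubmx (u i)) (D^T *m dsubmx (u i))) @ \oo -->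
  b1 * dot (G *m usubmx l) (G *m usubmx l)
    - b2 * dot (D^T *m dsubmx l) (D^T *m dsubmx l).
Proof.
move=> ul; have ul1 := cvg_col_mulmx (A := G) (cvg_col_usubmx ul).
have ul2 := cvg_col_mulmx (A := D^T) (cvg_col_dsubmx ul).
by apply: cvgB; apply: cvgM; do ?exact: cvg_cst; exact: cvg_col_dot.
Qed.

(** (b, sigma) and f are stacked into one Lipschitz function, paired with the linear map (D^T, -G),
    so that a single use of [ae_monotone] makes the null set independent of the arguments. *)
Lemma coef_interior_mono t : (1 <= t <= T.-1)%N -> {ae P, forall w, forall l l',
  dot (coef_bs t w l - coef_bs t w l') (D^T *m dsubmx (l - l'))
  - dot (coef_f t w l - coef_f t w l') (G *m usubmx (l - l')) <= quad (l - l')}.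
Proof.
move=> t1T; have tT : (t < T)%N by case/andP: t1T => _; rewrite -ltnS prednK.
have lip : {ae P, forall w,
    lipschitz_sq (4 * c ^+ 2) (fun l => col_mx (coef_bs t w l) (coef_f t w l))}.
  have := coef_f_lipschitz (ltnW tT); apply: filterS2 (coef_bs_lipschitz tT).
  move=> w Lbs Lf l l'; rewrite opp_col_mx add_col_mx dot_col_mx.
  have := Lbs l l'; have := Lf l l'; lra.
have mono l l' : {ae P, forall w,
    dot (col_mx (coef_bs t w l) (coef_f t w l) - col_mx (coef_bs t w l')
        (coef_f t w l'))
      (col_mx (D^T *m dsubmx (l - l')) (- G *m usubmx (l - l'))) <= quad (l -
        l')}.
  apply: filterS (hmon t1T (usubmx l) (usubmx (dsubmx l)) (dsubmx (dsubmx l))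
    (usubmx l') (usubmx (dsubmx l')) (dsubmx (dsubmx l'))) => w.
  rewrite coefA_dot !enorm_sqr opp_col_mx add_col_mx dot_col_mx mulNmx dotNr
      /quad.
  rewrite D_T !dsubmxB !usubmxB /coef_bs opp_col_mx add_col_mx !dot_col_mx
      /coef_f.
  lra.
have k1 (u : nat -> lam) l : cvg_col u l ->
    cvg_col (fun i => col_mx (D^T *m dsubmx (u i)) (- G *m usubmx (u i)))
      (col_mx (D^T *m dsubmx l) (- G *m usubmx l)).
  move=> ul; exact: (cvg_col_mx (cvg_col_mulmx (A := D^T) (cvg_col_dsubmx ul))
    (cvg_col_mulmx (A := - G) (cvg_col_usubmx ul))).
apply: filterS (ae_monotone (Q := quad)
  (kappa := fun l => col_mx (D^T *m dsubmx l) (- G *m usubmx l))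
  lip k1 (@cvg_col_quad _ _) mono) => w H l l'.
by have := H l l'; rewrite opp_col_mx add_col_mx dot_col_mx mulNmx dotNr.
Qed.

Lemma coef_initial_mono : {ae P, forall w, forall l l',
  dot (coef_bs 0 w l - coef_bs 0 w l') (D^T *m dsubmx (l - l'))
  <= - beta2 * dot (D^T *m dsubmx (l - l')) (D^T *m dsubmx (l - l'))}.
Proof.
have mono l l' : {ae P, forall w,
    dot (coef_bs 0 w l - coef_bs 0 w l') (D^T *m dsubmx (l - l')) <=
    0 * dot (G *m usubmx (l - l')) (G *m usubmx (l - l'))
    - beta2 * dot (D^T *m dsubmx (l - l')) (D^T *m dsubmx (l - l'))}.
  apply: filterS (hmon0 (usubmx l) (usubmx (dsubmx l)) (dsubmx (dsubmx l))
    (usubmx l') (usubmx (dsubmx l')) (dsubmx (dsubmx l'))) => w hyp.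
  rewrite -!mulmxBr !dot_adjl !enorm_sqr in hyp; rewrite mul0r.
  rewrite D_T !dsubmxB !usubmxB /coef_bs opp_col_mx add_col_mx !dot_col_mx.
  lra.
apply: filterS (ae_monotone
  (Q := fun l => 0 * dot (G *m usubmx l) (G *m usubmx l)
    - beta2 * dot (D^T *m dsubmx l) (D^T *m dsubmx l))
  (kappa := fun l => D^T *m dsubmx l) (coef_bs_lipschitz hT)
  (fun u l ul => cvg_col_mulmx (A := D^T) (cvg_col_dsubmx ul))
  (@cvg_col_quad _ _) mono) => w H l l'.
by have := H l l'; rewrite mul0r sub0r mulNr.
Qed.

(** For equal states the terms in f and beta1 vanish, which puts t = 0 and the interior times on the
    same footing. *)
Lemma coef_bs_mono t : (t < T)%N -> {ae P, forall w, forall l l',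
  usubmx l = usubmx l' ->
  dot (coef_bs t w l - coef_bs t w l') (D^T *m dsubmx (l - l'))
  <= - beta2 * dot (D^T *m dsubmx (l - l')) (D^T *m dsubmx (l - l'))}.
Proof.
case: t => [|t] tT; first by apply: filterS coef_initial_mono => w H l l' _;
    exact: H.
have t1T : (1 <= t.+1 <= T.-1)%N by rewrite /= -ltnS prednK.
apply: filterS (coef_interior_mono t1T) => w H l l' ll'; have := H l l'.
rewrite /quad; have -> : usubmx (l - l') = 0 by rewrite usubmxB ll' subrr.
by rewrite mulmx0 !dot0r mulr0 subr0 sub0r mulNr.
Qed.

Lemma coef_terminal_mono : {ae P, forall w, forall l l',
  beta1 * dot (G *m usubmx (l - l')) (G *m usubmx (l - l')) <=
  dot (coef_f T w l - coef_f T w l') (G *m usubmx (l - l'))}.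
Proof.
have mono l l' : {ae P, forall w,
    dot (coef_f T w l - coef_f T w l') (- G *m usubmx (l - l')) <=
    - beta1 * dot (G *m usubmx (l - l')) (G *m usubmx (l - l'))
    - 0 * dot (D^T *m dsubmx (l - l')) (D^T *m dsubmx (l - l'))}.
  apply: filterS (hmonT (usubmx l) (usubmx (dsubmx l)) (dsubmx (dsubmx l))
    (usubmx l') (usubmx (dsubmx l')) (dsubmx (dsubmx l'))) => w hyp.
  rewrite addrC -mulmxBr dot_adjl trmxK enorm_sqr -opprB dotNl in hyp.
  by rewrite usubmxB mulNmx dotNr mul0r subr0.
apply: filterS (ae_monotone
  (Q := fun l => - beta1 * dot (G *m usubmx l) (G *m usubmx l)
    - 0 * dot (D^T *m dsubmx l) (D^T *m dsubmx l))
  (kappa := fun l => - G *m usubmx l) (coef_f_lipschitz (leqnn T))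
  (fun u l ul => cvg_col_mulmx (A := - G) (cvg_col_usubmx ul))
  (@cvg_col_quad _ _) mono) => w H l l'.
by have := H l l'; rewrite mul0r subr0 mulNmx dotNr; lra.
Qed.

Lemma h_mono : {ae P, forall w, forall x x', 0 <= dot (h w x - h w x') (G *m (x
    - x'))}.
Proof.
have mono x x' : {ae P, forall w, dot (h w x - h w x') (- G *m (x - x')) <= 0}.
  by apply: filterS (hmonh x x') => w; rewrite mulNmx dotNr; lra.
apply: filterS (ae_monotone (Q := fun _ => 0) (kappa := fun x => - G *m x)
  h_lipschitz (fun u l ul => cvg_col_mulmx (A := - G) ul)
  (fun u l _ => cvg_cst 0) mono) => w H x x'.
by have := H x x'; rewrite mulNmx dotNr; lra.
Qed.

Lemma op_bs_mono t X U U' : (t < T)%N -> L2 P (H t) X -> L2 P (H t) U ->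
  L2 P (H t) U' ->
  ip (op_bs t X U - op_bs t X U') (mxapp D^T (U - U')) <=
  - beta2 * sq (mxapp D^T (U - U')).
Proof.
move=> tT LX LU LU'; have HP := history_complete hW (ltnW tT).
have LdB := L2B HP (L2_op_bs tT LX LU) (L2_op_bs tT LX LU').
have LD := L2_mulmx HP D^T (L2B HP LU LU').
rewrite /ip -RintegralZl //; last exact: (integrable_sq (L2_L2m HP LD)).
apply: ae_le_Rintegral.
- exact: (integrable_dot (L2_L2m HP LdB) (L2_L2m HP LD)).
- exact: (integrableZl measurableT (- beta2) (integrable_sq (L2_L2m HP LD))).
- apply: filterS (coef_bs_mono tT) => w.
  move=> /(_ (join X U w) (join X U' w)); rewrite /join !col_mxKu dsubmxB
      !col_mxKd.
  by apply.
Qed.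

Lemma op_mono t X X' U U' : (1 <= t < T)%N -> L2 P (H t) X -> L2 P (H t) X' ->
  L2 P (H t) U -> L2 P (H t) U' ->
  ip (op_bs t X U - op_bs t X' U') (mxapp D^T (U - U'))
  - ip (op_f t X U - op_f t X' U') (mxapp G (X - X')) <= - beta1 * sq (mxapp G
      (X - X')).
Proof.
move=> /andP[t1 tT] LX LX' LU LU'; have HP := history_complete hW (ltnW tT).
have t1T : (1 <= t <= T.-1)%N by rewrite t1 -ltnS prednK.
have t1T' : (1 <= t <= T)%N by rewrite t1 ltnW.
have LdB := L2_L2m HP (L2B HP (L2_op_bs tT LX LU) (L2_op_bs tT LX' LU')).
have LdF := L2_L2m HP (L2B HP (L2_op_f t1T' LX LU) (L2_op_f t1T' LX' LU')).
have LD := L2_L2m HP (L2_mulmx HP D^T (L2B HP LU LU')).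
have LG := L2_L2m HP (L2_mulmx HP G (L2B HP LX LX')).
have iB := integrable_dot LdB LD; have iF := integrable_dot LdF LG.
rewrite /ip -RintegralZl //; last exact: (integrable_sq LG).
rewrite -RintegralB //; apply: ae_le_Rintegral.
- exact: (integrableB measurableT iB iF).
- exact: (integrableZl measurableT (- beta1) (integrable_sq LG)).
- apply: filterS (coef_interior_mono t1T) => w.
  move=> /(_ (join X U w) (join X' U' w)); rewrite /quad /join.
  rewrite usubmxB dsubmxB !col_mxKu !col_mxKd.
  move=> /le_trans; apply.
  by have := mulr_ge0 hbeta2 (dot_ge0 (D^T *m (U w - U' w))); rewrite /mxapp;
      lra.
Qed.

(** This is Y_T + f(T, X_T, Y_T, Z_T) for Y_T = h(X_T); taking Z_T = 0 is legitimate by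
    [f_terminal_z]. *)
Definition terminal_map (X : Omega -> 'cV[R]_m) : Omega -> 'cV[R]_n :=
  op_h X + op_f T X (pad (op_h X)).

Let hTT : (1 <= T <= T)%N. Proof. by rewrite hT leqnn. Qed.
Let HPT := history_complete hW (leqnn T).

Let L2ph X : L2 P (H T) X -> L2 P (H T) (pad (op_h X)).
Proof. by move=> LX; apply: (L2_pad HPT); exact: L2_op_h. Qed.

Lemma L2_terminal_map X : L2 P (H T) X -> L2 P (H T) (terminal_map X).
Proof.
by move=> LX; exact: (L2D HPT (L2_op_h LX) (L2_op_f hTT LX (L2ph LX))).
Qed.

Lemma terminal_map_lip : exists L, forall X X', L2 P (H T) X -> L2 P (H T) X' ->
  sq (terminal_map X - terminal_map X') <= L * sq (X - X').
Proof.
exists (2 * (c ^+ 2 + 2 * c ^+ 2 * (1 + c ^+ 2))) => X X' LX LX'.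
have Lh := L2B HPT (L2_op_h LX) (L2_op_h LX').
have Lf := L2B HPT (L2_op_f hTT LX (L2ph LX)) (L2_op_f hTT LX' (L2ph LX')).
have le1 := op_h_lip LX LX'.
have le2 := op_f_lip hTT LX LX' (L2ph LX) (L2ph LX').
have padE : sq (pad (op_h X) - pad (op_h X')) = sq (op_h X - op_h X').
  apply: eq_Rintegral => w _.
  by rewrite !fctE /pad opp_col_mx add_col_mx dot_col_mx subrr dot0l addr0.
rewrite padE in le2.
rewrite /terminal_map opprD addrACA.
apply: le_trans (sqD_le (L2_semi_hilbert HPT n) Lh Lf) _.
rewrite -mulrA ler_pM2l // mulrDl; apply: lerD => //.
have := ler_wpM2l (sqr_ge0 c) le1; move: le2.
by move: (sq _) (sq (op_h X - _)) (sq (X - X')) => u v x; lra.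
Qed.

(** The lower bound on f(T, .) allows y to change together with x, so y = h(x) may be inserted;
    monotonicity of h adds a nonnegative term. *)
Lemma terminal_map_mono X X' : L2 P (H T) X -> L2 P (H T) X' ->
  beta1 * sq (mxapp G (X - X')) <=
  ip (terminal_map X - terminal_map X') (mxapp G (X - X')).
Proof.
move=> LX LX'.
have Lt := L2_L2m HPT (L2B HPT (L2_terminal_map LX) (L2_terminal_map LX')).
have LG := L2_L2m HPT (L2_mulmx HPT G (L2B HPT LX LX')).
rewrite /ip -RintegralZl //; last exact: (integrable_sq LG).
apply: ae_le_Rintegral.
- exact: (integrableZl measurableT beta1 (integrable_sq LG)).
- exact: (integrable_dot Lt LG).
- apply: filterS2 h_mono coef_terminal_mono => w Hh Hf.
  have := Hh (X w) (X' w).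
  have := Hf (join X (pad (op_h X)) w) (join X' (pad (op_h X')) w).
  rewrite usubmxB !col_mxKu => le1 le2; apply: le_trans le1 _.
  have -> : (terminal_map X - terminal_map X') w = (h w (X w) - h w (X' w)) +
      (coef_f T w (join X (pad (op_h X)) w) - coef_f T w (join X' (pad (op_h
        X')) w)).
    by rewrite /terminal_map !fctE opprD addrACA.
  by rewrite [leRHS]dotDl lerDr.
Qed.

Hypothesis hG : \rank G = minn n m.
Hypothesis hbeta : 0 < beta1 + beta2.
Hypothesis hbeta_nm : (m < n)%N -> 0 < beta1.
Hypothesis hbeta_mn : (n < m)%N -> 0 < beta2.

Lemma coercive_case :
  0 < beta1 /\ bounded_below G \/ 0 < beta2 /\ bounded_below G^T.
Proof.
have left_case : (m <= n)%N -> bounded_below G.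
  by move=> mn; apply: dot_le_mulmx_inj; rewrite hG (minn_idPr mn).
have right_case : (n <= m)%N -> bounded_below G^T.
  by move=> nm; apply: dot_le_mulmx_inj; rewrite mxrank_tr hG (minn_idPl nm).
have [mn|nm|mn] := ltngtP m n.
- by left; split; [exact: hbeta_nm|apply: left_case; exact: ltnW].
- by right; split; [exact: hbeta_mn|apply: right_case; exact: ltnW].
(* In the square case G and its transpose are both injective, and whichever constant is positive
   decides. *)
- have [b1|b1] := ltP 0 beta1; first by left; split=> //; apply: left_case;
    rewrite mn.
  by right; split; [have := hbeta; lra|apply: right_case; rewrite mn].
Qed.

(** * Backward induction over the times *)

Local Notation rvm := (Omega -> 'cV[R]_m).
Local Notation rvn := (Omega -> 'cV[R]_n).
Local Notation rvnn := (Omega -> 'cV[R]_(n + n)).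

(** The invariant of the induction. The Lipschitz constant is existential because it may grow at
    each step, while beta1 stays fixed. *)
Definition admissible t (Phi : rvm -> rvn) : Prop :=
  [/\ forall X, L2 P (H t) X -> L2 P (H t) (Phi X),
      exists L, forall X X', L2 P (H t) X -> L2 P (H t) X' ->
        sq (Phi X - Phi X') <= L * sq (X - X') &
      forall X X', L2 P (H t) X -> L2 P (H t) X' ->
        beta1 * sq (mxapp G (X - X')) <= ip (Phi X - Phi X') (mxapp G (X -
        X'))].

Definition noise_adjoint t (Pi : rvn -> rvnn) : Prop :=
  forall eta, L2 P (H t.+1) eta -> L2 P (H t) (Pi eta) /\
    forall V, L2 P (H t) V -> ip (Pi eta) V = ip eta (noise_sum (delta W t) V).

Local Notation solves t Pi Phi X U :=
  (step_solution P (H t) (delta W t) Pi (op_bs t) Phi X U).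

Section step.
Variables (t : nat) (tT : (t < T)%N) (Pi : rvn -> rvnn) (Phi : rvm -> rvn).
Hypothesis PiP : noise_adjoint t Pi.
Hypothesis PhiP : admissible t.+1 Phi.
Let GP := history_complete hW (ltnW tT).
Let GP' := history_complete hW tT.
Let GG' := @history_mono R d Omega P W t t.+1 (leqnSn t).
Let xiP := noise_increment hW tT.

Lemma backward_step_exists X : L2 P (H t) X -> exists U, solves t Pi Phi X U.
Proof.
case: PhiP => L2Phi [L Phi_lip] Phi_mono LX.
exact: (step_exists GP GP' GG' xiP PiP hbeta1 hbeta2
  (fun X U LX LU => L2_op_bs tT LX LU)
  (fun X X' U U' LX LX' LU LU' => op_bs_lip tT LX LX' LU LU')
  (fun X U U' LX LU LU' => op_bs_mono tT LX LU LU') L2Phi Phi_lip Phi_mono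
      coercive_case LX).
Qed.

Lemma backward_step_unique X X' U U' : L2 P (H t) X -> L2 P (H t) X' ->
  sq (X - X') = 0 -> solves t Pi Phi X U -> solves t Pi Phi X' U' -> sq (U -
      U') = 0.
Proof.
case: PhiP => L2Phi [L Phi_lip] Phi_mono LX LX' XX'.
exact: (step_unique GP GP' GG' xiP PiP hbeta1 hbeta2
  (fun X U LX LU => L2_op_bs tT LX LU)
  (fun X X' U U' LX LX' LU LU' => op_bs_lip tT LX LX' LU LU')
  (fun X U U' LX LU LU' => op_bs_mono tT LX LU LU')
  L2Phi Phi_lip Phi_mono coercive_case LX LX' XX').
Qed.

(** The restriction to t >= 1 matches the assumptions: at time 0 monotonicity concerns (b, sigma)
    only, and no earlier step asks for a field there. *)
Lemma backward_step_admissible (sol : rvm -> rvnn) : (1 <= t)%N ->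
  (forall X, L2 P (H t) X -> solves t Pi Phi X (sol X)) ->
  admissible t (fun X => first_block (sol X) + op_f t X (sol X)).
Proof.
move=> t1 solP; have t1T : (1 <= t <= T)%N by rewrite t1 ltnW.
have t1T' : (1 <= t < T)%N by rewrite t1.
case: PhiP => L2Phi [L Phi_lip] Phi_mono; split.
- move=> X LX; have [LU _] := solP _ LX.
  exact: (L2D GP (L2_usubmx GP LU) (L2_op_f t1T LX LU)).
- exact: (step_output_lip GP GP' GG' xiP PiP hbeta1 hbeta2
    (fun X U LX LU => L2_op_bs tT LX LU)
    (fun X X' U U' LX LX' LU LU' => op_bs_lip tT LX LX' LU LU')
    (fun X U U' LX LU LU' => op_bs_mono tT LX LU LU')
    L2Phi Phi_lip Phi_mono coercive_case
    (fun X U LX LU => L2_op_f t1T LX LU)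
    (fun X X' U U' LX LX' LU LU' => op_f_lip t1T LX LX' LU LU') solP).
- move=> X X' LX LX'.
  exact: (step_output_mono GP GP' GG' xiP PiP hbeta1
    (fun X U LX LU => L2_op_bs tT LX LU)
    L2Phi Phi_mono
    (fun X U LX LU => L2_op_f t1T LX LU)
    (fun X X' U U' LX LX' LU LU' => op_mono t1T' LX LX' LU LU') solP LX LX').
Qed.

End step.

Lemma terminal_admissible : admissible T terminal_map.
Proof.
by split; [exact: L2_terminal_map|exact: terminal_map_lip|exact:
    terminal_map_mono].
Qed.

(* [sol t] is the field X_t |-> (Y_t, Z_t), and [Phi t] is the field
   X_t |-> Y_t + f(t, X_t, Y_t, Z_t). *)
Record decoupling (Pi : nat -> rvn -> rvnn) (Phi : nat -> rvm -> rvn)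
    (sol : nat -> rvm -> rvnn) : Prop := Decoupling {
  dec_adjoint : forall t, (t < T)%N -> noise_adjoint t (Pi t);
  dec_admissible : forall t, (1 <= t <= T)%N -> admissible t (Phi t);
  dec_solves : forall t, (t < T)%N -> forall X, L2 P (H t) X ->
    solves t (Pi t) (Phi t.+1) X (sol t X);
  dec_terminal : Phi T = terminal_map;
  dec_step : forall t, (1 <= t < T)%N -> forall X,
    Phi t X = first_block (sol t X) + op_f t X (sol t X)
}.

(** The solution of a step is chosen once as a function [S] of the pair (t, Phi). The backward
    recursion is then a plain fixpoint in the remaining time, and admissibility is proved afterwards
    by induction. *)
Lemma decoupling_exists : exists Pi Phi sol, decoupling Pi Phi sol.
Proof.
have /choice[Pi PiP] : forall t, exists Pi, (t < T)%N -> noise_adjoint t Pi.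
  move=> t; have [tT|] := ltnP t T; last by exists (fun _ => 0).
  have [Pi PiP] := noise_proj_exists (history_complete hW (ltnW tT))
    (history_complete hW tT) (@history_mono R d Omega P W t t.+1 (leqnSn t))
        (noise_increment hW tT) n.
  by exists Pi => _.
have /choice[S SP] : forall p : nat * (rvm -> rvn), exists sol : rvm -> rvnn,
    (p.1 < T)%N -> admissible p.1.+1 p.2 ->
    forall X, L2 P (H p.1) X -> solves p.1 (Pi p.1) p.2 X (sol X).
  move=> [t Phi] /=; have [tT|] := ltnP t T; last by exists (fun _ => 0).
  have [PhiP|] := pselect (admissible t.+1 Phi); last by exists (fun _ => 0).
  have /choice[sol solP] : forall X, exists U, L2 P (H t) X -> solves t (Pi t)
      Phi X U.
    move=> X; have [LX|] := pselect (L2 P (H t) X); last by exists 0.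
    by have [U] := backward_step_exists tT (PiP _ tT) PhiP LX; exists U.
  by exists sol => _ _.
pose next t Phi X := first_block (S (t, Phi) X) + op_f t X (S (t, Phi) X).
(* [PhiR k] is the field at time T - k. *)
pose PhiR := fix PhiR k := if k is k'.+1 then next (T - k'.+1)%N (PhiR k') else
    terminal_map.
pose Phi t := PhiR (T - t)%N.
have stepE t : (t < T)%N -> Phi t = next t (Phi t.+1).
  move=> tT; have E : (T - (T - t.+1).+1 = t)%N by rewrite subnSK // subKn //
      ltnW.
  by rewrite /Phi -{1}(subnSK tT) /= E.
have adm k : (k < T)%N -> admissible (T - k) (PhiR k).
  elim: k => [|k IH] kT /=; first by rewrite subn0; exact: terminal_admissible.
  have tT : (T - k.+1 < T)%N by rewrite ltn_subrL /= (leq_trans _ kT).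
  have E : (T - k = (T - k.+1).+1)%N by rewrite subnSK // ltnW.
  have admk := IH (ltnW kT); rewrite E in admk.
  apply: (backward_step_admissible tT (PiP _ tT) admk); first by rewrite
      subn_gt0.
  exact: (SP (T - k.+1, PhiR k)%N tT admk).
have admPhi t : (1 <= t <= T)%N -> admissible t (Phi t).
  move=> /andP[t1 tT]; have := adm (T - t)%N; rewrite subKn //; apply.
  by rewrite ltn_subrL t1 hT.
exists Pi, Phi, (fun t => S (t, Phi t.+1)); split=> //.
- by move=> t tT; apply: (SP (t, Phi t.+1) tT); apply: admPhi.
- by rewrite /Phi subnn.
- by move=> t /andP[_ tT] X; rewrite stepE.
Qed.

(** * Existence: running the state forwards through the decoupling field *)

Section solution.
Variables (Pi : nat -> rvn -> rvnn) (Phi : nat -> rvm -> rvn) (sol : nat -> rvm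
    -> rvnn).
Hypothesis dec : decoupling Pi Phi sol.
Variable x0 : 'cV[R]_m.

Fixpoint state t : rvm :=
  if t is t'.+1 then next_state (delta W t') (op_bs t') (state t') (sol t'
      (state t'))
  else fun _ => x0.

Let control t := sol t (state t).
Let noise t := noise_sum (delta W t) (control t).
Let value t := Phi t (state t).

(** The process N. Its increment is Y_{t+1} + f(t+1, ...) minus Y_t + Z_t dW_t, as the backward
    equation dictates. *)
Fixpoint residual t : rvn :=
  if t is t'.+1 then residual t' + (value t'.+1 - noise t') else 0.

(** [sol] is specified only before T, hence the separate terminal value. *)
Definition solution_Y t : rvn :=
  if (t < T)%N then first_block (control t) else op_h (state t).

Definition solution_Z t : rvn := fun w => dsubmx (control t w).

Let HPle t (tT : (t <= T)%N) := history_complete hW tT.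

Lemma L2_state t : (t <= T)%N -> L2 P (H t) (state t).
Proof.
elim: t => [|t IH] tT; first exact: (L2_cst (HPle tT)).
have LX := IH (ltnW tT); have [LU _] := dec_solves dec tT LX.
exact: (L2_next_state (HPle (ltnW tT)) (HPle tT) (@history_mono _ _ _ _ _ t
    t.+1 (leqnSn t))
  (noise_increment hW tT) (fun X U LX LU => L2_op_bs tT LX LU) LX LU).
Qed.

Let L2_control t : (t < T)%N -> L2 P (H t) (control t).
Proof. by move=> tT; have [] := dec_solves dec tT (L2_state (ltnW tT)). Qed.

Let L2_noise_control t : (t < T)%N -> L2 P (H t.+1) (noise t).
Proof.
move=> tT; exact: (L2_noise_sum (HPle (ltnW tT)) (HPle tT)
  (@history_mono _ _ _ _ _ t t.+1 (leqnSn t)) (noise_increment hW tT)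
      (L2_control tT)).
Qed.

Let L2_value t : (1 <= t <= T)%N -> L2 P (H t) (value t).
Proof.
move=> tT; have [LPhi _ _] := dec_admissible dec tT.
by apply: LPhi; apply: L2_state; case/andP: tT.
Qed.

Let L2_residual t : (t <= T)%N -> L2 P (H t) (residual t).
Proof.
elim: t => [|t IH] tT; first exact: (L2_cst (HPle tT)).
have LN := L2S (@history_mono _ _ _ P W t t.+1 (leqnSn t)) (IH (ltnW tT)).
exact: (L2D (HPle tT) LN (L2B (HPle tT) (@L2_value t.+1 tT) (L2_noise_control
    tT))).
Qed.

(** The control is Pi applied to the next value, up to a null vector. As Pi is the adjoint of the
    isometry S, the value minus S of the control is orthogonal to the range of S. *)
Let residual_orthogonal t : (t < T)%N -> forall V, L2 P (H t) V ->
  ip (residual t.+1 - residual t) (noise_sum (delta W t) V) = 0.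
Proof.
move=> tT V LV; have [LU solU] := dec_solves dec tT (L2_state (ltnW tT)).
have Lv : L2 P (H t.+1) (value t.+1) by exact: (@L2_value t.+1 tT).
have [LPi PiE] := dec_adjoint dec tT Lv.
have HH := L2_semi_hilbert (HPle (ltnW tT)) (n + n).
have HH' := L2_semi_hilbert (HPle tT) n.
have LS := L2_noise_sum (HPle (ltnW tT)) (HPle tT)
  (@history_mono _ _ _ _ _ t t.+1 (leqnSn t)) (noise_increment hW tT) LV.
rewrite [residual t.+1]/= addrAC subrr add0r.
rewrite (ipBl HH' Lv (L2_noise_control tT) LS) -(PiE _ LV).
rewrite (ip_noise_sum (HPle (ltnW tT)) (HPle tT)
  (@history_mono _ _ _ _ _ t t.+1 (leqnSn t)) (noise_increment hW tT)
      (L2_control tT) LV).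
rewrite -(ipBl HH LPi (L2_control tT) LV).
apply: (ip_null HH (domB HH LPi (L2_control tT)) LV).
by rewrite (sqBC HH LPi (L2_control tT)).
Qed.

Lemma fbsde_solution_exists : exists X Y Z N, fbsde_solution P T W x0 b sigma f
    h X Y Z N.
Proof.
have L2Y t : (t <= T)%N -> L2 P (H t) (solution_Y t).
  rewrite leq_eqVlt /solution_Y => /orP[/eqP ->|tT].
    by rewrite ltnn; apply: L2_op_h; exact: L2_state.
  by rewrite tT; exact: (L2_usubmx (HPle (ltnW tT)) (L2_control tT)).
have resid_int t i : (t <= T)%N ->
    P.-integrable setT (EFin \o (fun w => residual t w i 0)).
  move=> tT; have := integrable_entry_mul i 0 (L2_L2m (HPle tT) (L2_residual
      tT))
    (L2_L2m (HPle tT) (L2_cst (HPle tT) (const_mx 1 : 'cV[R]_1))).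
  by congr (P.-integrable setT _); apply/funext => w /=; rewrite mxE mulr1.
have resid_incr t : (t < T)%N ->
    (forall i A, H t A -> \int[P]_w ((residual t.+1 - residual t) w i 0 * \1_A
        w) = 0) /\
    (forall i A, H t A -> \int[P]_w ((residual t.+1 w i 0 * (W t w + delta W t
        w)
      - residual t w i 0 * W t w) * \1_A w) = 0).
  move=> tT; exact: (orthogonal_noise_martingale (HPle (ltnW tT)) (HPle tT)
    (@history_mono _ _ _ _ _ t t.+1 (leqnSn t)) (noise_increment hW tT)
    (L2_residual (ltnW tT)) (L2_residual tT)
    (L2_noise_value hW (leqnn t) (ltnW tT)) (residual_orthogonal tT)).
exists state, solution_Y, solution_Z, residual; split.
- by move=> r /andP[_ rT]; exact: L2_state.
- by move=> r /andP[_ rT]; exact: L2Y.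
- move=> r /andP[_ rT]; have rT' : (r < T)%N by move: rT; rewrite -ltnS prednK.
  exact: (L2_dsubmx (HPle (ltnW rT')) (L2_control rT')).
- by move=> r /andP[_ rT]; exact: L2_residual.
- exact: aeW.
- move=> i; apply: (martingale_of_increments HPle (@history_mono _ _ _ P W)) =>
    [t tT|t A tT HA].
    by split; [exact: (L2_residual tT).1|exact: resid_int].
  have [+ _] := resid_incr t tT; move=> /(_ i A HA) <-.
  by apply: eq_Rintegral => w _; rewrite /delta !fctE !mxE.
- move=> i; apply: (martingale_of_increments HPle (@history_mono _ _ _ P W)) =>
    [t tT|t A tT HA].
    split.
      by apply: (measurable_wrtM (HPle tT)); [exact: (L2_residual tT).1|exact:
        noise_adapted].
    have := integrable_entry_mul i 0 (L2_L2m (HPle tT) (L2_residual tT))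
      (L2_L2m (HPle tT) (L2_noise_value hW (leqnn t) tT)).
    by congr (P.-integrable setT _); apply/funext => w /=; rewrite mxE.
  have [_ +] := resid_incr t tT; move=> /(_ i A HA) <-.
  by apply: eq_Rintegral => w _; rewrite /delta; ring.
- move=> t tT; apply: aeW => w; rewrite /delta /= /solution_Y /solution_Z tT.
  rewrite /next_state !fctE addrAC subrr add0r /noise_sum /op_bs /coef_bs /join.
  by rewrite !col_mxKu !col_mxKd.
- move=> t tT; have vE : {ae P, forall w, value t.+1 w = solution_Y t.+1 w +
      f t.+1 w (state t.+1 w) (solution_Y t.+1 w) (solution_Z t.+1 w)}.
    have [t1T|Tt] := ltnP t.+1 T.
      apply: aeW => w; rewrite /value (dec_step dec) ?t1T //.
      by rewrite /solution_Y t1T /solution_Z /op_f /coef_f /join !fctE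
        !(col_mxKu, col_mxKd).
    have TE : t.+1 = T by apply/eqP; rewrite eqn_leq tT.
    (* At t + 1 = T, [terminal_map] has 0 as last argument of f, whereas [solution_Z] has an
       unspecified value there. *)
    apply: filterS f_terminal_z => w fz.
    rewrite /value TE (dec_terminal dec) /terminal_map /solution_Y ltnn !fctE.
    rewrite /op_f /coef_f /join /pad !(col_mxKu, col_mxKd); congr (_ + _);
        exact: fz.
  apply: filterS vE => w vE.
  have -> : delta residual t w = value t.+1 w - noise t w.
    by rewrite /delta /= !fctE addrAC subrr add0r.
  rewrite vE /noise /noise_sum /delta {2}/solution_Y tT /solution_Z.
  by apply/colP => i; rewrite !mxE; ring.
- exact: aeW.
- by apply: aeW => w; rewrite /solution_Y ltnn.
Qed.

End solution.

(** * Uniqueness: every solution follows the decoupling field *)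

Section uniqueness.
Variables (Pi : nat -> rvn -> rvnn) (Phi : nat -> rvm -> rvn) (sol : nat -> rvm
    -> rvnn).
Hypothesis dec : decoupling Pi Phi sol.
Variable x0 : 'cV[R]_m.
Let HPle t (tT : (t <= T)%N) := history_complete hW tT.
Let Hsucc t : H t `<=` H t.+1 := @history_mono R d Omega P W t t.+1 (leqnSn t).

Section one_solution.
Variables (X : nat -> rvm) (Y Z N : nat -> rvn).
Hypothesis XYZN : fbsde_solution P T W x0 b sigma f h X Y Z N.

Definition control_of t : rvnn := fun w => col_mx (Y t w) (Z t w).

Let LX t (tT : (t <= T)%N) : L2 P (H t) (X t) := sol_X XYZN (r := t) tT.
Let LN t (tT : (t <= T)%N) : L2 P (H t) (N t) := sol_N XYZN (r := t) tT.

Let LU t : (t < T)%N -> L2 P (H t) (control_of t).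
Proof.
move=> tT; have LY : L2 P (H t) (Y t) by apply: (sol_Y XYZN); exact: ltnW.
have LZ : L2 P (H t) (Z t) by apply: (sol_Z XYZN); rewrite leq0n /= -ltnS
    prednK.
exact: (L2_col_mx (HPle (ltnW tT)) LY LZ).
Qed.

Lemma solution_orthogonal t V : (t < T)%N -> L2 P (H t) V ->
  ip (N t.+1 - N t) (noise_sum (delta W t) V) = 0.
Proof.
move=> tT; apply: (martingale_orthogonal_noise (HPle (ltnW tT)) (HPle tT)
  (Hsucc (t:=t)) (noise_increment hW tT) (LN (ltnW tT)) (LN tT)
  (L2_noise_value hW (leqnn t) (ltnW tT))).
- move=> i; have [NM _] := sol_N_martingale XYZN i.
  have := integrableB measurableT (NM _ tT).2 (NM _ (ltnW tT)).2.
  by congr (P.-integrable setT _); apply/funext => w; rewrite /= !fctE !mxE.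
- move=> i A HA.
  rewrite -[RHS](martingale_increment HPle (sol_N_martingale XYZN i) tT HA).
  by apply: eq_Rintegral => w _; rewrite /delta !fctE !mxE.
- move=> i A HA.
  rewrite -[RHS](martingale_increment HPle (sol_N_orthogonal XYZN i) tT HA).
  by apply: eq_Rintegral => w _; rewrite /delta; ring.
Qed.

Let value_ae t := {ae P, forall w,
  Phi t (X t) w = Y t w + f t w (X t w) (Y t w) (Z t w)}.

(** The backward equation makes Phi_{t+1}(X_{t+1}) equal to S U_t + dN_t. Applying Pi removes dN_t
    by orthogonality and S by isometry, and U_t remains. *)
Lemma solution_step t : (t < T)%N -> value_ae t.+1 ->
  solves t (Pi t) (Phi t.+1) (X t) (control_of t).
Proof.
move=> tT val; split; first exact: LU.
have GP := HPle (ltnW tT); have GP' := HPle tT.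
have HH := L2_semi_hilbert GP (n + n); have HH' := L2_semi_hilbert GP' n.
have xiP := noise_increment hW tT; have LUt := LU tT.
have LNX := L2_next_state GP GP' (Hsucc (t:=t)) xiP
  (fun X U LX LU => L2_op_bs tT LX LU) (LX (ltnW tT)) LUt.
set NX := next_state _ _ _ _ in LNX *.
have [L2Phi [L Phi_lip] _] := dec_admissible dec (t := t.+1) tT.
have LPhi := L2Phi _ LNX; have LPhiX := L2Phi _ (LX tT).
have XNX : {ae P, forall w, X t.+1 w = NX w}.
  apply: filterS (sol_forward XYZN tT) => w.
  rewrite /NX /next_state /noise_sum /op_bs /coef_bs /join /control_of /delta
      !fctE.
  by rewrite !(col_mxKu, col_mxKd) => <-; rewrite addrC subrK.
(* Phi acts on functions rather than on classes; its Lipschitz bound makes it respect almost sure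
   equality. *)
have Phi_ae : {ae P, forall w, (Phi t.+1 NX - Phi t.+1 (X t.+1)) w = 0}.
  apply: ip_eq0_ae; first exact: (L2_L2m GP' (L2B GP' LPhi LPhiX)).
  have := Phi_lip _ _ (LX tT) LNX.
  rewrite (ae_eq0_ip XNX (L2_L2m GP' (L2B GP' (LX tT) LNX))) mulr0 => le0.
  have := ip_ge0 HH' (domB HH' LPhi LPhiX); rewrite (sqBC HH' LPhi LPhiX) =>
      ge0.
  by apply/eqP; rewrite eq_le le0.
have LS := L2_noise_sum GP GP' (Hsucc (t:=t)) xiP LUt.
have LdN := L2B GP' (LN tT) (L2S (Hsucc (t:=t)) (LN (ltnW tT))).
have eta_ae : {ae P, forall w, Phi t.+1 NX w =
    (noise_sum (delta W t) (control_of t) + (N t.+1 - N t)) w}.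
  apply: filterS2 (ae_and Phi_ae val) (sol_backward XYZN tT) => w [e1 e2] e3.
  have -> : Phi t.+1 NX w = Phi t.+1 (X t.+1) w.
    by apply/eqP; rewrite -subr_eq0; apply/eqP; exact: e1.
  rewrite e2 /noise_sum /control_of !fctE col_mxKu col_mxKd.
  apply/colP => i; move: e3 => /colP/(_ i); rewrite /delta !mxE; lra.
have [LPi PiE] := dec_adjoint dec tT LPhi.
have orth V : L2 P (H t) V -> ip (control_of t - Pi t (Phi t.+1 NX)) V = 0.
  move=> LV; rewrite (ipBl HH LUt LPi LV) (PiE _ LV).
  have LSV := L2_noise_sum GP GP' (Hsucc (t:=t)) xiP LV.
  have -> : ip (Phi t.+1 NX) (noise_sum (delta W t) V) =
      ip (noise_sum (delta W t) (control_of t) + (N t.+1 - N t))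
         (noise_sum (delta W t) V).
    apply: ip_ae_eq.
    - exact: (L2_L2m GP' LPhi).
    - exact: (L2_L2m GP' LSV).
    - exact: (L2_L2m GP' (L2D GP' LS LdN)).
    - exact: (L2_L2m GP' LSV).
    - by apply: filterS eta_ae => w ->.
  rewrite (ipDl HH' LS LdN LSV) (solution_orthogonal tT LV) addr0.
  by rewrite (ip_noise_sum GP GP' (Hsucc (t:=t)) xiP LUt LV) subrr.
exact: orth (domB HH LUt LPi).
Qed.

(** Backward induction: the value at t + 1 makes U_t a solution of the step, uniqueness of the step
    identifies U_t with the field at X_t, and this gives the value at t. *)
Lemma solution_value k : (k < T)%N -> value_ae (T - k).
Proof.
elim: k => [|k IH] kT.
  rewrite subn0 /value_ae (dec_terminal dec).
  apply: filterS2 f_terminal_z (sol_terminal XYZN) => w fz YT.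
  rewrite /terminal_map !fctE /op_f /coef_f /join /pad !(col_mxKu, col_mxKd)
      /op_h YT.
  by congr (_ + _); exact: fz.
have tT : (T - k.+1 < T)%N by rewrite ltn_subrL /= (leq_trans _ kT).
have t1 : (1 <= T - k.+1)%N by rewrite subn_gt0.
have E : (T - k = (T - k.+1).+1)%N by rewrite subnSK // ltnW.
have valS := IH (ltnW kT); rewrite E in valS.
set t := (T - k.+1)%N in tT t1 valS *.
have s1 := solution_step tT valS.
have s2 := dec_solves dec tT (LX (ltnW tT)).
have adm := dec_admissible dec (t := t.+1) tT.
have X0 : sq (X t - X t) = 0.
  by rewrite subrr; exact: (ip0l (L2_semi_hilbert (HPle (ltnW tT)) m) (L2_cst
      (HPle (ltnW tT)) 0)).
have U0 := backward_step_unique tT (dec_adjoint dec tT) adm (LX (ltnW tT))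
  (LX (ltnW tT)) X0 s1 s2.
have LdU := L2B (HPle (ltnW tT)) s1.1 s2.1.
apply: filterS (ip_eq0_ae (L2_L2m (HPle (ltnW tT)) LdU) U0) => w.
rewrite fctE => /eqP; rewrite subr_eq0 => /eqP Uw.
have t1T : (1 <= t < T)%N by rewrite t1.
rewrite (dec_step dec t1T) !fctE /first_block /op_f /coef_f /join.
by rewrite !(col_mxKu, col_mxKd) -Uw /control_of !(col_mxKu, col_mxKd).
Qed.

Lemma solution_solves t : (t < T)%N ->
  solves t (Pi t) (Phi t.+1) (X t) (control_of t).
Proof.
move=> tT; apply: solution_step => //.
have := @solution_value (T - t.+1)%N; rewrite subKn //; apply.
by rewrite ltn_subrL /= hT.
Qed.

End one_solution.

(** Both solutions solve the same step equations, so equality propagates forwards: X_t determines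
    (Y_t, Z_t), and these determine X_{t+1}. Finally N is read off from the backward equation. *)
Lemma fbsde_solution_unique (X X' : nat -> rvm) (Y Y' Z Z' N N' : nat -> rvn) :
  fbsde_solution P T W x0 b sigma f h X Y Z N ->
  fbsde_solution P T W x0 b sigma f h X' Y' Z' N' ->
  (forall t, (t <= T)%N ->
    [/\ {ae P, forall w, X t w = X' t w},
        {ae P, forall w, Y t w = Y' t w} &
        {ae P, forall w, N t w = N' t w}]) /\
  (forall t, (t < T)%N -> {ae P, forall w, Z t w = Z' t w}).
Proof.
move=> S S'.
have controlE t : (t < T)%N -> {ae P, forall w, X t w = X' t w} ->
    {ae P, forall w, control_of Y Z t w = control_of Y' Z' t w}.
  move=> tT XX'; have GP := HPle (ltnW tT).
  have LX := sol_X S (r := t) (ltnW tT); have LX' := sol_X S' (r := t) (ltnW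
      tT).
  have s1 := solution_solves S tT; have s2 := solution_solves S' tT.
  have U0 := backward_step_unique tT (dec_adjoint dec tT)
    (dec_admissible dec (t := t.+1) tT) LX LX'
    (ae_eq0_ip XX' (L2_L2m GP (L2B GP LX LX'))) s1 s2.
  apply: filterS (ip_eq0_ae (L2_L2m GP (L2B GP s1.1 s2.1)) U0) => w.
  by rewrite fctE => /eqP; rewrite subr_eq0 => /eqP.
have stateE t : (t <= T)%N -> {ae P, forall w, X t w = X' t w}.
  elim: t => [|t IH] tT.
    by apply: filterS2 (sol_initial S) (sol_initial S') => w -> ->.
  have XX' := IH (ltnW tT).
  have fwd := ae_and (sol_forward S tT) (sol_forward S' tT).
  apply: filterS2 (ae_and XX' (controlE _ tT XX')) fwd => w [XX'w +] [fw fw'].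
  rewrite /control_of => /eq_col_mx[YY' ZZ'].
  rewrite -[LHS](subrK (X t w)) -[RHS](subrK (X' t w)) -/(delta X t w) -/(delta
      X' t w).
  by rewrite fw fw' XX'w YY' ZZ'.
have blocksE t : (t < T)%N -> {ae P, forall w, Y t w = Y' t w /\ Z t w = Z' t
    w}.
  move=> tT; apply: filterS (controlE _ tT (stateE _ (ltnW tT))) => w.
  by rewrite /control_of => /eq_col_mx.
have YE t : (t <= T)%N -> {ae P, forall w, Y t w = Y' t w}.
  rewrite leq_eqVlt => /orP[/eqP ->|tT]; last by apply: filterS (blocksE _ tT)
      => w [].
  apply: filterS2 (stateE _ (leqnn T)) (ae_and (sol_terminal S) (sol_terminal
      S')) => w.
  by move=> -> [-> ->].
have driverE t : (t < T)%N -> {ae P, forall w,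
    f t.+1 w (X t.+1 w) (Y t.+1 w) (Z t.+1 w) =
    f t.+1 w (X' t.+1 w) (Y' t.+1 w) (Z' t.+1 w)}.
  move=> tT; have [t1T|Tt] := ltnP t.+1 T.
    by apply: filterS2 (stateE _ tT) (blocksE _ t1T) => w -> [-> ->].
  (* Z_T and Z'_T may differ, but f(T, .) takes the same value at both. *)
  have -> : t.+1 = T by apply/eqP; rewrite eqn_leq tT.
  apply: filterS2 (ae_and (stateE _ (leqnn T)) (YE _ (leqnn T))) f_terminal_z
      => w.
  by move=> [-> ->] fz; exact: fz.
have NE t : (t <= T)%N -> {ae P, forall w, N t w = N' t w}.
  elim: t => [|t IH] tT; first by apply: filterS2 (sol_N0 S) (sol_N0 S') => w
      -> ->.
  have bwd := ae_and (sol_backward S tT) (sol_backward S' tT).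
  have ys := ae_and (YE _ tT) (blocksE _ tT).
  apply: filterS2 (ae_and (ae_and (IH (ltnW tT)) ys) (driverE _ tT)) bwd.
  move=> w [[NN' [Y1 [Y0 ZZ']]] ff] [bw bw'].
  move: bw bw'; rewrite /delta ff Y1 Y0 ZZ' NN' => -> /addrI /eqP.
  by rewrite -subr_eq0 opprB addrA subrK subr_eq0 => /eqP.
split=> [t tT|t tT]; first by split; [exact: stateE|exact: YE|exact: NE].
by apply: filterS (blocksE _ tT) => w [].
Qed.

End uniqueness.

End coefficients.

Theorem theorem4p1 (R : realType) (d : measure_display)
  (Omega : measurableType d) (P : probability Omega R)
  (T : nat) (hT : (1 <= T)%N)
  (W : nat -> Omega -> R) (hW : driving_noise P T W)
  (m n : nat) (x0 : 'cV[R]_m) (G : 'M[R]_(n, m)) (hG : \rank G = minn n m)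
  (b sigma : nat -> Omega -> 'cV[R]_m -> 'cV[R]_n -> 'cV[R]_n -> 'cV[R]_m)
  (f : nat -> Omega -> 'cV[R]_m -> 'cV[R]_n -> 'cV[R]_n -> 'cV[R]_n)
  (h : Omega -> 'cV[R]_m -> 'cV[R]_n)
  (* conventions *)
  (hbT : forall w x y z, b T w x y z = 0)
  (hsigmaT : forall w x y z, sigma T w x y z = 0)
  (hf0 : forall w x y z, f 0%N w x y z = 0)
  (* (i) Lipschitz continuity *)
  (c : R) (hc : 0 < c)
  (hLip : {ae P, forall w,
    (forall t x y z x' y' z', (t < T)%N ->
      [/\ enorm (b t w x y z - b t w x' y' z')
            <= c * enorm (stack x y z - stack x' y' z'),
          enorm (sigma t w x y z - sigma t w x' y' z')
            <= c * enorm (stack x y z - stack x' y' z'),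
          enorm (f t w x y z - f t w x' y' z')
            <= c * enorm (stack x y z - stack x' y' z') &
          enorm (coefA G b sigma f t w x y z
                 - coefA G b sigma f t w x' y' z')
            <= c * enorm (stack x y z - stack x' y' z')]) /\
    (forall x x', enorm (h w x - h w x') <= c * enorm (x - x')) /\
    (forall x y z x' y' z',
      enorm (f T w x y z - f T w x' y' z')
        <= c * (enorm (x - x') + enorm (y - y')))})
  (* (ii) adaptedness and integrability *)
  (hb2 : forall x y z,
    M2 P (history P W) 0 T.-1 (fun t w => b t w x y z))
  (hsigma2 : forall x y z,
    M2 P (history P W) 0 T.-1 (fun t w => sigma t w x y z))
  (hf2 : forall x y z,
    M2 P (history P W) 1 T (fun t w => f t w x y z))
  (hh2 : forall x, L2 P (history P W T) (fun w => h w x))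
  (* (iii) monotonicity *)
  (beta1 beta2 : R) (hbeta1 : 0 <= beta1) (hbeta2 : 0 <= beta2)
  (hbeta : 0 < beta1 + beta2)
  (hbeta_nm : (m < n)%N -> 0 < beta1) (hbeta_mn : (n < m)%N -> 0 < beta2)
  (hmon : forall t, (1 <= t <= T.-1)%N -> forall x y z x' y' z',
    {ae P, forall w,
      dot (coefA G b sigma f t w x y z - coefA G b sigma f t w x' y' z')
          (stack x y z - stack x' y' z')
      <= - beta1 * enorm (G *m (x - x')) ^+ 2
         - beta2 * enorm (G^T *m (y - y')) ^+ 2
         - beta2 * enorm (G^T *m (z - z')) ^+ 2})
  (hmonT : forall x y z x' y' z',
    {ae P, forall w,
      dot (- (G^T *m f T w x y z) + G^T *m f T w x' y' z') (x - x')
      <= - beta1 * enorm (G *m (x - x')) ^+ 2})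
  (hmon0 : forall x y z x' y' z',
    {ae P, forall w,
      dot (G *m b 0%N w x y z - G *m b 0%N w x' y' z') (y - y')
      + dot (G *m sigma 0%N w x y z - G *m sigma 0%N w x' y' z') (z - z')
      <= - beta2 * enorm (G^T *m (y - y')) ^+ 2
         - beta2 * enorm (G^T *m (z - z')) ^+ 2})
  (hmonh : forall x x',
    {ae P, forall w, 0 <= dot (h w x - h w x') (G *m (x - x'))}) :
  (exists X Y Z N, fbsde_solution P T W x0 b sigma f h X Y Z N) /\
  (forall X Y Z N X' Y' Z' N',
    fbsde_solution P T W x0 b sigma f h X Y Z N ->
    fbsde_solution P T W x0 b sigma f h X' Y' Z' N' ->
    (forall t, (t <= T)%N ->
      [/\ {ae P, forall w, X t w = X' t w},
          {ae P, forall w, Y t w = Y' t w} &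
          {ae P, forall w, N t w = N' t w}]) /\
    (forall t, (t < T)%N -> {ae P, forall w, Z t w = Z' t w})).
Proof.
have [Pi [Phi [sol dec]]] := decoupling_exists hT hW hc hLip hb2 hsigma2 hf2 hh2
  hbeta1 hbeta2 hmon hmonT hmon0 hmonh hG hbeta hbeta_nm hbeta_mn.
split; first exact: (fbsde_solution_exists hT hW hc hLip hb2 hsigma2 hh2
  dec x0).
move=> X Y Z N X' Y' Z' N'.
exact: (fbsde_solution_unique hT hW hc hLip hb2 hsigma2 hbeta1 hbeta2 hmon hmon0
  hG hbeta hbeta_nm hbeta_mn dec).
Qed.
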